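(* For any $K>0$ there exist constants $C_1,C_2>0$ depending only on $K$ such that the following holds. Let $\mathbf{X}\in\mathbb{R}^p$ be a mean-zero, $K$-subgaussian random vector with covariance matrix $\boldsymbol{\Sigma}=\mathbb{E}(\mathbf{X}\mathbf{X}^T)\in\mathbb{R}^{p\times p}$. Let $\mathbf{X}_0,\dots,\mathbf{X}_n$ be i.i.d. copies of $\mathbf{X}$ and let $\mathbf{M}\in[0,1]^{p\times p}$ be a fixed symmetric matrix (mask). If the dithering parameters $\tilde\lambda_k\ge0$ satisfy $\tilde\lambda_k^2=C_1\log(k)\lambda_k^2$, where $\lambda_k=\frac1k\sum_{j=0}^{k-1}\|\mathbf{X}_j\|_\infty$ for $1\le k\le n$, and $\boldsymbol{\Sigma}^{\mathrm{adap}}_n$ is the corresponding adaptively dithered one-bit estimator (defined in the context), then for any $\theta\ge C_2\max\{\log(p),\log(n)\}$ we have with probability at least $1-2e^{-\theta}$ $$\|\mathbf{M}\odot\boldsymbol{\Sigma}^{\mathrm{adap}}_n-\mathbf{M}\odot\boldsymbol{\Sigma}\|\lesssim_K\log(p)\log(n)\left(\theta^{5/2}\frac{\|\mathbf{M}\|_{1\to2}}{\sqrt n}\|\boldsymbol{\Sigma}\|_\infty^{1/2}\|\boldsymbol{\Sigma}\|^{1/2}+\theta^3\frac{\|\mathbf{M}\|}{n}\|\boldsymbol{\Sigma}\|_\infty\right).$$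
   Context: $a\lesssim_K b$ means $a\le C_K b$ for a constant $C_K>0$ depending only on $K$. A mean-zero random vector $\mathbf{X}$ in $\mathbb{R}^p$ is $K$-subgaussian if $\|\langle\mathbf{X},\mathbf{x}\rangle\|_{\psi_2}\le K(\mathbb{E}\langle\mathbf{X},\mathbf{x}\rangle^2)^{1/2}$ for all $\mathbf{x}\in\mathbb{R}^p$, where $\|X\|_{\psi_2}=\inf\{t>0:\mathbb{E}\exp(X^2/t^2)\le 2\}$. For a matrix $\mathbf{Z}$, $\|\mathbf{Z}\|$ is the operator norm (with respect to Euclidean norms), $\|\mathbf{Z}\|_\infty=\max_{i,j}|Z_{i,j}|$, and $\|\mathbf{Z}\|_{1\to2}$ is the maximum Euclidean norm of a column of $\mathbf{Z}$; for a vector, $\|\cdot\|_\infty$ is the maximum norm. $\odot$ is the entry-wise (Hadamard) product. $\mathrm{sign}$ acts entry-wise, with $\mathrm{sign}(x)=1$ if $x\ge0$ and $-1$ if $x<0$. Dithers: for $1\le k\le n$ the vectors $\boldsymbol{\tau}_k,\bar{\boldsymbol{\tau}}_k$ are independent and uniformly distributed in $[-\tilde\lambda_k,\tilde\lambda_k]^p$; they depend on the previous samples only via $\tilde\lambda_k$ and are independent of $\mathbf{X}_k$ and all future samples. That is, $\boldsymbol{\tau}_k=\tilde\lambda_k\mathbf{U}_k$ and $\bar{\boldsymbol{\tau}}_k=\tilde\lambda_k\bar{\mathbf{U}}_k$, where $\mathbf{U}_1,\bar{\mathbf{U}}_1,\dots,\mathbf{U}_n,\bar{\mathbf{U}}_n$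 are i.i.d. uniform on $[-1,1]^p$ and independent of $\mathbf{X}_0,\dots,\mathbf{X}_n$. Estimator: $\boldsymbol{\Sigma}^{\mathrm{adap}}_n=\frac12\boldsymbol{\Sigma}'_n+\frac12(\boldsymbol{\Sigma}'_n)^T$ with $$\boldsymbol{\Sigma}'_n=\sum_{k=1}^n\frac{\tilde\lambda_k^2}{n}\,\mathrm{sign}(\mathbf{X}_k+\boldsymbol{\tau}_k)\,\mathrm{sign}(\mathbf{X}_k+\bar{\boldsymbol{\tau}}_k)^T.$$
   Formalization: The formal theorem assumes p ≥ 2 and n ≥ 2, since for p = 1 or n = 1 the factor log(p)log(n) makes the right-hand side zero and the claimed bound fails (e.g. n = 1 gives estimator 0 but M⊙Σ ≠ 0). *)

(* Defs.v *)
From HB Require Import structures.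
From mathcomp Require Import all_boot all_order all_algebra.
From mathcomp Require Import all_classical all_reals all_analysis.

Set Implicit Arguments.
Unset Strict Implicit.
Unset Printing Implicit Defensive.

Import Order.TTheory GRing.Theory Num.Theory.
Import numFieldNormedType.Exports.

Local Open Scope classical_set_scope.
Local Open Scope ring_scope.

Section deterministic.
Context {R : realType}.

Definition dot p (x y : 'cV[R]_p) : R := \sum_i x i 0 * y i 0.

Definition norm2 p (x : 'cV[R]_p) : R := Num.sqrt (dot x x).

Definition opnorm m p (Z : 'M[R]_(m, p)) : R :=
  sup [set norm2 (Z *m x) | x in [set x : 'cV[R]_p | norm2 x <= 1]].

(* The maximal entry norm of a matrix or vector is the library's [mx_norm]. *)

Definition norm12 m p (Z : 'M[R]_(m, p)) : R :=
  \big[Num.max/0]_(j < p) norm2 (col j Z).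

Definition hadamard m p (A B : 'M[R]_(m, p)) : 'M[R]_(m, p) :=
  map2_mx *%R A B.

(* Unlike [Num.sg], the value at 0 is 1. *)
Definition sign1 (x : R) : R := if 0 <= x then 1 else -1.

Definition sign_mx m p (Z : 'M[R]_(m, p)) : 'M[R]_(m, p) := map_mx sign1 Z.

Definition colvec p (t : p.-tuple R) : 'cV[R]_p := \col_i tnth t i.

(* Indexing: the samples are x_0, ..., x_n, indexed by 'I_n.+1, whereas objects
   indexed mathematically by 1 <= k <= n are indexed by k : 'I_n, the element
   k : 'I_n standing for k + 1. Hence the sample paired with k : 'I_n is
   x (lift ord0 k), i.e. x_(k+1), and lambda_(k+1) averages over x_0, ..., x_k. *)
Definition running_mean n p (x : 'I_n.+1 -> 'cV[R]_p) (k : 'I_n) : R :=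
  k.+1%:R^-1 * \sum_(j < n.+1 | (j < k.+1)%N) mx_norm (x j).

Definition onebit_sum n p (x : 'I_n.+1 -> 'cV[R]_p)
    (tau taub : 'I_n -> 'cV[R]_p) (lam : 'I_n -> R) : 'M[R]_p :=
  \sum_(k < n) (lam k ^+ 2 / n%:R) *:
    (sign_mx (x (lift ord0 k) + tau k) *m
     (sign_mx (x (lift ord0 k) + taub k))^T).

Definition onebit_estimator n p (x : 'I_n.+1 -> 'cV[R]_p)
    (tau taub : 'I_n -> 'cV[R]_p) (lam : 'I_n -> R) : 'M[R]_p :=
  let S := onebit_sum x tau taub lam in 2^-1 *: S + 2^-1 *: S^T.

End deterministic.

(* Random vectors in R^p are measurable maps into [p.-tuple R], which carries
   the product (= Borel) sigma-algebra. *)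

Section probabilistic.
Context {R : realType}.

Definition same_law d d0 d' (T : measurableType d) (T0 : measurableType d0)
    (S : measurableType d') (P : probability T R) (P0 : probability T0 R)
    (Y : {RV P >-> S}) (Y0 : {RV P0 >-> S}) : Prop :=
  forall A : set S, measurable A -> distribution P Y A = distribution P0 Y0 A.

Definition mutually_independent d d' (T : measurableType d)
    (S : measurableType d') (P : probability T R) (I : finType)
    (Y : I -> {RV P >-> S}) : Prop :=
  forall (J : {set I}) (A : I -> set S), (forall i, measurable (A i)) ->
    P (\bigcap_(i in [set` J]) (Y i @^-1` A i))
    = (\prod_(i in J) P (Y i @^-1` A i))%E.

(* The uniform law on [-1, 1]^p, as the p-fold product of the uniform law on
   [-1, 1]. *)
Definition uniform_cube d (T : measurableType d) (P : probability T R) p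
    (U : {RV P >-> p.-tuple R}) : Prop :=
  forall A : 'I_p -> set R, (forall i, measurable (A i)) ->
    P [set w | forall i, A i (tnth (U w) i)]
    = (\prod_(i < p) uniform_prob (gtrN (@ltr01 R)) (A i))%E.

Section one_space.
Context d (T : measurableType d) (P : probability T R).

(* The infimum is taken in the extended reals, so it is +oo when no t > 0
   qualifies. *)
Definition psi2_norm (Y : T -> R) : \bar R :=
  ereal_inf [set t%:E | t in [set t : R | 0 < t /\
    ('E_P[fun w => expR (Y w ^+ 2 / t ^+ 2)%R] <= 2%:E)%E]].

Variable p : nat.

Definition square_integrable_vec (X : {RV P >-> p.-tuple R}) : Prop :=
  forall i : 'I_p, (fun w => tnth (X w) i) \in Lfun P 2%:E.

Definition mean_zero (X : {RV P >-> p.-tuple R}) : Prop :=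
  forall i : 'I_p, ('E_P[fun w => tnth (X w) i] = 0)%E.

Definition subgaussian (K : R) (X : {RV P >-> p.-tuple R}) : Prop :=
  forall x : 'cV[R]_p,
    (psi2_norm (fun w => dot (colvec (X w)) x) <=
     (K * Num.sqrt (fine 'E_P[fun w => (dot (colvec (X w)) x ^+ 2)%R]))%:E)%E.

Definition covmx (X : {RV P >-> p.-tuple R}) : 'M[R]_p :=
  \matrix_(i, j) fine ('E_P[fun w => (colvec (X w) *m (colvec (X w))^T) i j])%E.

Definition samples_and_dithers n (X : 'I_n.+1 -> {RV P >-> p.-tuple R})
    (U Ub : 'I_n -> {RV P >-> p.-tuple R}) (i : 'I_n.+1 + ('I_n + 'I_n)) :
    {RV P >-> p.-tuple R} :=
  match i with
  | inl j => X j
  | inr (inl k) => U k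
  | inr (inr k) => Ub k
  end.

(* The dithers are tau_k = lam_k U_k and taub_k = lam_k Ub_k. *)
Definition adaptive_estimator n (X : 'I_n.+1 -> {RV P >-> p.-tuple R})
    (U Ub : 'I_n -> {RV P >-> p.-tuple R}) (lam : 'I_n -> T -> R) (w : T) :
    'M[R]_p :=
  onebit_estimator (fun j => colvec (X j w))
    (fun k => lam k w *: colvec (U k w))
    (fun k => lam k w *: colvec (Ub k w))
    (fun k => lam k w).

End one_space.

End probabilistic.

(* Main.v *)
(* Given the past, the dither turns [l * sign (x + l u)] into [clip l x] on
   average, so one summand of the estimator has mean [Sigma] up to a bias
   [exp (- l ^ 2 / (4 a))] with [a] of order [|Sigma|_oo].  After the first
   [O(theta)] samples the running mean of [|X_j|_oo] is bounded below by a
   multiple of [|Sigma|_oo ^ (1 / 2)], so that the level [l] makes the bias at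
   step [k] at most [k ^ -2]; before that the bias is bounded trivially.  Hence
   the biases sum to [O(theta)].

   The fluctuations are handled by a matrix Laplace transform adapted to the
   filtration.  Instead of [exp A] it uses [(1 + A / N) ^ N] with [N] a power of
   2, so that the Golden-Thompson inequality becomes
   [tr ((X Y) ^ N) <= tr (X ^ N Y ^ N)] for symmetric [X] and [Y], which follows
   from Cauchy-Schwarz for the Frobenius product by induction on [log2 N]; no
   spectral theorem is needed.  The conditional second moment of a step comes
   from [sum_l w_l^T Sigma w_l <= |Sigma| |M|_{1->2} ^ 2 |v| ^ 2], where
   [w_l = (M_li v_i)_i]. *)

Require Import Defs.
From HB Require Import structures.
From mathcomp Require Import all_boot all_order all_algebra.
From mathcomp Require Import all_classical all_reals all_analysis.
From mathcomp Require Import measurable_realfun ring lra.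

Set Implicit Arguments.
Unset Strict Implicit.
Unset Printing Implicit Defensive.

Import Order.TTheory GRing.Theory Num.Theory.
Import numFieldNormedType.Exports.

Local Open Scope classical_set_scope.
Local Open Scope ring_scope.

(** * Matrix inequalities *)

(** The obstacle is that the dithering levels are random and unbounded, whereas the Laplace
    transform argument needs increments of operator norm at most 1. Steps whose level exceeds [L],
    or whose bias factor exceeds [b k], are therefore set to 0; when every level is good, the
    modified sum is the true error. The increments are scaled by [eta], which is $\pm1/D$. Here [D]
    adds a worst-case step size, of order $L^2\|M\|$, and a bound for the standard deviation over
    all steps, divided by $\sqrt\theta$. With this scale the conditional rates sum to $O(\theta)$, a
    deviation of order $\theta$ is exponentially unlikely, and $\theta D/n$ splits into the two
    terms of the rate. The lower bound on the running means comes from one coordinate of maximal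
    variance, whose mean absolute value is bounded below through its second and fourth moments. Four
    events of probability at most $e^{-\theta}/2$ are discarded: a large sample, a small running
    mean, and a matrix deviation of either sign. *)

Section euclid.
Context {R : realType}.
Implicit Types p : nat.

Lemma discriminant_le (a b c : R) : 0 <= c ->
  (forall t, 0 <= a + 2 * t * b + t ^+ 2 * c) -> b ^+ 2 <= a * c.
Proof.
rewrite le_eqVlt => /predU1P[<-|c0] H; last first.
  have := H (- b / c).
  have -> : a + 2 * (- b / c) * b + (- b / c) ^+ 2 * c = (a * c - b ^+ 2) / c.
    by field; rewrite gt_eqF.
  by rewrite pmulr_lge0 ?invr_gt0// subr_ge0.
rewrite mulr0 le_eqVlt; apply/orP; left; rewrite sqrf_eq0.
(* For $c=0$ the polynomial is affine in $t$; if $b\ne0$, this $t$ gives it the value $-1$. *)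
apply/negPn/negP => bn; have := H (- (a + 1) / (2 * b)).
have -> : a + 2 * (- (a + 1) / (2 * b)) * b + (- (a + 1) / (2 * b)) ^+ 2 * 0 = -1.
  by field.
lra.
Qed.

Lemma dotC p (x y : 'cV[R]_p) : dot x y = dot y x.
Proof. by apply: eq_bigr => i _; rewrite mulrC. Qed.

Lemma dotDl p (x y z : 'cV[R]_p) : dot (x + y) z = dot x z + dot y z.
Proof. by rewrite -big_split; apply: eq_bigr => i _; rewrite mxE mulrDl. Qed.

Lemma dotZl p a (x y : 'cV[R]_p) : dot (a *: x) y = a * dot x y.
Proof. by rewrite mulr_sumr; apply: eq_bigr => i _; rewrite mxE mulrA. Qed.

Lemma dotDr p (x y z : 'cV[R]_p) : dot x (y + z) = dot x y + dot x z.
Proof. by rewrite dotC dotDl !(dotC x). Qed.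

Lemma dotZr p a (x y : 'cV[R]_p) : dot x (a *: y) = a * dot x y.
Proof. by rewrite dotC dotZl dotC. Qed.

Lemma dot_ge0 p (x : 'cV[R]_p) : 0 <= dot x x.
Proof. by apply: sumr_ge0 => i _; rewrite -expr2 sqr_ge0. Qed.

Lemma dotE p (x y : 'cV[R]_p) : dot x y = \tr (x^T *m y).
Proof.
by rewrite /mxtrace big_ord1 mxE; apply: eq_bigr => i _; rewrite mxE.
Qed.

Lemma dot_mulmx m p (A : 'M[R]_(m, p)) x y :
  dot (A *m x) y = dot x (A^T *m y).
Proof. by rewrite !dotE trmx_mul mulmxA. Qed.

Lemma dot_delta p (x : 'cV[R]_p) i : dot x (delta_mx i 0) = x i 0.
Proof.
rewrite /dot (bigD1 i)//= mxE !eqxx mulr1 big1 ?addr0// => j ji.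
by rewrite mxE (negbTE ji) mulr0.
Qed.

Lemma dot_deltal p (x : 'cV[R]_p) i : dot (delta_mx i 0) x = x i 0.
Proof. by rewrite dotC dot_delta. Qed.

Lemma mulmx_delta m p (A : 'M[R]_(m, p)) i : A *m delta_mx i 0 = col i A.
Proof. by rewrite colE. Qed.

Lemma dot_sqr_le p (x y : 'cV[R]_p) : dot x y ^+ 2 <= dot x x * dot y y.
Proof.
apply: discriminant_le (dot_ge0 _) _ => t.
have := dot_ge0 (x + t *: y).
rewrite !dotDl !dotDr !dotZl !dotZr (dotC y x).
by rewrite (_ : _ + _ + _ = dot x x + 2 * t * dot x y + t ^+ 2 * dot y y)//; ring.
Qed.

Lemma norm2_ge0 p (x : 'cV[R]_p) : 0 <= norm2 x.
Proof. exact: sqrtr_ge0. Qed.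

Lemma norm2_sqr p (x : 'cV[R]_p) : norm2 x ^+ 2 = dot x x.
Proof. by rewrite sqr_sqrtr// dot_ge0. Qed.

Lemma norm2_leP p (x : 'cV[R]_p) c : 0 <= c ->
  (norm2 x <= c) = (dot x x <= c ^+ 2).
Proof. by move=> c0; rewrite -norm2_sqr ler_sqr// nnegrE ?norm2_ge0. Qed.

Lemma dot_le p (x y : 'cV[R]_p) : `|dot x y| <= norm2 x * norm2 y.
Proof.
rewrite -ler_sqr ?nnegrE ?mulr_ge0 ?norm2_ge0//.
by rewrite exprMn !norm2_sqr -normrX ger0_norm ?sqr_ge0 ?dot_sqr_le.
Qed.

Lemma norm2D p (x y : 'cV[R]_p) : norm2 (x + y) <= norm2 x + norm2 y.
Proof.
rewrite norm2_leP ?addr_ge0 ?norm2_ge0//.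
rewrite !dotDl !dotDr (dotC y x) sqrrD !norm2_sqr mulr2n.
by have := le_trans (ler_norm _) (dot_le x y); lra.
Qed.

Lemma norm2Z p a (x : 'cV[R]_p) : norm2 (a *: x) = `|a| * norm2 x.
Proof.
by rewrite /norm2 dotZl dotZr mulrA -expr2 sqrtrM ?sqr_ge0// sqrtr_sqr.
Qed.

Lemma norm2_delta p (i : 'I_p) : norm2 (delta_mx i 0 : 'cV[R]_p) = 1.
Proof. by rewrite /norm2 dot_delta mxE !eqxx sqrtr1. Qed.

Lemma norm2_eq0 p (x : 'cV[R]_p) : norm2 x = 0 -> x = 0.
Proof.
move=> h; have : dot x x = 0 by rewrite -norm2_sqr h expr0n.
move/eqP; rewrite psumr_eq0 => [/allP H|i _]; last by rewrite -expr2 sqr_ge0.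
apply/matrixP => i j; rewrite (ord1 j) mxE; apply/eqP.
by have := H i (mem_index_enum _); rewrite /= -expr2 sqrf_eq0.
Qed.

(** A bound that need not be optimal passes through sums, products and powers without handling a
    supremum; [opnorm_le] and [opbound_opnorm] translate to and from [opnorm]. *)
Definition opbound m p (Z : 'M[R]_(m, p)) (c : R) :=
  forall x, norm2 (Z *m x) <= c * norm2 x.

Lemma opboundD m p (Y Z : 'M[R]_(m, p)) b c :
  opbound Y b -> opbound Z c -> opbound (Y + Z) (b + c).
Proof.
move=> Yb Zc x; rewrite mulmxDl mulrDl.
by apply: le_trans (norm2D _ _) _; apply: lerD.
Qed.

Lemma opboundZ m p (Z : 'M[R]_(m, p)) a c :
  opbound Z c -> opbound (a *: Z) (`|a| * c).
Proof.
by move=> Zc x; rewrite -scalemxAl norm2Z -mulrA ler_wpM2l.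
Qed.

Lemma opbound_le m p (Z : 'M[R]_(m, p)) b c :
  b <= c -> opbound Z b -> opbound Z c.
Proof.
by move=> bc Zb x; apply: le_trans (Zb x) _; rewrite ler_wpM2r ?norm2_ge0.
Qed.

Lemma opboundM m p q (Y : 'M[R]_(m, p)) (Z : 'M[R]_(p, q)) b c : 0 <= b ->
  opbound Y b -> opbound Z c -> opbound (Y *m Z) (b * c).
Proof.
move=> b0 Yb Zc x; rewrite -mulmxA -mulrA.
by apply: le_trans (Yb _) _; rewrite ler_wpM2l.
Qed.

Lemma opbound1 p : opbound (1 : 'M[R]_p) 1.
Proof. by move=> x; rewrite mul1mx mul1r. Qed.

Lemma opboundX p (Z : 'M[R]_p) c k : 0 <= c ->
  opbound Z c -> opbound (Z ^+ k) (c ^+ k).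
Proof.
move=> c0 Zc; elim: k => [|k IH]; first exact: opbound1.
by rewrite !exprS; apply: opboundM.
Qed.

Lemma opbound_sum m p I (r : seq I) (Z : I -> 'M[R]_(m, p)) c :
  (forall i, opbound (Z i) (c i)) ->
  opbound (\sum_(i <- r) Z i) (\sum_(i <- r) c i).
Proof.
move=> Zc; elim/big_ind2 : _ => //; last by move=> *; apply: opboundD.
by move=> x; rewrite mul0mx mul0r /norm2 /dot big1 ?sqrtr0// => i _; rewrite mxE mul0r.
Qed.

Lemma opbound_trace p (Z : 'M[R]_p) c : opbound Z c -> `|\tr Z| <= p%:R * c.
Proof.
move=> Zc; apply: le_trans (ler_norm_sum _ _ _) _.
rewrite -[p in p%:R]card_ord mulrC mulr_natr -sumr_const.
apply: ler_sum => i _.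
have -> : Z i i = dot (delta_mx i 0) (Z *m delta_mx i 0).
  by rewrite dot_deltal mulmx_delta mxE.
apply: le_trans (dot_le _ _) _; rewrite norm2_delta mul1r.
by apply: le_trans (Zc _) _; rewrite norm2_delta mulr1.
Qed.

(** Polarization: $4\langle v,Zu\rangle$ is the difference of the quadratic form at $u+v$ and at
    $u-v$, and the parallelogram law adds up the two bounds. *)
Lemma sym_opbound p (Z : 'M[R]_p) c : 0 <= c -> Z^T = Z ->
  (forall x, `|dot x (Z *m x)| <= c * dot x x) -> opbound Z c.
Proof.
move=> c0 sZ H.
have polar u v : dot v (Z *m u) <= c / 2 * (dot u u + dot v v).
  have := le_trans (ler_norm _) (H (u + v)).
  have := le_trans (ler_norm _) (H (u + (-1) *: v)).
  have := H (u + (-1) *: v).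
  rewrite ler_norml => /andP[h1 h2] h3 h4.
  have e : dot u (Z *m v) = dot v (Z *m u).
    by rewrite dotC dot_mulmx sZ.
  move: h1 h2 h3 h4; rewrite !mulmxDr -!scalemxAr.
  rewrite !dotDl !dotDr !dotZl !dotZr e (dotC v u); lra.
move=> x; set y := Z *m x.
have [h|h] := eqVneq (norm2 y) 0; first by rewrite h mulr_ge0 ?norm2_ge0.
have h0 : 0 < norm2 y by rewrite lt_def h norm2_ge0.
have [x0|x0] := eqVneq (norm2 x) 0.
  by move: h; rewrite /y (norm2_eq0 x0) mulmx0 /norm2 /dot big1 ?sqrtr0 ?eqxx// => i _; rewrite mxE mul0r.
have x0' : 0 < norm2 x by rewrite lt_def x0 norm2_ge0.
(* The scaling gives both arguments the same norm, so that the sum of squares in [polar] is twice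
   their product. *)
have := polar (norm2 y *: x) (norm2 x *: y).
rewrite -scalemxAr !dotZl !dotZr -/y -!norm2_sqr.
set a := norm2 y; set b := norm2 x => hp.
rewrite -(ler_pM2l (_ : 0 < a ^+ 2 * b)) ?mulr_gt0 ?exprn_gt0//.
move: hp; rewrite /a /b; nra.
Qed.

End euclid.

(** * Trace inequalities for exponents that are powers of 2 *)

Section trace_inequalities.
Context {R : realType}.
Implicit Types p k n : nat.

Lemma trmxX p (A : 'M[R]_p) n : (A ^+ n)^T = A^T ^+ n.
Proof.
elim: n => [|n IH]; first by rewrite !expr0 trmx1.
by rewrite exprS exprSr -!mulmxE trmx_mul IH.
Qed.

Lemma mxtrace_mulXC p (A B : 'M[R]_p) n : \tr ((A * B) ^+ n) = \tr ((B * A) ^+ n).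
Proof.
case: n => [|n]; first by rewrite !expr0.
have H k : (A * B) ^+ k * A = A * (B * A) ^+ k.
  elim: k => [|k IH]; first by rewrite !expr0 mul1r mulr1.
  by rewrite !exprSr [RHS]mulrA -IH !mulrA.
by rewrite exprSr mulrA H -!mulmxE -mulmxA mxtrace_mulC -mulmxA !mulmxE -exprSr.
Qed.

Lemma mxtrace_mulT_ge0 m p (A : 'M[R]_(m, p)) : 0 <= \tr (A *m A^T).
Proof.
apply: sumr_ge0 => i _; rewrite mxE; apply: sumr_ge0 => j _.
by rewrite mxE -expr2 sqr_ge0.
Qed.

Lemma mxtrace_mul_le p (A B : 'M[R]_p) :
  2 * \tr (A * B) <= \tr (A * A^T) + \tr (B * B^T).
Proof.
have := mxtrace_mulT_ge0 (A - B^T).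
rewrite linearB /= trmxK mulmxBl !mulmxBr !linearB /= -!mulmxE.
rewrite (mxtrace_mulC B^T B) -[\tr (B^T *m A^T)]mxtrace_tr trmx_mul !trmxK; lra.
Qed.

(** The two claims are proved together because each one, at the next exponent, uses the other at the
    present one. *)
Let mxtrace_exp2 p k : (forall W : 'M[R]_p,
     \tr (W ^+ (2 ^ k.+1)) <= \tr ((W * W^T) ^+ (2 ^ k))) /\
  (forall X Y : 'M[R]_p, X^T = X -> Y^T = Y ->
     \tr ((X * Y) ^+ (2 ^ k)) <= \tr (X ^+ (2 ^ k) * Y ^+ (2 ^ k))).
Proof.
elim: k => [|k [L P]].
  split=> [W|X Y _ _]; last by rewrite !expr1.
  rewrite expr1 expr2; have := mxtrace_mul_le W W; lra.
split=> [W|X Y sX sY].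
  (* The first claim is applied to $W^2$. By cyclicity the result is $\mathrm{tr}\,(SS')^{2^k}$ with
     $S=WW^T$ and $S'=W^TW$; the second claim separates $S$ and $S'$, whose powers have equal
     traces. *)
  rewrite expnS exprM; apply: le_trans (L _) _.
  rewrite expr2 -!mulmxE trmx_mul !mulmxE -!mulrA mxtrace_mulXC.
  rewrite (mulrA W) -(mulrA _ _ W).
  apply: le_trans (P _ _ _ _) _; rewrite -?mulmxE ?trmx_mul ?trmxK//.
  rewrite mulmxE; set S := W *m W^T; set S' := W^T *m W.
  have sS : S^T = S by rewrite trmx_mul trmxK.
  have sS' : S'^T = S' by rewrite trmx_mul trmxK.
  have := mxtrace_mul_le (S ^+ (2 ^ k)) (S' ^+ (2 ^ k)).
  rewrite !trmxX sS sS' -!exprD addnn -mul2n -expnS.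
  have -> : \tr (S' ^+ (2 ^ k.+1)) = \tr (S ^+ (2 ^ k.+1)).
    by rewrite /S /S' !mulmxE mxtrace_mulXC.
  lra.
(* For $W=XY$ the product $WW^T=XY^2X$ becomes $X^2Y^2$ after a cyclic shift, to which the second
   claim applies. *)
apply: le_trans (L _) _.
rewrite -!mulmxE trmx_mul sX sY !mulmxE -mulrA mxtrace_mulXC.
rewrite mulrA -mulrA -!expr2.
rewrite mxtrace_mulXC; apply: le_trans (P _ _ _ _) _; rewrite ?trmxX ?sX ?sY//.
by rewrite -!exprM -expnS.
Qed.

Lemma mxtrace_mulX2_le p k (X Y : 'M[R]_p) : X^T = X -> Y^T = Y ->
  \tr ((X * Y) ^+ (2 ^ k)) <= \tr (X ^+ (2 ^ k) * Y ^+ (2 ^ k)).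
Proof. exact: (mxtrace_exp2 p k).2. Qed.

(** Iterated Cauchy-Schwarz: $\langle x,Hx\rangle^2\le|Hx|^2=\langle x,H^2x\rangle$ for unit $x$ and
    symmetric $H$. It replaces the comparison of a Rayleigh quotient with an eigenvalue. *)
Lemma dot_X2_le p k (G : 'M[R]_p) x : G^T = G -> norm2 x = 1 ->
  dot x (G *m x) ^+ (2 ^ k) <= `|dot x (G ^+ (2 ^ k) *m x)|.
Proof.
move=> sG x1; apply: le_trans (ler_norm _) _; rewrite normrX.
elim: k => [|k IH]; first by rewrite !expr1.
rewrite expnSr exprM.
apply: le_trans (lerXn2r 2 _ _ IH) _; rewrite ?nnegrE ?exprn_ge0//.
have := dot_sqr_le x (G ^+ (2 ^ k) *m x).
rewrite -!norm2_sqr x1 expr1n mul1r norm2_sqr dot_mulmx trmxX sG mulmxA mulmxE.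
rewrite -exprD addnn -muln2 => h.
by rewrite -normrX ger0_norm ?sqr_ge0//; apply: le_trans h _; rewrite ler_norm.
Qed.

Lemma sum_dot_col m p (G : 'M[R]_(m, p)) :
  \sum_i dot (col i G) (col i G) = \tr (G *m G^T).
Proof.
rewrite mxtrace_mulC; apply: eq_bigr => i _; rewrite mxE.
by apply: eq_bigr => j _; rewrite !mxE.
Qed.

Lemma mxtrace_conj p (G Q : 'M[R]_p) :
  \tr (G^T *m Q *m G) = \sum_i dot (col i G) (Q *m col i G).
Proof.
apply: eq_bigr => i _.
by rewrite -!mulmx_delta dot_mulmx dot_deltal !mulmxA mulmx_delta [RHS]mxE.
Qed.

Lemma dot_mulmx_trace_le m p (G : 'M[R]_(m, p)) x :
  dot (G *m x) (G *m x) <= \tr (G *m G^T) * dot x x.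
Proof.
rewrite /dot mulr_suml; apply: ler_sum => i _.
rewrite -expr2.
have -> : (G *m x) i 0 = dot (row i G)^T x.
  by rewrite mxE; apply: eq_bigr => j _; rewrite !mxE.
apply: le_trans (dot_sqr_le _ _) _; rewrite ler_wpM2r ?dot_ge0// mxE.
by rewrite le_eqVlt; apply/orP; left; apply/eqP; apply: eq_bigr => j _; rewrite !mxE.
Qed.

(** The quadratic form of $G^{2^{k+1}}$ at $x$ is $|G^{2^k}x|^2$, at most the squared Frobenius norm
    of $G^{2^k}$. Thus a trace controls every direction at once. *)
Lemma dot_X2_le_trace p k (G : 'M[R]_p) x : G^T = G -> norm2 x = 1 ->
  dot x (G *m x) ^+ (2 ^ k.+1) <= \tr (G ^+ (2 ^ k.+1)).
Proof.
move=> sG x1; apply: le_trans (dot_X2_le _ sG x1) _.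
have sGk : (G ^+ (2 ^ k))^T = G ^+ (2 ^ k) by rewrite trmxX sG.
rewrite expnS mul2n -addnn exprD -mulmxA -[X in X *m (_ *m _)]sGk -dot_mulmx.
rewrite ger0_norm ?dot_ge0//; apply: le_trans (dot_mulmx_trace_le _ _) _.
by rewrite -norm2_sqr x1 expr1n mulr1 sGk.
Qed.

End trace_inequalities.

(** * The power $(1+B/N)^N$ as a substitute for the matrix exponential *)

Section truncated_exponential.
Context {R : realType}.
Implicit Types p k n : nat.

(** The second-order remainder is written with a factor $B$ on each side so that its quadratic form
    at $v$ costs only a multiple of $|Bv|^2$, as in $e^B\preceq1+B+B^2$. *)
Lemma exprDZ_mx p (B : 'M[R]_p) (a : R) n : 0 <= a -> n%:R * a <= 1 ->
  opbound B 1 ->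
  exists2 C, (1 + a *: B) ^+ n = 1 + (n%:R * a) *: B + B * C * B &
             opbound C ((n%:R * a) ^+ 2).
Proof.
move=> a0 + B1; elim: n => [_|n IH na].
  exists 0; first by rewrite expr0 mul0r scale0r mulr0 mul0r !addr0.
  move=> x; rewrite mul0r expr0n/= mul0r mul0mx.
  by rewrite -(scale0r 0) norm2Z normr0 mul0r.
have na' : n%:R * a <= 1.
  by apply: le_trans na; rewrite ler_wpM2r// ler_nat.
have [C HC bC] := IH na'.
(* Multiplying the expansion by $1+aB$ creates the new quadratic terms $na^2BB$ and $aBBCB$,
   collected here between two factors $B$. *)
exists (C + (n%:R * a ^+ 2) *: (1 : 'M[R]_p) + a *: (B * C)).
  rewrite exprS HC -!mulmxE !(mulmxDl, mulmxDr, mulmx1, mul1mx).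
  rewrite -!(scalemxAl, scalemxAr) !(mulmx1, mul1mx) !scalerA !mulmxA.
  rewrite -[n.+1]addn1 natrD mulrDl mul1r scalerDl.
  rewrite (mulrC a (n%:R * a)) -mulrA -expr2 -!addrA; do 2 congr (_ + _).
  by rewrite addrCA.
apply: opbound_le; last first.
  apply: opboundD; first apply: opboundD; first exact: bC.
    by apply: opboundZ; exact: opbound1.
  by apply: opboundZ; apply: opboundM bC => //; exact: B1.
rewrite !ger0_norm ?mulr_ge0 ?sqr_ge0// mulr1 mul1r.
rewrite -natr1 in na *.
have n0 : 0 <= n%:R :> R by [].
move: na n0; set t := n%:R : R => na n0.
have h : 0 <= t + 1 - t * (t * a).
  have : t * (t * a) <= t * 1 by rewrite ler_wpM2l//; lra.
  lra.
have := mulr_ge0 (sqr_ge0 a) h; rewrite -subr_ge0 => h2; rewrite -subr_ge0.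
by move: h2; congr (0 <= _); ring.
Qed.

Lemma dot_exprDZ_le p (B : 'M[R]_p) n (v : 'cV[R]_p) : (0 < n)%N ->
  B^T = B -> opbound B 1 ->
  dot v ((1 + n%:R^-1 *: B) ^+ n *m v) <=
  dot v v + dot v (B *m v) + dot (B *m v) (B *m v).
Proof.
move=> n0 sB B1.
have n1 : n%:R * n%:R^-1 = 1 :> R by rewrite mulfV// pnatr_eq0 -lt0n.
have [||C -> bC] := @exprDZ_mx p B n%:R^-1 n _ _ B1; rewrite ?invr_ge0// n1//.
rewrite scale1r !mulmxDl mul1mx !dotDr lerD2l -!mulmxE -!mulmxA.
rewrite -[X in X *m (C *m _)]sB -dot_mulmx.
apply: le_trans (ler_norm _) _; apply: le_trans (dot_le _ _) _.
rewrite -norm2_sqr expr2 ler_wpM2l ?norm2_ge0//.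
by have := bC (B *m v); rewrite n1 expr1n mul1r.
Qed.

(** Telescoping, one factor at a time. The condition $r\ge1$ allows the single power $r^n$ to bound
    every product that arises. *)
Lemma opbound_exprB p (X Y : 'M[R]_p) r d n : 1 <= r -> 0 <= d ->
  opbound X r -> opbound Y r -> opbound (X - Y) d ->
  opbound (X ^+ n - Y ^+ n) (n%:R * (r ^+ n * d)).
Proof.
move=> r1 d0 Xr Yr XYd; have r0 : 0 <= r by apply: le_trans r1.
elim: n => [|n IH].
  rewrite !expr0 subrr mul0r => x; rewrite mul0r mul0mx.
  by rewrite -(scale0r 0) norm2Z normr0 mul0r.
have -> : X ^+ n.+1 - Y ^+ n.+1 = X * (X ^+ n - Y ^+ n) + (X - Y) * Y ^+ n.
  by rewrite !exprS mulrBr mulrBl addrA subrK.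
apply: opbound_le; last first.
  apply: opboundD; first by apply: opboundM IH; [|exact: Xr].
  by apply: opboundM; [|exact: XYd|exact: opboundX Yr].
rewrite -natr1 mulrDl mul1r exprS mulrCA !mulrA lerD2l -mulrA mulrC ler_peMl//.
by rewrite mulr_ge0 ?exprn_ge0.
Qed.

(** From $(1-x/2)e^{x/2}\le1$ and $(1+x)(1-x/2)\ge1$ on $[0,1]$. It turns $(1+u/N)^N$ into $e^{u/2}$
    and is the origin of the halved exponent in the tail bounds. *)
Lemma expR_half_le (x : R) : 0 <= x <= 1 -> expR (x / 2) <= 1 + x.
Proof.
move=> /andP[x0 x1].
have := expR_ge1Dx (- (x / 2)).
rewrite expRN => h.
have e0 := expR_gt0 (x / 2).
have := ler_wpM2r (ltW e0) h; rewrite mulVf ?gt_eqF// => h2.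
nra.
Qed.

(* One step of the Golden-Thompson argument with [exp A] replaced by
   [(1 + A / N) ^+ N], [N] a power of 2: replacing [1 + (A + B) / N] by
   [(1 + A / N) (1 + B / N)] only costs [A B / N ^+ 2]. *)
Lemma mxtrace_exprD_le p k (A B : 'M[R]_p) (b : R) :
  A^T = A -> B^T = B -> 0 <= b -> opbound A b -> opbound B 1 ->
  let N := (2 ^ k.+1)%N in let a := N%:R^-1 in
  let G := (1 + a *: A) ^+ (2 ^ k) in
  \tr ((1 + a *: (A + B)) ^+ N) <=
  \sum_i (dot (col i G) (col i G) + dot (col i G) (B *m col i G) +
          dot (B *m col i G) (B *m col i G)) +
  p%:R * (N%:R * (((1 + a * b) * (1 + a)) ^+ N * (a ^+ 2 * b))).
Proof.
move=> sA sB b0 Ab B1; cbv zeta.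
set N := (2 ^ k.+1)%N; set a := N%:R^-1; set G := (1 + a *: A) ^+ (2 ^ k).
have a0 : 0 <= a by rewrite invr_ge0.
have N0 : (0 < N)%N by rewrite expn_gt0.
set r := (1 + a * b) * (1 + a).
pose X := 1 + a *: (A + B) : 'M[R]_p.
pose Y := (1 + a *: A) * (1 + a *: B) : 'M[R]_p.
have XY : Y = X + a ^+ 2 *: (A *m B).
  rewrite /Y /X -mulmxE mulmxDl !mulmxDr !mul1mx mulmx1 -scalemxAl -scalemxAr.
  by rewrite scalerA -expr2 scalerDr -!addrA; congr (_ + _); rewrite addrCA.
have d0 : 0 <= a ^+ 2 * b by rewrite mulr_ge0 ?sqr_ge0.
have Xb : opbound (X - Y) (a ^+ 2 * b).
  rewrite XY opprD addrA subrr add0r -scaleNr; apply: opbound_le; last first.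
    by apply: opboundZ; apply: opboundM; [|exact: Ab|exact: B1].
  by rewrite normrN ger0_norm ?sqr_ge0// mulr1.
have ab0 : 0 <= a * b by apply: mulr_ge0.
have pA : opbound (1 + a *: A) (1 + a * b).
  apply: opboundD; first exact: opbound1.
  by rewrite -{2}(ger0_norm a0); apply: opboundZ.
have pB : opbound (1 + a *: B) (1 + a).
  apply: opboundD; first exact: opbound1.
  by rewrite -{2}[a]mulr1 -{2}(ger0_norm a0); apply: opboundZ.
have Yr : opbound Y r by apply: opboundM pA pB; lra.
have Xr : opbound X r.
  apply: opbound_le; last first.
    apply: opboundD; first exact: opbound1.
    by apply: opboundZ; apply: opboundD; [exact: Ab|exact: B1].
  by rewrite /r ger0_norm//; nra.
have r1 : 1 <= r by rewrite /r; nra.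
have /opbound_trace := opbound_exprB N r1 d0 Xr Yr Xb.
rewrite linearB /= -/X => h.
have sDA : (1 + a *: A)^T = 1 + a *: A by rewrite linearD/= trmx1 linearZ/= sA.
have sDB : (1 + a *: B)^T = 1 + a *: B by rewrite linearD/= trmx1 linearZ/= sB.
have /= := mxtrace_mulX2_le k.+1 sDA sDB; rewrite -/N -/Y => h2.
(* Since $(1+aA)^N=GG^T$, cyclicity leaves quadratic forms of $(1+aB)^N$ at the columns of [G],
   where [dot_exprDZ_le] applies. *)
have h3 : \tr ((1 + a *: A) ^+ N * (1 + a *: B) ^+ N) =
    \sum_i dot (col i G) ((1 + a *: B) ^+ N *m col i G).
  rewrite -mxtrace_conj -/G.
  have -> : (1 + a *: A) ^+ N = G * G^T.
    by rewrite /G trmxX sDA -exprD addnn -mul2n -expnS.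
  by rewrite -!mulmxE -!mulmxA mxtrace_mulC !mulmxA.
have h4 : \sum_i dot (col i G) ((1 + a *: B) ^+ N *m col i G) <=
  \sum_i (dot (col i G) (col i G) + dot (col i G) (B *m col i G) +
          dot (B *m col i G) (B *m col i G)).
  by apply: ler_sum => i _; apply: dot_exprDZ_le.
move: h; rewrite ler_norml => /andP[_ h]; rewrite -/X -/r.
lra.
Qed.

End truncated_exponential.

(** * Operator, column and entry norms, and Hadamard products *)

Section norms.
Context {R : realType}.
Implicit Types m p k n : nat.

Lemma mx_norm_ge0 m p (Z : 'M[R]_(m, p)) : 0 <= mx_norm Z.
Proof. by rewrite /mx_norm. Qed.

Lemma le_mx_norm m p (Z : 'M[R]_(m, p)) i j : `|Z i j| <= mx_norm Z.
Proof. by rewrite mx_normrE; apply: (le_bigmax _ _ (i, j)). Qed.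

Lemma mx_norm_le m p (Z : 'M[R]_(m, p)) c : 0 <= c ->
  (forall i j, `|Z i j| <= c) -> mx_norm Z <= c.
Proof. by move=> c0 Zc; rewrite mx_normrE; apply/bigmax_leP; split. Qed.

Lemma le_norm12 m p (Z : 'M[R]_(m, p)) j : norm2 (col j Z) <= norm12 Z.
Proof. exact: (le_bigmax _ (fun j => norm2 (col j Z)) j). Qed.

Lemma norm12_ge0 m p (Z : 'M[R]_(m, p)) : 0 <= norm12 Z.
Proof. by apply: bigmax_ge_id. Qed.

Lemma opbound_exists m p (Z : 'M[R]_(m, p)) : exists2 c, 0 <= c & opbound Z c.
Proof.
exists (Num.sqrt (\tr (Z *m Z^T))) => [|x]; first exact: sqrtr_ge0.
rewrite /norm2 -sqrtrM ?mxtrace_mulT_ge0// ler_sqrt ?dot_mulmx_trace_le//.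
by rewrite mulr_ge0 ?dot_ge0 ?mxtrace_mulT_ge0.
Qed.

Lemma norm20 p : norm2 (0 : 'cV[R]_p) = 0.
Proof. by rewrite -(scale0r 0) norm2Z normr0 mul0r. Qed.

Lemma opnorm_le m p (Z : 'M[R]_(m, p)) c : 0 <= c -> opbound Z c -> opnorm Z <= c.
Proof.
move=> c0 Zc; apply: ge_sup => [|_ [x /= x1 <-]].
  by exists (norm2 (Z *m 0)); exists 0 => //=; rewrite norm20 ler01.
by apply: le_trans (Zc x) _; rewrite ler_piMr.
Qed.

Lemma opbound_opnorm m p (Z : 'M[R]_(m, p)) : opbound Z (opnorm Z).
Proof.
have [c c0 Zc] := opbound_exists Z.
move=> x; have [x0|x0] := eqVneq (norm2 x) 0.
  by rewrite (norm2_eq0 x0) mulmx0 !norm20 mulr0.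
have xp : 0 < norm2 x by rewrite lt_def x0 norm2_ge0.
rewrite -ler_pdivrMr// mulrC.
have -> : (norm2 x)^-1 * norm2 (Z *m x) = norm2 (Z *m ((norm2 x)^-1 *: x)).
  by rewrite -scalemxAr norm2Z ger0_norm ?invr_ge0 ?norm2_ge0.
apply: ub_le_sup.
  exists c => _ [y /= y1 <-].
  by apply: le_trans (Zc y) _; rewrite ler_piMr.
exists ((norm2 x)^-1 *: x) => //=.
by rewrite norm2Z ger0_norm ?invr_ge0 ?norm2_ge0// mulVf.
Qed.

Lemma opnorm_ge0 m p (Z : 'M[R]_(m, p)) : 0 <= opnorm Z.
Proof.
have [c c0 Zc] := opbound_exists Z.
apply: le_trans (norm2_ge0 (Z *m 0)) _; apply: ub_le_sup.
  exists c => _ [y /= y1 <-].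
  by apply: le_trans (Zc y) _; rewrite ler_piMr.
by exists 0 => //=; rewrite norm20 ler01.
Qed.

Lemma opnorm0_eq0 m p (Z : 'M[R]_(m, p)) : opnorm Z = 0 -> Z = 0.
Proof.
move=> Z0; apply/matrixP => i j; have := opbound_opnorm Z (delta_mx j 0).
rewrite Z0 mul0r => h.
have : norm2 (Z *m delta_mx j 0) = 0 by apply/eqP; rewrite eq_le h norm2_ge0.
by move/norm2_eq0; rewrite mulmx_delta => /matrixP /(_ i 0); rewrite !mxE.
Qed.

Lemma quad_le_opnorm p (Z : 'M[R]_p) x : dot x (Z *m x) <= opnorm Z * dot x x.
Proof.
apply: le_trans (ler_norm _) _; apply: le_trans (dot_le _ _) _.
rewrite -norm2_sqr expr2 mulrCA ler_wpM2l ?norm2_ge0//.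
exact: opbound_opnorm.
Qed.

Lemma diag_le_opnorm p (Z : 'M[R]_p) i : Z i i <= opnorm Z.
Proof.
have := quad_le_opnorm Z (delta_mx i 0).
rewrite dot_deltal mulmx_delta mxE => /le_trans; apply.
by rewrite -norm2_sqr norm2_delta expr1n mulr1.
Qed.

Lemma bernoulli_le (z : R) n : 0 <= z -> 1 + z *+ n <= (1 + z) ^+ n.
Proof.
move=> z0; elim: n => [|n IH]; first by rewrite mulr0n expr0; lra.
rewrite exprS mulrSr.
have h : 0 <= z *+ n by rewrite mulrn_wge0.
have : (1 + z) * (1 + z *+ n) <= (1 + z) * (1 + z) ^+ n.
  by rewrite ler_wpM2l//; lra.
nra.
Qed.

(** Powers amplify a ratio $x/c>1$ beyond any factor $b$. This removes the dimension factor that a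
    trace bound introduces, by letting the exponent grow. *)
Lemma expr2_unbounded (x c b : R) : 0 <= c -> c < x ->
  exists k, b * c ^+ (2 ^ k.+1) < x ^+ (2 ^ k.+1).
Proof.
move=> c0 cx; have x0 : 0 < x by apply: le_lt_trans cx.
have [c00|cn] := eqVneq c 0.
  by exists 0; rewrite c00 expr0n/= mulr0 exprn_gt0.
have cp : 0 < c by rewrite lt_def cn.
set y := x / c; have y1 : 0 < y - 1 by rewrite subr_gt0 ltr_pdivlMr ?mul1r.
have [N bN] : exists N : nat, b < 1 + (y - 1) *+ N.
  exists (Num.bound ((`|b|) / (y - 1))).
  rewrite -mulr_natr.
  have := archi_boundP (divr_ge0 (normr_ge0 b) (ltW y1)).
  rewrite ltr_pdivrMr// mulrC => h; have := ler_norm b; lra.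
exists N; rewrite -(divfK cn x) -/y exprMn ltr_pM2r ?exprn_gt0//.
have NN : (N <= 2 ^ N.+1)%N.
  by apply: ltnW; apply: leq_trans (ltn_expl N.+1 (ltnSn 1)).
apply: lt_le_trans bN _.
have y1' : 1 <= y by lra.
apply: le_trans (ler_weXn2l y1' NN).
by have := bernoulli_le N (ltW y1); rewrite [1 + (y - 1)]addrC subrK.
Qed.

(* Makes [opnorm Z <= c] a countable conjunction of polynomial conditions on the
   entries of [Z], hence measurable. *)
Lemma sym_opnorm_leP p (Z : 'M[R]_p) c : Z^T = Z -> 0 <= c ->
  opnorm Z <= c <-> forall k, \tr (Z ^+ (2 ^ k.+1)) <= p%:R * c ^+ (2 ^ k.+1).
Proof.
move=> sZ c0; split => [Zc k|H].
  apply: le_trans (ler_norm _) _; apply: opbound_trace; apply: opboundX => //.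
  exact: opbound_le Zc (opbound_opnorm Z).
apply: opnorm_le => //; apply: sym_opbound => // x.
have [x0|x0] := eqVneq (norm2 x) 0.
  by rewrite (norm2_eq0 x0) mulmx0 /dot !big1 ?normr0 ?mulr0// => i _; rewrite mxE mul0r.
have [u u1 ->] : exists2 u, norm2 u = 1 & x = norm2 x *: u.
  exists ((norm2 x)^-1 *: x); last by rewrite scalerA mulfV// scale1r.
  by rewrite norm2Z ger0_norm ?invr_ge0 ?norm2_ge0// mulVf.
rewrite -scalemxAr !dotZl !dotZr -[dot u u]norm2_sqr u1 expr1n mulr1.
rewrite mulrA -expr2 normrM (ger0_norm (sqr_ge0 _)) [leRHS]mulrC.
rewrite ler_wpM2l ?sqr_ge0//.
rewrite leNgt; apply/negP => /(expr2_unbounded p%:R c0)[k].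
rewrite ltNge => /negP; apply.
have := dot_X2_le_trace k sZ u1.
have -> : dot u (Z *m u) ^+ (2 ^ k.+1) = `|dot u (Z *m u)| ^+ (2 ^ k.+1).
  by rewrite -normrX ger0_norm// expnS mulnC exprM sqr_ge0.
by move=> h; apply: le_trans h (H k).
Qed.

Lemma norm2_abs p (x : 'cV[R]_p) : norm2 (map_mx Num.norm x) = norm2 x.
Proof.
congr Num.sqrt; apply: eq_bigr => i _.
by rewrite mxE -normrM ger0_norm// -expr2 sqr_ge0.
Qed.

Lemma sum_abs_le p (M : 'M[R]_p) (v : 'cV[R]_p) :
  \sum_l (\sum_i M l i * `|v i 0|) ^+ 2 <= opnorm M ^+ 2 * dot v v.
Proof.
have := opbound_opnorm M (map_mx Num.norm v).
rewrite norm2_leP ?mulr_ge0 ?opnorm_ge0 ?norm2_ge0// norm2_abs exprMn norm2_sqr.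
move=> h; apply: le_trans h; rewrite le_eqVlt; apply/orP; left; apply/eqP.
apply: eq_bigr => l _; rewrite -expr2 mxE.
by congr (_ ^+ 2); apply: eq_bigr => i _; rewrite mxE.
Qed.

(** Entrywise $|Dx|\le cM|x|$, and $|x|$ has the same Euclidean norm as $x$. *)
Lemma opbound_dominated p (D M : 'M[R]_p) c : 0 <= c ->
  (forall i j, `|D i j| <= c * M i j) -> opbound D (c * opnorm M).
Proof.
move=> c0 DM x.
rewrite norm2_leP ?mulr_ge0 ?opnorm_ge0 ?norm2_ge0// !exprMn norm2_sqr -mulrA.
have h := ler_wpM2l (sqr_ge0 c) (sum_abs_le M x).
apply: le_trans h; rewrite mulr_sumr; apply: ler_sum => l _.
rewrite -expr2 -exprMn mulr_sumr -[leLHS]ger0_norm ?sqr_ge0// normrX.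
have h : `|(D *m x) l 0| <= \sum_i c * (M l i * `|x i 0|).
  rewrite mxE; apply: le_trans (ler_norm_sum _ _ _) _; apply: ler_sum => i _.
  by rewrite normrM mulrA ler_wpM2r.
by apply: lerXn2r; rewrite ?nnegrE//; apply: le_trans h.
Qed.

Lemma sum_sqr_le m p (M : 'M[R]_(m, p)) (v : 'cV[R]_p) :
  \sum_l \sum_i (M l i * v i 0) ^+ 2 <= norm12 M ^+ 2 * dot v v.
Proof.
rewrite exchange_big mulr_sumr /=; apply: ler_sum => i _.
have -> : \sum_l (M l i * v i 0) ^+ 2 = norm2 (col i M) ^+ 2 * (v i 0 * v i 0).
  rewrite norm2_sqr mulr_suml; apply: eq_bigr => l _.
  by rewrite !mxE; ring.
rewrite ler_wpM2r -?expr2 ?sqr_ge0// ler_sqr ?nnegrE ?norm2_ge0 ?norm12_ge0//.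
exact: le_norm12.
Qed.

Lemma quad_sqr_le p (S : 'M[R]_p) : S^T = S -> (forall v, 0 <= dot v (S *m v)) ->
  forall u v, dot u (S *m v) ^+ 2 <= dot u (S *m u) * dot v (S *m v).
Proof.
move=> sS S0 u v; apply: discriminant_le => [//|t].
have := S0 (u + t *: v).
have e : dot v (S *m u) = dot u (S *m v) by rewrite dotC dot_mulmx sS.
rewrite mulmxDr -scalemxAr !dotDl !dotDr !dotZl !dotZr e => h.
by apply: le_trans h _; rewrite le_eqVlt; apply/orP; left; apply/eqP; ring.
Qed.

Lemma hadamard_sum_quad_le p (M S : 'M[R]_p) (v : 'cV[R]_p) :
  (forall v, 0 <= dot v (S *m v)) ->
  \sum_l (let w := \col_i (M l i * v i 0) in dot w (S *m w)) <=
  opnorm S * (norm12 M ^+ 2 * dot v v).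
Proof.
move=> S0; apply: le_trans (ler_wpM2l (opnorm_ge0 S) (sum_sqr_le M v)).
rewrite mulr_sumr; apply: ler_sum => l _ /=.
apply: le_trans (quad_le_opnorm _ _) _; rewrite ler_wpM2l ?opnorm_ge0//.
by rewrite le_eqVlt; apply/orP; left; apply/eqP; apply: eq_bigr => i _; rewrite mxE.
Qed.

(** Row $l$ of the product is $\langle e_l,Sw\rangle$ with $w_i=M_{li}v_i$. Cauchy-Schwarz for the
    form $S$ bounds its square by $S_{ll}\langle w,Sw\rangle$, which is then summed over $l$. *)
Lemma hadamard_psd_le p (M S : 'M[R]_p) (v : 'cV[R]_p) (s : R) : S^T = S ->
  (forall v, 0 <= dot v (S *m v)) -> (forall i, S i i <= s) -> 0 <= s ->
  dot (hadamard M S *m v) (hadamard M S *m v) <=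
  s * (opnorm S * (norm12 M ^+ 2 * dot v v)).
Proof.
move=> sS S0 Ss s0.
apply: le_trans (ler_wpM2l s0 (hadamard_sum_quad_le M v S0)); rewrite mulr_sumr; apply: ler_sum => l _ /=.
set w := \col_i _.
have -> : (hadamard M S *m v) l 0 = dot (delta_mx l 0) (S *m w).
  by rewrite dot_deltal !mxE; apply: eq_bigr => i _; rewrite !mxE; ring.
rewrite -expr2; apply: le_trans (quad_sqr_le sS S0 _ _) _.
by rewrite ler_wpM2r// dot_deltal mulmx_delta mxE.
Qed.

Lemma hadamardE m p (A B : 'M[R]_(m, p)) i j : hadamard A B i j = A i j * B i j.
Proof. by rewrite mxE. Qed.

End norms.

(** * Expectations and independence *)

Section bounded_measurable.
Context {R : realType} d (T : measurableType d).
Implicit Types f g : T -> R.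

(** Boundedness is stable under products, unlike integrability, and gives integrability for any
    probability. The domain may also carry a sub-sigma-algebra, in which case measurability
    expresses adaptedness. *)
Definition bmeas f :=
  measurable_fun [set: T] f /\ exists c, forall x, `|f x| <= c.

Lemma eq_bmeas f g : f =1 g -> bmeas f -> bmeas g.
Proof. by move=> /funext ->. Qed.

Lemma bmeas_cst c : bmeas (fun=> c).
Proof. by split=> //; exists `|c|. Qed.

Lemma bmeasD f g : bmeas f -> bmeas g -> bmeas (fun x => f x + g x).
Proof.
move=> [mf [c fc]] [mg [e ge]]; split; first exact: measurable_funD.
by exists (c + e) => x; apply: le_trans (ler_normD _ _) _; apply: lerD.
Qed.

Lemma bmeasM f g : bmeas f -> bmeas g -> bmeas (fun x => f x * g x).
Proof.
move=> [mf [c fc]] [mg [e ge]]; split; first exact: measurable_funM.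
by exists (c * e) => x; rewrite normrM ler_pM.
Qed.

Lemma bmeasN f : bmeas f -> bmeas (fun x => - f x).
Proof.
move=> [mf [c fc]]; split; last by exists c => x; rewrite normrN.
exact: measurableT_comp.
Qed.

Lemma bmeasB f g : bmeas f -> bmeas g -> bmeas (fun x => f x - g x).
Proof. by move=> bf bg; apply: bmeasD => //; apply: bmeasN. Qed.

Lemma bmeasX f n : bmeas f -> bmeas (fun x => f x ^+ n).
Proof.
move=> bf; elim: n => [|n IH].
  exact: (@eq_bmeas (fun=> 1)) (bmeas_cst 1).
by apply: eq_bmeas (bmeasM bf IH) => x; rewrite exprS.
Qed.

Lemma bmeas_sum (I : Type) (r : seq I) (Q : pred I) (h : I -> T -> R) :
  (forall i, Q i -> bmeas (h i)) -> bmeas (fun x => \sum_(i <- r | Q i) h i x).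
Proof.
move=> bh; elim: r => [|i r IH].
  by apply: eq_bmeas (bmeas_cst 0) => x; rewrite big_nil.
have [Qi|Qi] := boolP (Q i).
  by apply: eq_bmeas (bmeasD (bh i Qi) IH) => x; rewrite big_cons Qi.
by apply: eq_bmeas IH => x; rewrite big_cons (negbTE Qi).
Qed.

Lemma bmeas_prod (I : Type) (r : seq I) (Q : pred I) (h : I -> T -> R) :
  (forall i, Q i -> bmeas (h i)) -> bmeas (fun x => \prod_(i <- r | Q i) h i x).
Proof.
move=> bh; elim: r => [|i r IH].
  by apply: eq_bmeas (bmeas_cst 1) => x; rewrite big_nil.
have [Qi|Qi] := boolP (Q i).
  by apply: eq_bmeas (bmeasM (bh i Qi) IH) => x; rewrite big_cons Qi.
by apply: eq_bmeas IH => x; rewrite big_cons (negbTE Qi).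
Qed.

Lemma bmeas_indic (A : set T) : measurable A -> bmeas (\1_A).
Proof.
move=> mA; split; first exact: measurable_indic.
by exists 1 => x; rewrite indicE; case: (_ \in _); rewrite ?normr1 ?normr0.
Qed.

Lemma bmeas_le f c : measurable_fun setT f -> (forall x, 0 <= f x <= c) -> bmeas f.
Proof. by move=> mf fc; split=> //; exists c => x; rewrite ger0_norm; case/andP: (fc x). Qed.

End bounded_measurable.

Section expectation.
Context {R : realType} d (T : measurableType d) (P : probability T R).
Implicit Types f g : T -> R.

Local Notation intg f := (P.-integrable setT (EFin \o f)).
Local Notation Ex f := (Rintegral P setT f).

Lemma bmeas_integrable f : bmeas f -> intg f.
Proof.
move=> [mf [c fc]]; apply: measurable_bounded_integrable => //.
  by rewrite (le_lt_trans (probability_le1 _ _))// ltey.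
exists c; split; first exact: num_real.
by move=> x cx y _ /=; apply: le_trans (fc y) (ltW cx).
Qed.

Lemma Ex_cst c : Ex (fun=> c) = c.
Proof. by rewrite Rintegral_cst//; have := probability_setT P => /= ->; rewrite mulr1. Qed.

Lemma ExD f g : intg f -> intg g -> Ex (fun x => f x + g x) = Ex f + Ex g.
Proof. by move=> fi gi; rewrite RintegralD. Qed.

Lemma ExZl c f : intg f -> Ex (fun x => c * f x) = c * Ex f.
Proof. by move=> fi; rewrite RintegralZl. Qed.

Lemma Ex_le f g : intg f -> intg g -> (forall x, f x <= g x) -> Ex f <= Ex g.
Proof. by move=> fi gi fg; apply: le_Rintegral. Qed.

Lemma eq_Ex f g : f =1 g -> Ex f = Ex g.
Proof. by move=> fg; apply: eq_Rintegral => x _; apply: fg. Qed.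

Lemma intgD f g : intg f -> intg g -> intg (fun x => f x + g x).
Proof.
by move=> fi gi; apply: eq_integrable (integrableD measurableT fi gi).
Qed.

Lemma intgB f g : intg f -> intg g -> intg (fun x => f x - g x).
Proof.
by move=> fi gi; apply: eq_integrable (integrableB measurableT fi gi).
Qed.

Lemma intgZl c f : intg f -> intg (fun x => c * f x).
Proof.
by move=> fi; apply: eq_integrable (integrableZl measurableT c fi).
Qed.

Lemma intg_sum (I : Type) (r : seq I) (h : I -> T -> R) :
  (forall i, intg (h i)) -> intg (fun x => \sum_(i <- r) h i x).
Proof.
move=> hi; elim: r => [|i r IH].
  rewrite (_ : (fun x => _) = fun=> 0); last by apply/funext => x; rewrite big_nil.
  by apply: bmeas_integrable; exact: bmeas_cst.
rewrite (_ : (fun x => _) = fun x => h i x + \sum_(j <- r) h j x).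
  exact: intgD.
by apply/funext => x; rewrite big_cons.
Qed.

Lemma Ex_sum (I : Type) (r : seq I) (h : I -> T -> R) :
  (forall i, intg (h i)) ->
  Ex (fun x => \sum_(i <- r) h i x) = \sum_(i <- r) Ex (h i).
Proof.
move=> hi; elim: r => [|i r IH].
  by rewrite (@eq_Ex _ (fun=> 0)) ?Ex_cst ?big_nil// => x; rewrite big_nil.
rewrite big_cons -IH -ExD//; last exact: intg_sum.
by apply: eq_Ex => x; rewrite big_cons.
Qed.

Lemma le_intg f g : measurable_fun setT f -> (forall x, `|f x| <= g x) ->
  intg g -> intg f.
Proof.
move=> mf fg gi; apply: le_integrable gi => //.
  exact/measurable_EFinP.
by move=> x _ /=; rewrite lee_fin; apply: le_trans (fg x) (ler_norm _).
Qed.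

Lemma Ex_EFin f : intg f -> (\int[P]_x (f x)%:E)%E = (Ex f)%:E.
Proof. by move=> fi; rewrite /Rintegral fineK// integrable_fin_num. Qed.

Lemma Ex_indic A : measurable A -> (Ex (\1_A))%:E = P A.
Proof.
move=> mA; rewrite -Ex_EFin; last by apply: bmeas_integrable; apply: bmeas_indic.
by rewrite integral_indic// setIT.
Qed.

Lemma markov_le f c A : bmeas f -> (forall x, 0 <= f x) -> measurable A ->
  (forall x, A x -> c <= f x) -> 0 < c -> (P A <= (Ex f / c)%:E)%E.
Proof.
move=> bf f0 mA Af c0; rewrite -Ex_indic// lee_fin ler_pdivlMr// mulrC.
rewrite -ExZl; last by apply: bmeas_integrable; apply: bmeas_indic.
apply: Ex_le.
- by apply: intgZl; apply: bmeas_integrable; apply: bmeas_indic.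
- exact: bmeas_integrable.
- move=> x; rewrite indicE; case: (boolP (x \in A)) => [|_]; rewrite ?mulr1 ?mulr0//.
  by rewrite inE => /Af.
Qed.

End expectation.

(** * Independent sigma-algebras and expectations with one argument frozen *)

Section decoupling.
Context {R : realType} d (T : measurableType d) (P : probability T R).
Local Notation Ex f := (Rintegral P setT f).

(** Both $A\mapsto P(A\cap B)$ and $A\mapsto P(A)P(B)$ are finite measures that agree on a
    generating family closed under intersection, so they agree on the generated sigma-algebra. *)
Lemma g_sigma_indep (G : set (set T)) (B : set T) :
  G `<=` measurable -> G setT -> setI_closed G -> measurable B ->
  (forall A, G A -> P (A `&` B) = (P A * P B)%E) ->
  forall A, <<s G >> A -> P (A `&` B) = (P A * P B)%E.
Proof.
move=> Gm GT GI mB GB A sA.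
have Pfin : P B \is a fin_num by apply: fin_num_measure.
have PB0 : 0 <= fine (P B) by apply: fine_ge0.
pose m2 := mscale (NngNum PB0) P.
have -> : (P A * P B)%E = m2 A by rewrite /m2 /mscale/= fineK// muleC.
rewrite -[P (A `&` B)]/(mrestr P mB A).
apply: (@g_sigma_algebra_measure_unique _ _ _ G Gm (fun=> setT)) => //.
- by rewrite bigcup_const//; exists 0%N.
- by move=> X GX; rewrite /= /mrestr GB// /mscale/= fineK// muleC.
- by move=> k; rewrite /= /mrestr setTI; apply: le_lt_trans (probability_le1 _ _) (ltey _).
Qed.

Lemma g_sigma_indep2 (G1 G2 : set (set T)) :
  G1 `<=` measurable -> G1 setT -> setI_closed G1 ->
  G2 `<=` measurable -> G2 setT -> setI_closed G2 ->
  (forall A B, G1 A -> G2 B -> P (A `&` B) = (P A * P B)%E) ->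
  forall A B, <<s G1 >> A -> <<s G2 >> B -> P (A `&` B) = (P A * P B)%E.
Proof.
move=> G1m G1T G1I G2m G2T G2I G12 A B sA sB.
have mA : measurable A.
  by move: A sA; apply: smallest_sub => //; exact: sigma_algebra_measurable.
rewrite setIC muleC; apply: (g_sigma_indep G2m) => // C GC.
rewrite setIC muleC; apply: (g_sigma_indep G1m) => //; first exact: G2m.
by move=> D GD; apply: G12.
Qed.

Context d1 d2 (A1 : measurableType d1) (A2 : measurableType d2)
  (V : {RV P >-> A1}) (W : {RV P >-> A2}).
Hypothesis VW : forall A B, measurable A -> measurable B ->
  P (V @^-1` A `&` W @^-1` B) = (P (V @^-1` A) * P (W @^-1` B))%E.

Lemma Ex_decouple (f : A1 * A2 -> R) : bmeas f ->
  bmeas (fun w => Ex (fun w' => f (V w, W w'))) /\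
  Ex (fun w => f (V w, W w)) = Ex (fun w => Ex (fun w' => f (V w, W w'))).
Proof.
move=> bf; have [mf [c fc]] := bf.
have mVW : measurable_fun setT (fun w => (V w, W w)).
  by apply: measurable_fun_pair; exact: measurable_funPT.
pose VWm := isMeasurableFun.Build _ _ _ _ _ mVW.
pose VW' : {RV P >-> (A1 * A2)%type} := HB.pack (fun w => (V w, W w)) VWm.
have fi d' (S : measurableType d') (Q : probability S R) (g : S -> R) :
  bmeas g -> Q.-integrable setT (EFin \o g) by exact: bmeas_integrable.
have bVW : bmeas (f \o VW').
  by split; [exact: measurableT_comp|exists c => x; apply: fc].
have bf2 x : bmeas (fun y => f (x, y)).
  split; last by exists c.
  by apply: measurableT_comp => //; apply: measurable_fun_pair.
have bf3 x : bmeas (fun w' => f (x, W w')).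
  split; last by exists c.
  by apply: measurableT_comp (bf2 x).1 _.
(* Independence says that the joint law is the product of the marginals, which reduces the claim to
   Fubini. *)
have m12 : forall X, measurable X ->
    (distribution P V \x distribution P W)%E X = distribution P VW' X.
  by apply: product_measure_unique => A B mA mB; rewrite /= -VW.
have fi2 : (distribution P V \x distribution P W)%E.-integrable setT (EFin \o f).
  apply: measurable_bounded_integrable => //.
    have := m12 _ measurableT => /= ->.
    by apply: le_lt_trans (probability_le1 _ _) (ltey _).
  by exists c; split => [|x cx y _]; [exact: num_real|apply: le_trans (fc y) (ltW cx)].
have FE x : fubini_F (distribution P W) (EFin \o f) x = (Ex (fun w' => f (x, W w')))%:E.
  rewrite /fubini_F -Ex_EFin; last exact: fi.
  rewrite integral_distribution; [by []|exact: (measurable_EFinP _ _).2 (bf2 x).1|exact: fi].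
have mF : measurable_fun setT (fun x => Ex (fun w' => f (x, W w'))).
  apply/measurable_EFinP; rewrite (_ : _ \o _ = fubini_F (distribution P W) (EFin \o f)).
    exact: measurable_fubini_F fi2.
  by apply/funext => x; rewrite FE.
have bE : bmeas (fun w => Ex (fun w' => f (V w, W w'))).
  split; first by apply: (measurableT_comp mF).
  exists c => w /=.
  have := le_normr_Rintegral measurableT (fi _ _ P _ (bf3 (V w))).
  move=> /le_trans; apply.
  have := @Ex_le _ _ _ P (fun w' => `|f (V w, W w')|) (fun=> c).
  rewrite Ex_cst; apply=> //.
  - apply: (fi); split; last by exists c => y; rewrite normr_id.
    by apply: measurableT_comp => //; exact: (bf3 (V w)).1.
  - by apply: fi; exact: bmeas_cst.
split=> //; rewrite /Rintegral; congr fine.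
transitivity (\int[distribution P VW']_z (f z)%:E)%E.
  rewrite integral_distribution//; [exact/measurable_EFinP|exact: fi].
rewrite -(eq_measure_integral _ (fun A mA _ => m12 A mA)).
rewrite -(integral12_prod_meas1 fi2).
rewrite (eq_integral (fun x => (Ex (fun w' => f (x, W w')))%:E)); last first.
  by move=> x _; exact: FE.
rewrite integral_distribution; [by []|exact/measurable_EFinP|].
exact: fi.
Qed.

End decoupling.

Section independent_family.
Context {R : realType} d d' (T : measurableType d) (S : measurableType d')
  (P : probability T R) (I : finType) (Y : I -> {RV P >-> S}).
Hypothesis indY : mutually_independent Y.
Local Notation Ex f := (Rintegral P setT f).
Implicit Types J : {set I}.

Definition cylinders J : set (set T) :=
  [set A | exists2 B : I -> set S, (forall i, measurable (B i)) &
    A = \bigcap_(i in [set` J]) Y i @^-1` B i].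

(* [T] with the sigma-algebra generated by the [Y i], [i \in J]. *)
Definition sigma_of J := g_sigma_algebraType (cylinders J).

Lemma cylinders_measurable J : cylinders J `<=` measurable.
Proof.
move=> _ [B mB ->]; apply: fin_bigcap_measurable => // i _.
by rewrite -[X in measurable X]setTI; apply: measurable_funPT.
Qed.

Lemma cylindersT J : cylinders J setT.
Proof.
by exists (fun=> setT) => //; rewrite bigcapT//.
Qed.

Lemma cylindersI J : setI_closed (cylinders J).
Proof.
move=> _ _ [B mB ->] [C mC ->]; exists (fun i => B i `&` C i).
  by move=> i; apply: measurableI.
by rewrite -bigcapI.
Qed.

Lemma measurable_sigma_of J i : i \in J ->
  measurable_fun [set: sigma_of J] (Y i : sigma_of J -> S).
Proof.
move=> iJ _ A mA; rewrite setTI; apply: sub_sigma_algebra.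
exists (fun j => if j == i then A else setT); first by move=> j; case: ifP.
apply/seteqP; split=> w /=.
  by move=> Aw j _; case: eqP => // ->.
by move=> /(_ i iJ); rewrite eqxx.
Qed.

Lemma measurable_sigma_of_id J :
  measurable_fun setT (id : T -> sigma_of J).
Proof.
move=> _ A sA; rewrite setTI preimage_id; move: A sA.
by apply: smallest_sub; [exact: sigma_algebra_measurable|exact: cylinders_measurable].
Qed.

Let idm J := isMeasurableFun.Build _ _ _ _ _ (@measurable_sigma_of_id J).

(** The identity viewed as a random variable in a coarser space: everything depending on the [Y i],
    [i \in J], becomes a function of one variable. Disjoint index sets give two independent
    variables, as [Ex_decouple] requires. *)
Definition sigma_of_rv J : {RV P >-> sigma_of J} := HB.pack (id : T -> sigma_of J) (idm J).

Lemma cylinders_indep J J' A B : {in J, forall i, i \notin J'} ->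
  cylinders J A -> cylinders J' B -> P (A `&` B) = (P A * P B)%E.
Proof.
move=> JJ' [C mC ->] [D mD ->]; rewrite !indY//.
pose F i := if i \in J then C i else D i.
have mF i : measurable (F i) by rewrite /F; case: ifP.
have nJ i : i \in J' -> (i \in J) = false.
  by move=> iJ'; apply/negbTE/negP => /JJ'; rewrite iJ'.
rewrite [X in P X](_ : _ = \bigcap_(i in [set` J :|: J']) Y i @^-1` F i).
  rewrite indY//.
  rewrite (eq_bigl (mem [predU J & J'])) => [|i]; last by rewrite !inE.
  rewrite bigU//=; last by apply/pred0P => i /=; apply/negbTE/negP => /andP[/JJ'/negP].
  congr (_ * _)%E; apply: eq_bigr => i iJ; rewrite /F ?iJ//.
  by rewrite nJ.
apply/seteqP; split=> w /=.
  move=> [wC wD] i /=; rewrite inE /F => /orP[iJ|iJ].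
    by rewrite iJ; apply: wC.
  by rewrite nJ//; apply: wD.
move=> wF; split=> i /= iJ.
  by have := wF i; rewrite /F /= inE iJ; apply.
by have := wF i; rewrite /F /= inE iJ orbT nJ//; apply.
Qed.

Lemma sigma_of_indep J J' (A : set (sigma_of J)) (B : set (sigma_of J')) :
  {in J, forall i, i \notin J'} -> measurable A -> measurable B ->
  P (sigma_of_rv J @^-1` A `&` sigma_of_rv J' @^-1` B) =
  (P (sigma_of_rv J @^-1` A) * P (sigma_of_rv J' @^-1` B))%E.
Proof.
move=> JJ' mA mB.
apply: (@g_sigma_indep2 _ _ _ P (cylinders J) (cylinders J')) => //;
  by [exact: cylinders_measurable | exact: cylindersT | exact: cylindersI |
      move=> ? ? ? ?; apply: cylinders_indep JJ' _ _].
Qed.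

Lemma bmeas_sigma_of J (f : sigma_of J -> R) : bmeas f -> bmeas (f : T -> R).
Proof.
move=> [mf bf]; split=> //.
exact: (measurableT_comp mf (@measurable_sigma_of_id J)).
Qed.

(** This takes the place of the tower property: an expectation over [w'] with [w] frozen is the
    conditional expectation given the variables in [J]. *)
Lemma Ex_decouple_le J J' (f : sigma_of J * sigma_of J' -> R) (h : T -> R) :
  {in J, forall i, i \notin J'} -> bmeas f -> bmeas h ->
  (forall w, Ex (fun w' : T => f (w, w')) <= h w) ->
  Ex (fun w : T => f (w, w)) <= Ex h.
Proof.
move=> JJ' bf bh fh.
have [] := @Ex_decouple _ _ _ P _ _ _ _ (sigma_of_rv J) (sigma_of_rv J') _ _ bf.
  by move=> A B mA mB; apply: sigma_of_indep.
move=> bE ->; apply: Ex_le => //; exact: bmeas_integrable.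
Qed.

Lemma Ex_decouple_eq J J' (f : sigma_of J * sigma_of J' -> R) (h : T -> R) :
  {in J, forall i, i \notin J'} -> bmeas f ->
  (forall w, Ex (fun w' : T => f (w, w')) = h w) ->
  Ex (fun w : T => f (w, w)) = Ex h.
Proof.
move=> JJ' bf fh.
have [] := @Ex_decouple _ _ _ P _ _ _ _ (sigma_of_rv J) (sigma_of_rv J') _ _ bf.
  by move=> A B mA mB; apply: sigma_of_indep.
by move=> _ ->; apply: eq_Ex.
Qed.

Lemma Ex_indepM J J' (f : sigma_of J -> R) (g : sigma_of J' -> R) :
  {in J, forall i, i \notin J'} -> bmeas f -> bmeas g ->
  Ex (fun w => f w * g w) = Ex f * Ex g.
Proof.
move=> JJ' bf bg.
have b1 : bmeas (fun z : sigma_of J * sigma_of J' => f z.1 * g z.2).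
  apply: bmeasM.
    split; first exact: (measurableT_comp bf.1 measurable_fst).
    by have [_ [c fc]] := bf; exists c.
  split; first exact: (measurableT_comp bg.1 measurable_snd).
  by have [_ [c fc]] := bg; exists c.
rewrite (Ex_decouple_eq (h := fun w => f w * Ex g) JJ' b1).
  have fi := bmeas_integrable P (bmeas_sigma_of bf).
  rewrite (@eq_Ex _ _ _ P _ (fun w => Ex g * f w)) => [|w]; last exact: mulrC.
  by rewrite (ExZl _ fi) mulrC.
move=> w; exact: (ExZl (f w) (bmeas_integrable P (bmeas_sigma_of bg))).
Qed.

End independent_family.

(** * Expectation of one summand of the estimator *)

Section dithers.
Context {R : realType} d (T : measurableType d) (P : probability T R) (p : nat)
  (U : {RV P >-> p.-tuple R}).
Hypothesis hU : uniform_cube U.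
Local Notation Ex f := (Rintegral P setT f).
Local Notation unif := (uniform_prob (gtrN (@ltr01 R))).

Definition clip (l x : R) : R := Num.max (- l) (Num.min l x).

Lemma measurable_coord i : measurable_fun setT (fun w => tnth (U w) i).
Proof. exact: (measurableT_comp (measurable_tnth i) (measurable_funPT U)). Qed.

Lemma uniform_cube_pair i j (A B : set R) : i != j ->
  measurable A -> measurable B ->
  P ([set w | A (tnth (U w) i)] `&` [set w | B (tnth (U w) j)]) =
  (unif A * unif B)%E.
Proof.
move=> ij mA mB.
pose F k := if k == i then A else if k == j then B else setT.
have -> : [set w | A (tnth (U w) i)] `&` [set w | B (tnth (U w) j)] =
    [set w | forall k, F k (tnth (U w) k)].
  apply/seteqP; split=> w /=; rewrite /F.
    by move=> [Aw Bw] k; case: eqP => [->//|_]; case: eqP => [->|].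
  move=> H; split; first by have := H i; rewrite eqxx.
  by have := H j; rewrite eq_sym (negbTE ij) eqxx.
rewrite hU; last by move=> k; rewrite /F; case: ifP => // _; case: ifP.
rewrite (bigD1 i)//= (bigD1 j)//=; last by rewrite eq_sym.
rewrite big1 ?mule1; first by rewrite /F eqxx eq_sym (negbTE ij) eqxx.
move=> k /andP[ki kj]; rewrite /F (negbTE ki) (negbTE kj).
exact: probability_setT.
Qed.

Lemma uniform_cube_marginal i (A : set R) : measurable A ->
  P [set w | A (tnth (U w) i)] = unif A.
Proof.
move=> mA; pose F k := if k == i then A else setT.
have -> : [set w | A (tnth (U w) i)] = [set w | forall k, F k (tnth (U w) k)].
  apply/seteqP; split=> w /=; rewrite /F.
    by move=> Aw k; case: eqP => [->//|_].
  by move=> H; have := H i; rewrite eqxx.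
rewrite hU; last by move=> k; rewrite /F; case: ifP => // _; case: ifP.
rewrite (bigD1 i)//= big1 ?mule1; first by rewrite /F eqxx.
move=> k ki; rewrite /F (negbTE ki); exact: probability_setT.
Qed.

Lemma unif_ray c : unif `[c, +oo[%classic = (Num.max 0 (Num.min 1 ((1 - c) / 2)))%:E.
Proof.
have m11 : (-1 : R) < 1 by apply: gtrN.
have [c1|c1] := leP c (-1).
  rewrite min_l ?max_r//; last by rewrite ler_pdivlMr//; lra.
  rewrite /uniform_prob integral_uniform_pdf1// => x /=.
  by rewrite !in_itv/= andbT => /andP[h _]; apply: le_trans h.
rewrite min_r; last by rewrite ler_pdivrMr//; lra.
rewrite /uniform_prob integral_uniform_pdf.
rewrite (eq_integral (fun=> (1 - (-1))^-1%:E)); last first.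
  by move=> x; rewrite inE/= => -[_]; rewrite in_itv/= /uniform_pdf => ->.
have -> : `[c, +oo[ `&` `[-1, 1] = `[c, 1]%classic :> set R.
  apply/seteqP; split=> x /=; rewrite !in_itv/= andbT.
    by move=> [-> /andP[]].
  by move=> /andP[h1 h2]; rewrite h1 h2 (le_trans _ h1)// ltW.
rewrite integral_cst//= lebesgue_measure_itv/= lte_fin.
have [c2|c2] := ltP c 1.
  by rewrite -EFinB -EFinM max_r; [congr EFin; rewrite mulrC; congr (_ / _); lra | lra].
by rewrite mule0 max_l//; lra.
Qed.

Lemma sign1E (x : R) : sign1 x = 2 * \1_[set y : R | 0 <= y] x - 1.
Proof.
rewrite /sign1 indicE; case: (boolP (0 <= x)) => h.
  by rewrite mem_set// mulr1; lra.
by rewrite memNset ?mulr0 ?sub0r//; exact/negP.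
Qed.

Lemma sign1_sqr (x : R) : sign1 x * sign1 x = 1.
Proof. by rewrite /sign1; case: ifP => _; lra. Qed.

Lemma sign1_norm (x : R) : `|sign1 x| = 1.
Proof. by rewrite /sign1; case: ifP => _; rewrite ?normrN normr1. Qed.

Lemma measurable_sign1 : measurable_fun setT (@sign1 R).
Proof.
apply: measurable_fun_if => //; apply: measurable_fun_ler => //.
Qed.

Let ev x l i := [set w | 0 <= x + l * tnth (U w) i].
Let mset0 x l : measurable [set u : R | 0 <= x + l * u].
Proof.
rewrite -[X in measurable X]setTI.
have : measurable_fun setT (fun u : R => 0 <= x + l * u).
  by apply: measurable_fun_ler => //; apply: measurable_funD.
by move=> /(_ measurableT [set true] I).
Qed.

Lemma unif_halfline x l : 0 <= l ->
  l * (2 * fine (unif [set u : R | 0 <= x + l * u]) - 1) = clip l x.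
Proof.
(* At level 0 both sides vanish; at a positive level the event is the ray from $-x/l$. *)
rewrite le_eqVlt => /predU1P[<-|l0].
  rewrite mul0r /clip oppr0; have [h|h] := leP 0 x; first by rewrite maxxx.
  by rewrite max_l// ltW.
have -> : [set u : R | 0 <= x + l * u] = `[- x / l, +oo[%classic.
  apply/seteqP; split=> u /=; rewrite in_itv/= andbT ler_pdivrMr//; lra.
rewrite unif_ray /= /clip.
set c := - x / l; have xc : x = - (c * l) by rewrite /c divfK ?gt_eqF// opprK.
rewrite xc; have [h1|h1] := leP c (-1).
  have -> : Num.min 1 ((1 - c) / 2) = 1 by rewrite min_l//; lra.
  have -> : Num.min l (- (c * l)) = l by rewrite min_l//; nra.
  by rewrite !max_r//; lra.
have [h2|h2] := leP c 1.
  have -> : Num.min 1 ((1 - c) / 2) = (1 - c) / 2 by rewrite min_r//; lra.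
  have -> : Num.min l (- (c * l)) = - (c * l) by rewrite min_r//; nra.
  by rewrite !max_r//; [lra|nra|lra].
have -> : Num.min 1 ((1 - c) / 2) = (1 - c) / 2 by rewrite min_r//; lra.
have -> : Num.min l (- (c * l)) = - (c * l) by rewrite min_r//; nra.
by rewrite !max_l//; [lra|nra|lra].
Qed.

Let bind A : measurable A -> bmeas (\1_A : T -> R) /\ P.-integrable setT (EFin \o (\1_A : T -> R)).
Proof.
by move=> mA; split; [exact: bmeas_indic | apply: bmeas_integrable; exact: bmeas_indic].
Qed.

Let sE x l i : (fun w => sign1 (x + l * tnth (U w) i)) =1
  (fun w => 2 * \1_(ev x l i) w + (-1)).
Proof. by move=> w; rewrite sign1E !indicE. Qed.

Let mev x l i : measurable (ev x l i).
Proof.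
have := measurable_coord i measurableT (mset0 x l); rewrite setTI; exact.
Qed.

Let Eev x l i : Ex (\1_(ev x l i)) = fine (unif [set u : R | 0 <= x + l * u]).
Proof.
by rewrite -(uniform_cube_marginal i (mset0 x l)) -Ex_indic//; exact: (mev x l i).
Qed.

Lemma bmeas_sign1 x l i : bmeas (fun w => sign1 (x + l * tnth (U w) i)).
Proof.
apply: (@eq_bmeas _ _ _ (fun w => 2 * \1_(ev x l i) w + (-1))); first by move=> w; rewrite sE.
apply: bmeasD; last exact: bmeas_cst.
by apply: bmeasM; [exact: bmeas_cst | exact: bmeas_indic].
Qed.

Let Esign x l i : Ex (fun w => sign1 (x + l * tnth (U w) i)) =
  2 * fine (unif [set u : R | 0 <= x + l * u]) - 1.
Proof.
have i1 : P.-integrable setT (EFin \o (fun=> -1 : R)).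
  by apply: bmeas_integrable; exact: bmeas_cst.
have ib := (bind (mev x l i)).2.
by rewrite (eq_Ex _ (sE x l i)) (ExD (intgZl 2 ib) i1) (ExZl 2 ib) Ex_cst Eev.
Qed.

Lemma Ex_sign1 x l i : 0 <= l ->
  l * Ex (fun w => sign1 (x + l * tnth (U w) i)) = clip l x.
Proof. by move=> l0; rewrite Esign unif_halfline. Qed.

(** Distinct coordinates of one dither are independent, so the mean factorizes. For $i=j$ the two
    signs would share their noise, which is why the coordinates must differ. *)
Lemma Ex_sign1_pair x y l i j : i != j -> 0 <= l ->
  l ^+ 2 * Ex (fun w => sign1 (x + l * tnth (U w) i) * sign1 (y + l * tnth (U w) j)) =
  clip l x * clip l y.
Proof.
move=> ij l0.
suff -> : Ex (fun w => sign1 (x + l * tnth (U w) i) * sign1 (y + l * tnth (U w) j)) =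
    Ex (fun w => sign1 (x + l * tnth (U w) i)) * Ex (fun w => sign1 (y + l * tnth (U w) j)).
  by rewrite -(Ex_sign1 x i l0) -(Ex_sign1 y j l0); ring.
rewrite !Esign.
have mab : measurable (ev x l i `&` ev y l j) by apply: measurableI.
(* Each sign is $2\cdot1_A-1$, and the product of two of them is expanded so that only probabilities
   of events and of their intersection remain. *)
rewrite (@eq_Ex _ _ _ _ _ (fun w => 4 * \1_(ev x l i `&` ev y l j) w +
   ((-2) * \1_(ev x l i) w + ((-2) * \1_(ev y l j) w + 1)))); last first.
  by move=> w; rewrite !sE indicI /=; ring.
have ia := (bind (mev x l i)).2; have ib := (bind (mev y l j)).2.
have iab := (bind mab).2.
have i1 : P.-integrable setT (EFin \o (fun=> 1 : R)).
  by apply: bmeas_integrable; exact: bmeas_cst.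
have i2 := intgD (intgZl (-2) ib) i1; have i3 := intgD (intgZl (-2) ia) i2.
rewrite (ExD (intgZl 4 iab) i3) (ExD (intgZl (-2) ia) i2) (ExD (intgZl (-2) ib) i1).
rewrite (ExZl 4 iab) (ExZl (-2) ia) (ExZl (-2) ib) Ex_cst !Eev.
have -> : Ex (\1_(ev x l i `&` ev y l j)) =
    fine (unif [set u : R | 0 <= x + l * u]) * fine (unif [set u : R | 0 <= y + l * u]).
  apply: EFin_inj; rewrite Ex_indic// (uniform_cube_pair ij (mset0 x l) (mset0 y l)).
  rewrite -(uniform_cube_marginal i (mset0 x l)) -(uniform_cube_marginal j (mset0 y l)).
  rewrite -(Ex_indic P (mev x l i)) -(Ex_indic P (mev y l j)).
  by rewrite EFinM.
ring.
Qed.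

End dithers.

(** * Clipping errors and moments under a bound on $E\exp(X^2/a)$ *)

Section subgaussian_moments.
Context {R : realType}.
Implicit Types l x y a : R.

Lemma clip_norm_le l x : 0 <= l -> `|clip l x| <= l.
Proof.
move=> l0; rewrite /clip ler_norml le_max lexx/= ge_max ge_min lexx/= andbT; lra.
Qed.

Lemma clip_id l x : `|x| <= l -> clip l x = x.
Proof. by rewrite /clip ler_norml => /andP[h1 h2]; rewrite min_r// max_r. Qed.

Lemma clip_le_norm l x : 0 <= l -> `|clip l x| <= `|x|.
Proof.
move=> l0; have [h|h] := leP `|x| l; first by rewrite clip_id.
exact: le_trans (clip_norm_le x l0) (ltW h).
Qed.

Lemma clip_diff_le l x : 0 <= l -> `|x - clip l x| <= `|x|.
Proof.
move=> l0; rewrite /clip; have [x0|x0] := leP 0 x.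
  have [h|h] := leP l x; first by rewrite max_r ?(ger0_norm (_ : 0 <= x - l)) ?ger0_norm//; lra.
  by rewrite max_r ?subrr ?normr0//; lra.
rewrite (ltr0_norm x0) min_r; last lra.
have [h|h] := leP (- l) x; first by rewrite subrr normr0; lra.
by rewrite ler0_norm; lra.
Qed.

(** The difference vanishes unless $|x|>l$. There $x^2\le2a\,e^{x^2/(2a)}$, and the exponential
    factor is at most $e^{-l^2/(2a)}e^{x^2/a}$. *)
Lemma clip_diff_sqr_le l a x : 0 <= l -> 0 < a ->
  (x - clip l x) ^+ 2 <= 2 * a * expR (- (l ^+ 2 / (2 * a))) * expR (x ^+ 2 / a).
Proof.
move=> l0 a0; have [h|h] := leP `|x| l.
  by rewrite clip_id// subrr expr0n/= !mulr_ge0 ?expR_ge0// ltW.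
have lx : l ^+ 2 <= x ^+ 2.
  by rewrite -[x ^+ 2]ger0_norm ?sqr_ge0// normrX lerXn2r ?nnegrE// ltW.
have h1 : (x - clip l x) ^+ 2 <= x ^+ 2.
  rewrite -[leLHS]ger0_norm ?sqr_ge0// -[leRHS]ger0_norm ?sqr_ge0// !normrX.
  by rewrite lerXn2r ?nnegrE// clip_diff_le.
apply: le_trans h1 _.
have h2 := expR_ge1Dx (x ^+ 2 / (2 * a)).
apply: (@le_trans _ _ (2 * a * expR (x ^+ 2 / (2 * a)))).
  have e : x ^+ 2 = 2 * a * (x ^+ 2 / (2 * a)) by field; rewrite gt_eqF.
  by rewrite {1}e ler_wpM2l ?mulr_ge0 ?(ltW a0)//; lra.
rewrite -[leRHS]mulrA ler_wpM2l ?mulr_ge0 ?(ltW a0)// -expRD ler_expR.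
have -> : x ^+ 2 / a = x ^+ 2 / (2 * a) + x ^+ 2 / (2 * a).
  by field; rewrite gt_eqF.
have : l ^+ 2 / (2 * a) <= x ^+ 2 / (2 * a).
  by rewrite ler_pM2r// invr_gt0 mulr_gt0.
lra.
Qed.

(** The difference of products splits into two terms with one clipping error each, treated by the
    arithmetic-geometric inequality. The weight $e$ stays free, to be matched to the size of the
    error. *)
Lemma clip_prod_le l x y e : 0 <= l -> 0 < e ->
  `|x * y - clip l x * clip l y| <=
  2^-1 * (e * x ^+ 2 + e^-1 * (y - clip l y) ^+ 2) +
  2^-1 * (e * y ^+ 2 + e^-1 * (x - clip l x) ^+ 2).
Proof.
move=> l0 e0.
have amgm (u v : R) : 0 <= u -> 0 <= v -> u * v <= 2^-1 * (e * u ^+ 2 + e^-1 * v ^+ 2).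
  move=> u0 v0; rewrite -subr_ge0.
  have -> : 2^-1 * (e * u ^+ 2 + e^-1 * v ^+ 2) - u * v = (2 * e)^-1 * (e * u - v) ^+ 2.
    by field; rewrite gt_eqF.
  by rewrite mulr_ge0 ?sqr_ge0// invr_ge0 mulr_ge0// ltW.
have -> : x * y - clip l x * clip l y = x * (y - clip l y) + clip l y * (x - clip l x).
  by ring.
apply: le_trans (ler_normD _ _) _; rewrite !normrM.
have h1 := amgm `|x| `|y - clip l y| (normr_ge0 _) (normr_ge0 _).
have h2 := amgm `|y| `|x - clip l x| (normr_ge0 _) (normr_ge0 _).
rewrite -!normrX !(ger0_norm (sqr_ge0 _)) in h1 h2.
apply: lerD h1 _; apply: le_trans h2.
by rewrite ler_wpM2r// clip_le_norm.
Qed.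

Lemma expr4_le_expR a x : 0 < a -> x ^+ 4 <= 4 * a ^+ 2 * expR (x ^+ 2 / a).
Proof.
move=> a0; set y := x ^+ 2 / a.
have -> : x ^+ 4 = a ^+ 2 * y ^+ 2 by rewrite /y; field; rewrite gt_eqF.
rewrite (mulrC 4) -[leRHS]mulrA ler_wpM2l ?sqr_ge0//.
have y0 : 0 <= y by rewrite divr_ge0 ?sqr_ge0// ltW.
have -> : expR y = expR (y / 2) ^+ 2 by rewrite expr2 -expRD; congr expR; lra.
have h := expR_ge1Dx (y / 2).
have : (1 + y / 2) ^+ 2 <= expR (y / 2) ^+ 2 by rewrite lerXn2r ?nnegrE//; lra.
nra.
Qed.

(** $(1-z+z^2)(1+z)=1+z^3\ge1$, while $1+z\le e^z$. *)
Lemma expRN_le (z : R) : 0 <= z -> expR (- z) <= 1 - z + z ^+ 2.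
Proof.
move=> z0; have h := expR_ge1Dx z; have e0 := expR_gt0 z.
rewrite expRN -[leLHS]mul1r ler_pdivrMr//.
have : (1 - z + z ^+ 2) * (1 + z) <= (1 - z + z ^+ 2) * expR z.
  by rewrite ler_wpM2l//; nra.
have : 0 <= z ^+ 3 by rewrite exprn_ge0.
nra.
Qed.

Lemma sqr_le_expR a x : 0 < a -> x ^+ 2 <= a * expR (x ^+ 2 / a).
Proof.
move=> a0; have h := expR_ge1Dx (x ^+ 2 / a).
have e : x ^+ 2 = a * (x ^+ 2 / a) by field; rewrite gt_eqF.
by rewrite {1}e ler_wpM2l ?(ltW a0)//; lra.
Qed.

Lemma measurable_clip l : measurable_fun setT (clip l).
Proof.
apply: measurable_maxr => //; exact: measurable_minr.
Qed.

Context d (T : measurableType d) (P : probability T R) (a : R).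
Hypothesis a0 : 0 < a.
Local Notation Ex f := (Rintegral P setT f).
Local Notation intg f := (P.-integrable setT (EFin \o f)).

(** A $\psi_2$ norm of at most $\sqrt a$. Integrability is a separate clause because the real-valued
    integral of a function with integral $+\infty$ is 0, which would satisfy the last inequality. *)
Definition exp_moment_le (X : T -> R) :=
  [/\ measurable_fun setT X, intg (fun w => expR (X w ^+ 2 / a)) &
    Ex (fun w => expR (X w ^+ 2 / a)) <= 2].

Implicit Types X Y : T -> R.

Let meas2 X : measurable_fun setT X -> measurable_fun setT (fun w => X w ^+ 2).
Proof. exact: measurable_funX. Qed.

Lemma exp_moment_intg2 X : exp_moment_le X -> intg (fun w => X w ^+ 2).
Proof.
move=> [mX iX _]; apply: le_intg (intgZl a iX); first exact: meas2.
by move=> w; rewrite ger0_norm ?sqr_ge0// sqr_le_expR.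
Qed.

Lemma exp_moment_intgM X Y : exp_moment_le X -> exp_moment_le Y ->
  intg (fun w => X w * Y w).
Proof.
move=> hX hY; have [mX _ _] := hX; have [mY _ _] := hY.
apply: le_intg (intgD (exp_moment_intg2 hX) (exp_moment_intg2 hY)).
  exact: measurable_funM.
by move=> w; rewrite ler_norml; apply/andP; split; nra.
Qed.

Lemma intg_abs X : exp_moment_le X -> intg (fun w => `|X w|).
Proof.
move=> hX; have [mX _ _] := hX.
have i1 : intg (fun=> 1 : R) by apply: bmeas_integrable; exact: bmeas_cst.
apply: le_intg (intgD i1 (exp_moment_intg2 hX)).
  exact: measurableT_comp.
move=> w; rewrite normr_id.
have -> : X w ^+ 2 = `|X w| ^+ 2 by rewrite -normrX ger0_norm// sqr_ge0.
nra.
Qed.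

Let meas_clip_diff X l : measurable_fun setT X ->
  measurable_fun setT (fun w => (X w - clip l (X w)) ^+ 2).
Proof.
move=> mX; apply: measurable_funX; apply: measurable_funB => //.
exact: (measurableT_comp (measurable_clip l) mX).
Qed.

Lemma intg_clip_diff l X : 0 <= l -> exp_moment_le X ->
  intg (fun w => (X w - clip l (X w)) ^+ 2).
Proof.
move=> l0 hX; have [mX iX eX] := hX.
apply: le_intg (intgZl (2 * a * expR (- (l ^+ 2 / (2 * a)))) iX).
  exact: meas_clip_diff.
by move=> w; rewrite ger0_norm ?sqr_ge0// clip_diff_sqr_le.
Qed.

Lemma Ex_clip_diff_le l X : 0 <= l -> exp_moment_le X ->
  Ex (fun w => (X w - clip l (X w)) ^+ 2) <= 4 * a * expR (- (l ^+ 2 / (2 * a))).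
Proof.
move=> l0 hX; have [mX iX eX] := hX.
apply: le_trans (Ex_le (intg_clip_diff l0 hX) (intgZl _ iX)
  (fun w => clip_diff_sqr_le (X w) l0 a0)) _.
rewrite (ExZl _ iX).
have : 0 <= 2 * a * expR (- (l ^+ 2 / (2 * a))) by rewrite !mulr_ge0 ?expR_ge0// ltW.
nra.
Qed.

Lemma Ex_clip_prod_le l X Y (s : R) : 0 <= l ->
  exp_moment_le X -> exp_moment_le Y ->
  Ex (fun w => X w ^+ 2) <= s -> Ex (fun w => Y w ^+ 2) <= s ->
  `|Ex (fun w => X w * Y w) - Ex (fun w => clip l (X w) * clip l (Y w))| <=
  (s + 4 * a) * expR (- (l ^+ 2 / (4 * a))).
Proof.
move=> l0 hX hY Xs Ys; have [mX iX eX] := hX; have [mY iY eY] := hY.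
(* The mean squared clipping error is at most $4ae^2$, so this weight makes both halves of
   [clip_prod_le] of order $e$. *)
set e := expR (- (l ^+ 2 / (4 * a))); have e0 : 0 < e by exact: expR_gt0.
have e2 : expR (- (l ^+ 2 / (2 * a))) = e ^+ 2.
  by rewrite /e [RHS]expr2 -expRD; congr expR; field; rewrite gt_eqF.
have ic : intg (fun w => clip l (X w) * clip l (Y w)).
  apply: bmeas_integrable; apply: bmeasM; split.
  - exact: (measurableT_comp (measurable_clip l) mX).
  - by exists l => w; apply: clip_norm_le.
  - exact: (measurableT_comp (measurable_clip l) mY).
  - by exists l => w; apply: clip_norm_le.
have iXY := exp_moment_intgM hX hY.
have i2X := exp_moment_intg2 hX; have i2Y := exp_moment_intg2 hY.
have idX := intg_clip_diff l0 hX; have idY := intg_clip_diff l0 hY.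
have dX := Ex_clip_diff_le l0 hX; have dY := Ex_clip_diff_le l0 hY.
rewrite e2 in dX dY.
pose g1 := intgZl 2^-1 (intgD (intgZl e i2X) (intgZl e^-1 idY)).
pose g2 := intgZl 2^-1 (intgD (intgZl e i2Y) (intgZl e^-1 idX)).
rewrite -RintegralB//.
apply: le_trans (le_normr_Rintegral _ _) _ => //.
  exact: intgB iXY ic.
apply: le_trans (Ex_le _ (intgD g1 g2) (fun w => clip_prod_le (X w) (Y w) l0 e0)) _.
  exact: integrable_norm (intgB iXY ic).
rewrite (ExD g1 g2) (ExZl _ (intgD (intgZl e i2X) (intgZl e^-1 idY))).
rewrite (ExZl _ (intgD (intgZl e i2Y) (intgZl e^-1 idX))).
rewrite (ExD (intgZl e i2X) (intgZl e^-1 idY)) (ExD (intgZl e i2Y) (intgZl e^-1 idX)).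
rewrite (ExZl e i2X) (ExZl e i2Y) (ExZl e^-1 idX) (ExZl e^-1 idY).
have h1 : e^-1 * Ex (fun w => (X w - clip l (X w)) ^+ 2) <= 4 * a * e.
  by rewrite mulrC ler_pdivrMr//; apply: le_trans dX _; rewrite le_eqVlt; apply/orP; left; apply/eqP; ring.
have h2 : e^-1 * Ex (fun w => (Y w - clip l (Y w)) ^+ 2) <= 4 * a * e.
  by rewrite mulrC ler_pdivrMr//; apply: le_trans dY _; rewrite le_eqVlt; apply/orP; left; apply/eqP; ring.
have h3 : e * Ex (fun w => X w ^+ 2) <= e * s by rewrite ler_wpM2l// ltW.
have h4 : e * Ex (fun w => Y w ^+ 2) <= e * s by rewrite ler_wpM2l// ltW.
lra.
Qed.

(** $X^2\le B|X|$ where $|X|\le B$, and $X^2\le X^4/B^2$ elsewhere; the fourth moment is at most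
    $8a^2$. With $B$ large enough this bounds the first absolute moment from below. *)
Lemma Ex_abs_ge X (B : R) : 0 < B -> exp_moment_le X ->
  Ex (fun w => X w ^+ 2) - 8 * a ^+ 2 / B ^+ 2 <= B * Ex (fun w => `|X w|).
Proof.
move=> B0 hX; have [mX iX eX] := hX.
have h (w : T) : X w ^+ 2 <= B * `|X w| + (4 * a ^+ 2 / B ^+ 2) * expR (X w ^+ 2 / a).
  have h4 := expr4_le_expR (X w) a0.
  have h5 : X w ^+ 4 / B ^+ 2 <= 4 * a ^+ 2 / B ^+ 2 * expR (X w ^+ 2 / a).
    by rewrite [leRHS]mulrAC ler_pM2r// invr_gt0 exprn_gt0.
  apply: le_trans (_ : B * `|X w| + X w ^+ 4 / B ^+ 2 <= _); last by rewrite lerD2l.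
  have [u0 eu] : 0 <= `|X w| /\ X w ^+ 2 = `|X w| ^+ 2.
    by split=> //; rewrite -normrX ger0_norm ?sqr_ge0.
  have -> : X w ^+ 4 = (`|X w| ^+ 2) ^+ 2 by rewrite -eu -exprM.
  rewrite eu; set u := `|X w| in u0 *.
  have [uB|uB] := leP u B.
    apply: (@le_trans _ _ (B * u)); first by rewrite [leLHS]expr2 ler_wpM2r.
    by rewrite lerDl divr_ge0 ?sqr_ge0.
  apply: (@le_trans _ _ ((u ^+ 2) ^+ 2 / B ^+ 2)); last by rewrite lerDr mulr_ge0// ltW.
  rewrite ler_pdivlMr ?exprn_gt0// [in leRHS]expr2 ler_wpM2l ?sqr_ge0//.
  by rewrite lerXn2r ?nnegrE// ?ltW.
have ia := intg_abs hX.
have := Ex_le (exp_moment_intg2 hX) (intgD (intgZl B ia) (intgZl _ iX)) h.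
rewrite (ExD (intgZl B ia) (intgZl _ iX)) (ExZl B ia) (ExZl _ iX).
have : 0 <= 4 * a ^+ 2 / B ^+ 2 by rewrite divr_ge0 ?sqr_ge0// mulr_ge0 ?sqr_ge0.
have -> : 8 * a ^+ 2 / B ^+ 2 = 4 * a ^+ 2 / B ^+ 2 * 2 by ring.
nra.
Qed.

Lemma Ex_laplace_le X (b m s : R) : 0 <= b -> exp_moment_le X ->
  m <= Ex (fun w => `|X w|) -> Ex (fun w => X w ^+ 2) <= s ->
  Ex (fun w => expR (- (b * `|X w|))) <= expR (- (b * m - b ^+ 2 * s)).
Proof.
move=> b0 hX hm hs; have [mX iX eX] := hX.
have i1 : intg (fun=> 1 : R) by apply: bmeas_integrable; exact: bmeas_cst.
have ia := intg_abs hX; have i2 := exp_moment_intg2 hX.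
apply: (@le_trans _ _ (1 + (- b * m + b ^+ 2 * s))); last first.
  by apply: le_trans (expR_ge1Dx _); lra.
apply: (@le_trans _ _ (Ex (fun w => 1 + (- b * `|X w| + b ^+ 2 * X w ^+ 2)))).
  apply: Ex_le; last first.
  - move=> w; have := expRN_le (mulr_ge0 b0 (normr_ge0 (X w))).
    have e : `|X w| ^+ 2 = X w ^+ 2 by rewrite -normrX ger0_norm ?sqr_ge0.
    by rewrite exprMn e; lra.
  - exact: intgD i1 (intgD (intgZl _ ia) (intgZl _ i2)).
  - apply: bmeas_integrable; apply: (@bmeas_le _ _ _ _ 1).
      apply: measurableT_comp => //; apply: measurableT_comp => //.
      by apply: measurable_funM => //; exact: measurableT_comp.
    by move=> w; rewrite expR_ge0/= -expR0 ler_expR oppr_le0 mulr_ge0.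
rewrite (ExD i1 (intgD (intgZl _ ia) (intgZl _ i2))) Ex_cst lerD2l.
rewrite (ExD (intgZl _ ia) (intgZl _ i2)) (ExZl _ ia) (ExZl _ i2).
by apply: lerD; [nra | rewrite ler_wpM2l ?sqr_ge0].
Qed.

Lemma exp_moment_tail X (u : R) : exp_moment_le X ->
  (P [set w | (a * u <= X w ^+ 2)%R] <= (2 * expR (- u))%:E)%E.
Proof.
move=> [mX iX eX].
have mA : measurable [set w | a * u <= X w ^+ 2].
  have : measurable_fun setT (fun w => a * u <= X w ^+ 2).
    by apply: measurable_fun_ler => //; exact: meas2.
  by move=> /(_ measurableT [set true] I); rewrite setTI.
rewrite -Ex_indic// lee_fin.
have ii := bmeas_integrable P (@bmeas_indic R _ _ _ mA).
have -> : 2 * expR (- u) = expR (- u) * 2 by rewrite mulrC.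
apply: le_trans (ler_wpM2l (expR_ge0 _) eX).
rewrite -(ExZl _ iX); apply: Ex_le => //; first exact: intgZl.
move=> w; rewrite indicE -expRD; case: (boolP (w \in _)) => [|_]; last first.
  exact: expR_ge0.
rewrite inE /= => h; rewrite -expR0 ler_expR.
by rewrite addrC subr_ge0 ler_pdivlMr// mulrC.
Qed.

End subgaussian_moments.

(** * Dithered signs of a random sample *)

Section dithered_signs.
Context {R : realType} d (T : measurableType d) (P : probability T R) (p : nat)
  (I : finType) (Y : I -> {RV P >-> p.-tuple R}).
Hypothesis indY : mutually_independent Y.
Implicit Types J : {set I}.
Local Notation Ex f := (Rintegral P setT f).
Local Notation intg f := (P.-integrable setT (EFin \o f)).

Lemma bmeas_sign1_comp d' (A : measurableType d') (f : A -> R) :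
  measurable_fun setT f -> bmeas (fun z => sign1 (f z)).
Proof.
move=> mf; split; first exact: (measurableT_comp measurable_sign1 mf).
by exists 1 => z; rewrite sign1_norm.
Qed.

Lemma bmeas_clip_comp d' (A : measurableType d') (f : A -> R) l : 0 <= l ->
  measurable_fun setT f -> bmeas (fun z => clip l (f z)).
Proof.
move=> l0 mf; split; first exact: (measurableT_comp (measurable_clip l) mf).
by exists l => z; apply: clip_norm_le.
Qed.

Lemma measurable_sigma_of_coord J i k : i \in J ->
  measurable_fun setT (fun w : sigma_of Y J => tnth (Y i w) k).
Proof.
move=> iJ; apply: (measurableT_comp (measurable_tnth k)).
exact: (@measurable_sigma_of _ _ _ _ _ _ _ Y J i iJ).
Qed.

Lemma measurable_sigma_of_fst J J' i k : i \in J ->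
  measurable_fun setT (fun z : sigma_of Y J * sigma_of Y J' => tnth (Y i z.1) k).
Proof.
move=> iJ; exact: (measurableT_comp (measurable_sigma_of_coord k iJ) measurable_fst).
Qed.

Lemma measurable_sigma_of_snd J J' i k : i \in J' ->
  measurable_fun setT (fun z : sigma_of Y J * sigma_of Y J' => tnth (Y i z.2) k).
Proof.
move=> iJ; exact: (measurableT_comp (measurable_sigma_of_coord k iJ) measurable_snd).
Qed.

Variables (ix iu iv : I) (l : R).
Hypotheses (iux : iu != ix) (ivx : iv != ix) (ivu : iv != iu) (l0 : 0 <= l).
Hypotheses (hU : uniform_cube (Y iu)) (hV : uniform_cube (Y iv)).

Let X k w := tnth (Y ix w) k.
Let U k w := tnth (Y iu w) k.
Let V k w := tnth (Y iv w) k.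

Let mX k : measurable_fun setT (X k).
Proof. exact: measurable_coord. Qed.

Let dxu : {in [set ix]%SET, forall i, i \notin [set iu]%SET}.
Proof. by move=> i; rewrite !inE => /eqP->; rewrite eq_sym. Qed.

(** The two signs carry independent dithers, so each averages to a clipped coordinate given the
    sample. This covers $i=j$, the case excluded from [Ex_sign1_pair]. *)
Lemma Ex_sign1_cross i j :
  l ^+ 2 * Ex (fun w => sign1 (X i w + l * U i w) * sign1 (X j w + l * V j w)) =
  Ex (fun w => clip l (X i w) * clip l (X j w)).
Proof.
have mU k : measurable_fun setT (U k) by exact: measurable_coord.
have mV k : measurable_fun setT (V k) by exact: measurable_coord.
have bs : bmeas (fun w => sign1 (X i w + l * U i w)).
  by apply: bmeas_sign1_comp; apply: measurable_funD => //; apply: measurable_funM.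
have bt : bmeas (fun w => sign1 (X j w + l * V j w)).
  by apply: bmeas_sign1_comp; apply: measurable_funD => //; apply: measurable_funM.
rewrite -(ExZl _ (bmeas_integrable P (bmeasM bs bt))).
(* The second dither is averaged first, with the sample and the first dither frozen. *)
have e1 : Ex (fun w => l ^+ 2 * (sign1 (X i w + l * U i w) * sign1 (X j w + l * V j w)))
  = Ex (fun w => l * sign1 (X i w + l * U i w) * clip l (X j w)).
  apply: (@Ex_decouple_eq _ _ _ _ _ _ _ _ indY [set ix; iu]%SET [set iv]%SET
    (fun z => l ^+ 2 * (sign1 (X i z.1 + l * U i z.1) * sign1 (X j z.1 + l * V j z.2)))).
  - by move=> k; rewrite !inE => /orP[] /eqP ->; rewrite eq_sym.
  - apply: bmeasM; first exact: bmeas_cst.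
    apply: bmeasM; apply: bmeas_sign1_comp; apply: measurable_funD.
    + by apply: measurable_sigma_of_fst; rewrite !inE eqxx.
    + by apply: measurable_funM => //; apply: measurable_sigma_of_fst; rewrite !inE eqxx orbT.
    + by apply: measurable_sigma_of_fst; rewrite !inE eqxx.
    + by apply: measurable_funM => //; apply: measurable_sigma_of_snd; rewrite !inE.
  - move=> w /=.
    have bV := bmeas_sign1 (Y iv) (X j w) l j.
    rewrite (@eq_Ex _ _ _ _ _ (fun w' => l ^+ 2 * sign1 (X i w + l * U i w) *
      sign1 (X j w + l * V j w'))); last by move=> w'; rewrite mulrA.
    rewrite (ExZl _ (bmeas_integrable P bV)) -(Ex_sign1 hV (X j w) j l0).
    by rewrite expr2; ring.
rewrite e1; clear e1.
apply: (@Ex_decouple_eq _ _ _ _ _ _ _ _ indY [set ix]%SET [set iu]%SET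
    (fun z => l * sign1 (X i z.1 + l * U i z.2) * clip l (X j z.1))).
- exact: dxu.
- apply: bmeasM; first apply: bmeasM; first exact: bmeas_cst.
  + apply: bmeas_sign1_comp; apply: measurable_funD.
      by apply: measurable_sigma_of_fst; rewrite !inE.
    by apply: measurable_funM => //; apply: measurable_sigma_of_snd; rewrite !inE.
  + by apply: bmeas_clip_comp => //; apply: measurable_sigma_of_fst; rewrite !inE.
- move=> w /=; have bU := bmeas_sign1 (Y iu) (X i w) l i.
  rewrite (@eq_Ex _ _ _ _ _ (fun w' => l * clip l (X j w) *
      sign1 (X i w + l * U i w'))); last by move=> w'; ring.
  by rewrite (ExZl _ (bmeas_integrable P bU)) -(Ex_sign1 hU (X i w) i l0); ring.
Qed.

(** Given the sample, the off-diagonal products average to products of clipped coordinates. A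
    diagonal product is 1, which accounts for the extra $l^2\sum_ic_i^2$. *)
Lemma Ex_signs_sqr_le (c : 'I_p -> R) :
  l ^+ 2 * Ex (fun w => (\sum_i c i * sign1 (X i w + l * U i w)) ^+ 2) <=
  l ^+ 2 * \sum_i c i ^+ 2 + Ex (fun w => (\sum_i c i * clip l (X i w)) ^+ 2).
Proof.
have mU k : measurable_fun setT (U k) by exact: measurable_coord.
have bs i : bmeas (fun w => sign1 (X i w + l * U i w)).
  by apply: bmeas_sign1_comp; apply: measurable_funD => //; apply: measurable_funM.
have bS : bmeas (fun w => (\sum_i c i * sign1 (X i w + l * U i w)) ^+ 2).
  apply: bmeasX; apply: bmeas_sum => i _; apply: bmeasM => //; exact: bmeas_cst.
have bC : bmeas (fun w => (\sum_i c i * clip l (X i w)) ^+ 2).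
  apply: bmeasX; apply: bmeas_sum => i _; apply: bmeasM; first exact: bmeas_cst.
  by apply: bmeas_clip_comp.
rewrite -(ExZl _ (bmeas_integrable P bS)).
rewrite -[X in X + _](Ex_cst P) -ExD; last 2 first.
- by apply: bmeas_integrable; exact: bmeas_cst.
- exact: bmeas_integrable.
apply: (@Ex_decouple_le _ _ _ _ _ _ _ _ indY [set ix]%SET [set iu]%SET
    (fun z => l ^+ 2 * (\sum_i c i * sign1 (X i z.1 + l * U i z.2)) ^+ 2)).
- exact: dxu.
- apply: bmeasM; first exact: bmeas_cst.
  apply: bmeasX; apply: bmeas_sum => i _; apply: bmeasM; first exact: bmeas_cst.
  apply: bmeas_sign1_comp; apply: measurable_funD.
    by apply: measurable_sigma_of_fst; rewrite !inE.
  by apply: measurable_funM => //; apply: measurable_sigma_of_snd; rewrite !inE.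
- by apply: bmeasD => //; exact: bmeas_cst.
move=> w /=.
have bU i := bmeas_sign1 (Y iu) (X i w) l i.
pose g i j w' := c i * c j * (sign1 (X i w + l * U i w') * sign1 (X j w + l * U j w')).
have ig i j : intg (g i j).
  exact: intgZl (bmeas_integrable P (bmeasM (bU i) (bU j))).
have sqE (F : 'I_p -> R) : (\sum_i F i) ^+ 2 = \sum_i \sum_j F i * F j.
  by rewrite expr2 mulr_suml; apply: eq_bigr => i _; rewrite mulr_sumr.
rewrite (@eq_Ex _ _ _ _ _ (fun w' => l ^+ 2 * \sum_i \sum_j g i j w')); last first.
  move=> w'; rewrite sqE; congr (_ * _); apply: eq_bigr => i _; apply: eq_bigr => j _.
  by rewrite /g; ring.
rewrite ExZl; last by apply: intg_sum => i; apply: intg_sum.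
rewrite Ex_sum; last by move=> i; apply: intg_sum.
rewrite !mulr_sumr sqE -big_split /=; apply: ler_sum => i _.
rewrite Ex_sum// mulr_sumr (bigD1 i)//= [in leRHS](bigD1 i)//= addrA.
apply: lerD.
  rewrite (@eq_Ex _ _ _ _ _ (fun=> c i ^+ 2)); last first.
    by move=> w'; rewrite /g sign1_sqr mulr1 expr2.
  by rewrite Ex_cst lerDl -expr2 sqr_ge0.
apply: ler_sum => j ji; rewrite le_eqVlt; apply/orP; left; apply/eqP.
rewrite /g (ExZl _ (bmeas_integrable P (bmeasM (bU i) (bU j)))).
rewrite mulrCA (Ex_sign1_pair hU (X i w) (X j w) _ l0) 1?eq_sym//.
ring.
Qed.

End dithered_signs.

(** * Quadratic forms of a single summand *)

Section quadratic_step.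
Context {R : realType} (p : nat).
Implicit Types x u v : p.-tuple R.

Definition dithered_sign l x u : 'cV[R]_p := sign_mx (colvec x + l *: colvec u).

Definition sym_part (Z : 'M[R]_p) : 'M[R]_p := 2^-1 *: Z + 2^-1 *: Z^T.

Definition onebit_step l x u v : 'M[R]_p :=
  sym_part (l ^+ 2 *: (dithered_sign l x u *m (dithered_sign l x v)^T)).

Definition onebit_error (M Sigma : 'M[R]_p) eta l x u v : 'M[R]_p :=
  eta *: (hadamard M (onebit_step l x u v) - hadamard M Sigma).

Lemma sqr_sumE (I : finType) (F : I -> R) : (\sum_i F i) ^+ 2 = \sum_i \sum_j F i * F j.
Proof. by rewrite expr2 mulr_suml; apply: eq_bigr => i _; rewrite mulr_sumr. Qed.

(** Cauchy-Schwarz with weights $|c_j|$. Keeping the weights inside both sums yields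
    $(\sum_j|c_j|)^2$ once the $f_j^2$ have a common bound. *)
Lemma sqr_sum_le (I : finType) (c f : I -> R) :
  (\sum_j c j * f j) ^+ 2 <= (\sum_j `|c j|) * \sum_j `|c j| * f j ^+ 2.
Proof.
have h i j : c i * f i * (c j * f j) <=
    2^-1 * (`|c i| * (`|c j| * f j ^+ 2)) + 2^-1 * (`|c j| * (`|c i| * f i ^+ 2)).
  apply: le_trans (ler_norm _) _; rewrite !normrM.
  have -> : `|c i| * `|f i| * (`|c j| * `|f j|) = (`|c i| * `|c j|) * (`|f i| * `|f j|).
    by ring.
  have -> : 2^-1 * (`|c i| * (`|c j| * f j ^+ 2)) + 2^-1 * (`|c j| * (`|c i| * f i ^+ 2)) =
    (`|c i| * `|c j|) * (2^-1 * (f i ^+ 2 + f j ^+ 2)) by ring.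
  rewrite ler_wpM2l ?mulr_ge0//.
  have e k : f k ^+ 2 = `|f k| ^+ 2 by rewrite -normrX ger0_norm ?sqr_ge0.
  by rewrite !e; have := sqr_ge0 (`|f i| - `|f j|); nra.
rewrite sqr_sumE; apply: le_trans (ler_sum _ (fun i _ => ler_sum _ (fun j _ => h i j))) _.
under eq_bigr do rewrite big_split.
rewrite big_split /= [X in _ + X]exchange_big /= mulr_suml.
rewrite -big_split /= ler_sum// => i _.
by rewrite -!mulr_sumr; lra.
Qed.

Section pointwise.
Variables (M Sigma : 'M[R]_p) (l : R) (x u v : p.-tuple R).
Hypothesis sM : M^T = M.

Let Z := l ^+ 2 *: (dithered_sign l x u *m (dithered_sign l x v)^T).

Lemma hadamard_sym_part (A : 'M[R]_p) :
  hadamard M (sym_part A) = sym_part (hadamard M A).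
Proof.
apply/matrixP => i j; rewrite !mxE.
have -> : M j i = M i j by rewrite -[in LHS]sM mxE.
ring.
Qed.

Lemma sym_part_sym (A : 'M[R]_p) : (sym_part A)^T = sym_part A.
Proof. by rewrite linearD /= !linearZ /= trmxK addrC. Qed.

Let ZE i j : Z i j = l ^+ 2 * (sign1 (tnth x i + l * tnth u i) * sign1 (tnth x j + l * tnth v j)).
Proof. by rewrite !mxE big_ord1 !mxE. Qed.

Let h (M' : 'M[R]_p) u' v' (y : 'cV[R]_p) :
  dot (hadamard M' (l ^+ 2 *: (dithered_sign l x u' *m (dithered_sign l x v')^T)) *m y)
    (hadamard M' (l ^+ 2 *: (dithered_sign l x u' *m (dithered_sign l x v')^T)) *m y) =
  l ^+ 4 * \sum_k (\sum_j M' k j * y j 0 * sign1 (tnth x j + l * tnth v' j)) ^+ 2.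
Proof.
rewrite mulr_sumr; apply: eq_bigr => k _; rewrite -expr2 mxE.
rewrite (eq_bigr (fun j => l ^+ 2 * sign1 (tnth x k + l * tnth u' k) *
   (M' k j * y j 0 * sign1 (tnth x j + l * tnth v' j)))); last first.
  by move=> j _; rewrite !mxE big_ord1 !mxE; ring.
rewrite -mulr_sumr; set S := \sum_(i < p) _; set e := sign1 _.
have -> : (l ^+ 2 * e * S) ^+ 2 = l ^+ 4 * (e * e) * S ^+ 2 by ring.
by rewrite sign1_sqr mulr1.
Qed.

(** These are the first- and second-order terms needed by the Laplace transform. In the second one
    the sign attached to a row squares to 1, so each row involves one dither only; transposition
    exchanges the two dithers. *)
Lemma onebit_step_quad_le (eta : R) (y : 'cV[R]_p) :
  dot y (onebit_error M Sigma eta l x u v *m y) +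
  dot (onebit_error M Sigma eta l x u v *m y)
    (onebit_error M Sigma eta l x u v *m y) <=
  (\sum_i \sum_j eta * (M i j * (y i 0 * y j 0)) *
     (l ^+ 2 * (sign1 (tnth x i + l * tnth u i) * sign1 (tnth x j + l * tnth v j))
      - Sigma i j)) +
  eta ^+ 2 * (l ^+ 2 * (l ^+ 2 * \sum_k (\sum_j M k j * y j 0 * sign1 (tnth x j + l * tnth v j)) ^+ 2)
   + l ^+ 2 * (l ^+ 2 * \sum_k (\sum_j M k j * y j 0 * sign1 (tnth x j + l * tnth u j)) ^+ 2)
   + 2 * dot (hadamard M Sigma *m y) (hadamard M Sigma *m y)).
Proof.
rewrite /onebit_error /onebit_step -/Z hadamard_sym_part.
set W := hadamard M Z; set S := hadamard M Sigma.
rewrite -!scalemxAl dotZr !dotZl !dotZr mulmxBl (mulrA eta eta) -expr2.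
(* A quadratic form sees only the symmetric part, so symmetrizing leaves the linear term
   unchanged. *)
have e1 : dot y (sym_part W *m y) = dot y (W *m y).
  rewrite mulmxDl -!scalemxAl dotDr !dotZr.
  have -> : dot y (W^T *m y) = dot y (W *m y) by rewrite -dot_mulmx dotC.
  lra.
have WT : W^T = hadamard M (l ^+ 2 *: (dithered_sign l x v *m (dithered_sign l x u)^T)).
  apply/matrixP => i j; rewrite /W /Z !mxE !big_ord1 !mxE.
  have -> : M j i = M i j by rewrite -[in LHS]sM mxE.
  ring.
have nsq (a b : 'cV[R]_p) : dot (a - b) (a - b) <= 2 * dot a a + 2 * dot b b.
  have := dot_ge0 (a + b); rewrite -(scaleN1r b) !dotDl !dotDr !dotZl !dotZr (dotC b a); lra.
have nsq2 : dot (sym_part W *m y) (sym_part W *m y) <=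
    2^-1 * (dot (W *m y) (W *m y) + dot (W^T *m y) (W^T *m y)).
  rewrite mulmxDl -!scalemxAl; set a := W *m y; set b := W^T *m y.
  have := dot_ge0 (a - b); rewrite -(scaleN1r b) !dotDl !dotDr !dotZl !dotZr (dotC b a); lra.
apply: lerD.
  rewrite -[dot y _]/(dot y _) dotDr -scaleN1r dotZr e1.
  have qE (A : 'M[R]_p) : dot y (A *m y) = \sum_i \sum_j A i j * (y i 0 * y j 0).
    apply: eq_bigr => i _; rewrite mxE mulr_sumr; apply: eq_bigr => j _; ring.
  rewrite !qE mulrDr !mulr_sumr -big_split /= le_eqVlt; apply/orP; left; apply/eqP.
  apply: eq_bigr => i _; rewrite !mulr_sumr -big_split /=; apply: eq_bigr => j _.
  by rewrite /W /S !hadamardE ZE; ring.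
rewrite ler_wpM2l ?sqr_ge0//; apply: le_trans (nsq _ _) _; rewrite lerD2r.
have nsq3 : 2 * dot (sym_part W *m y) (sym_part W *m y) <=
  dot (W *m y) (W *m y) + dot (W^T *m y) (W^T *m y) by lra.
apply: le_trans nsq3 _; rewrite WT /W /Z !h.
(* One $l^2$ stays next to the squared signs, where averaging turns it into clipped coordinates; the
   other is bounded by $L^2$ later. *)
have e4 q : l ^+ 4 * q = l ^+ 2 * (l ^+ 2 * q) by ring.
by rewrite !e4.
Qed.

End pointwise.
End quadratic_step.

Section expected_step.
Context {R : realType} d (T : measurableType d) (P : probability T R) (p : nat)
  (I : finType) (Y : I -> {RV P >-> p.-tuple R}).
Hypothesis indY : mutually_independent Y.
Variables (ix iu iv : I) (a s : R) (M Sigma : 'M[R]_p).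
Hypotheses (iux : iu != ix) (ivx : iv != ix) (ivu : iv != iu).
Hypotheses (hU : uniform_cube (Y iu)) (hV : uniform_cube (Y iv)).
Hypotheses (a0 : 0 < a) (s0 : 0 <= s).
Local Notation Ex f := (Rintegral P setT f).
Local Notation intg f := (P.-integrable setT (EFin \o f)).

Let X k w := tnth (Y ix w) k.

Hypothesis expX : forall k, exp_moment_le P a (X k).
Hypothesis covX : forall i j, Ex (fun w => X i w * X j w) = Sigma i j.
Hypothesis diagS : forall i, Sigma i i <= s.
Hypotheses (M0 : forall i j, 0 <= M i j) (sM : M^T = M).

Let iXX i j : intg (fun w => X i w * X j w).
Proof. exact: (exp_moment_intgM a0 (expX i) (expX j)). Qed.

Lemma cov_sym : Sigma^T = Sigma.
Proof.
by apply/matrixP => i j; rewrite mxE -!covX; apply: eq_Ex => w; rewrite mulrC.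
Qed.

Lemma Ex_sqr_dot (c : 'I_p -> R) :
  Ex (fun w => (\sum_i c i * X i w) ^+ 2) =
  dot (\col_i c i) (Sigma *m \col_i c i).
Proof.
rewrite (@eq_Ex _ _ _ _ _ (fun w => \sum_i \sum_j (c i * c j) * (X i w * X j w))); last first.
  move=> w; rewrite sqr_sumE; apply: eq_bigr => i _; apply: eq_bigr => j _; ring.
have ig i j : intg (fun w => (c i * c j) * (X i w * X j w)) by apply: intgZl.
rewrite Ex_sum; last by move=> i; apply: intg_sum.
apply: eq_bigr => i _; rewrite Ex_sum// !mxE mulr_sumr.
by apply: eq_bigr => j _; rewrite ExZl// covX !mxE; ring.
Qed.

Lemma cov_psd (v : 'cV[R]_p) : 0 <= dot v (Sigma *m v).
Proof.
have -> : v = \col_i v i 0 by apply/matrixP => i j; rewrite mxE (ord1 j).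
by rewrite -Ex_sqr_dot; apply: Rintegral_ge0 => w _; rewrite sqr_ge0.
Qed.

Section clipped.
Variable l : R.
Hypothesis l0 : 0 <= l.

Let mX k : measurable_fun setT (X k).
Proof. exact: measurable_coord. Qed.

Let bc k : bmeas (fun w => clip l (X k w)).
Proof. exact: bmeas_clip_comp. Qed.

(** A clipped coordinate is the coordinate minus its clipping error: the first part gives the
    covariance form, the second an exponentially small term. *)
Lemma Ex_clip_sqr_le (c : 'I_p -> R) :
  Ex (fun w => (\sum_i c i * clip l (X i w)) ^+ 2) <=
  2 * dot (\col_i c i) (Sigma *m \col_i c i) +
  2 * ((\sum_i `|c i|) ^+ 2 * (4 * a * expR (- (l ^+ 2 / (2 * a))))).
Proof.
pose D i w := (X i w - clip l (X i w)) ^+ 2.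
have iD i : intg (D i) by apply: (intg_clip_diff a0 l0 (expX i)).
pose g w := 2 * (\sum_i c i * X i w) ^+ 2 +
  2 * ((\sum_i `|c i|) * \sum_i `|c i| * D i w).
have i1 : intg (fun w => (\sum_i c i * X i w) ^+ 2).
  rewrite (_ : (fun w => _) = fun w => \sum_i \sum_j (c i * c j) * (X i w * X j w)).
    by apply: intg_sum => i; apply: intg_sum => j; apply: intgZl.
  apply/funext => w; rewrite sqr_sumE; apply: eq_bigr => i _; apply: eq_bigr => j _; ring.
have i2 : intg (fun w => \sum_i `|c i| * D i w).
  by apply: intg_sum => i; apply: intgZl.
have i3 := intgZl (\sum_i `|c i|) i2.
have bC : bmeas (fun w => (\sum_i c i * clip l (X i w)) ^+ 2).
  by apply: bmeasX; apply: bmeas_sum => i _; apply: bmeasM; first exact: bmeas_cst.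
apply: (@le_trans _ _ (Ex g)).
  apply: Ex_le => //; first exact: bmeas_integrable.
    exact: intgD (intgZl 2 i1) (intgZl 2 i3).
  move=> w; apply: (@le_trans _ _ (2 * (\sum_i c i * X i w) ^+ 2 +
     2 * (\sum_i c i * (X i w - clip l (X i w))) ^+ 2)).
    set A := \sum_i c i * X i w; set B := \sum_i c i * (X i w - _).
    have -> : \sum_i c i * clip l (X i w) = A - B.
      by rewrite /A /B -sumrB; apply: eq_bigr => i _; ring.
    have := sqr_ge0 (A + B); nra.
  by rewrite /g lerD2l ler_wpM2l// sqr_sum_le.
rewrite (ExD (intgZl 2 i1) (intgZl 2 i3)) (ExZl _ i1) (ExZl _ i3) (ExZl _ i2).
rewrite Ex_sqr_dot lerD2l ler_wpM2l// expr2 -mulrA ler_wpM2l ?sumr_ge0//.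
rewrite Ex_sum; last by move=> i; apply: intgZl.
rewrite mulr_suml; apply: ler_sum => i _; rewrite ExZl// ler_wpM2l//.
exact: Ex_clip_diff_le.
Qed.

Let mu := opnorm M.
Let m := norm12 M ^+ 2.
Let S := opnorm Sigma.

(** [Ex_signs_sqr_le] is applied with $c_j=M_{kj}y_j$. Summed over the rows $k$, its three
    contributions are bounded by [sum_sqr_le], [hadamard_sum_quad_le] and [sum_abs_le]. *)
Lemma Ex_signs_sum_le (iw : I) (y : 'cV[R]_p) :
  iw != ix -> uniform_cube (Y iw) ->
  l ^+ 2 * Ex (fun w => \sum_k (\sum_j M k j * y j 0 *
     sign1 (X j w + l * tnth (Y iw w) j)) ^+ 2) <=
  (l ^+ 2 * m + 2 * S * m +
   8 * a * expR (- (l ^+ 2 / (2 * a))) * mu ^+ 2) * dot y y.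
Proof.
move=> iwx hW.
have mW k : measurable_fun setT (fun w => tnth (Y iw w) k) by exact: measurable_coord.
have bs k : bmeas (fun w => (\sum_j M k j * y j 0 *
     sign1 (X j w + l * tnth (Y iw w) j)) ^+ 2).
  apply: bmeasX; apply: bmeas_sum => j _; apply: bmeasM; first exact: bmeas_cst.
  by apply: bmeas_sign1_comp; apply: measurable_funD => //; apply: measurable_funM.
rewrite Ex_sum; last by move=> k; apply: bmeas_integrable.
set q := expR _.
have h k := Ex_signs_sqr_le indY iwx l0 hW (fun j => M k j * y j 0).
have h2 k := Ex_clip_sqr_le (fun j => M k j * y j 0).
rewrite mulr_sumr.
apply: (@le_trans _ _ (\sum_k (l ^+ 2 * \sum_j (M k j * y j 0) ^+ 2 +
  (2 * dot (\col_j (M k j * y j 0)) (Sigma *m \col_j (M k j * y j 0)) +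
   2 * ((\sum_j M k j * `|y j 0|) ^+ 2 * (4 * a * q)))))).
  apply: ler_sum => k _; apply: le_trans (h k) _; rewrite lerD2l.
  apply: le_trans (h2 k) _; rewrite lerD2l ler_wpM2l// le_eqVlt.
  apply/orP; left; apply/eqP; congr (_ ^+ 2 * _).
  by apply: eq_bigr => j _; rewrite normrM ger0_norm.
rewrite !big_split /= -!mulr_sumr -mulr_suml.
have h3 := sum_sqr_le M y.
have h4 := hadamard_sum_quad_le M y cov_psd.
have h5 := sum_abs_le M y.
have l2 : 0 <= l ^+ 2 by apply: sqr_ge0.
have q0 : 0 <= 4 * a * q by rewrite !mulr_ge0 ?expR_ge0// ltW.
have h3' := ler_wpM2l l2 h3.
have h5' := ler_wpM2r q0 h5.
rewrite -/mu -/m -/S in h3' h4 h5' *.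
have -> : (l ^+ 2 * m + 2 * S * m + 8 * a * q * mu ^+ 2) * dot y y =
  l ^+ 2 * (m * dot y y) + (2 * (S * (m * dot y y)) +
   2 * (mu ^+ 2 * dot y y * (4 * a * q))) by ring.
by apply: lerD => //; apply: lerD; rewrite ler_wpM2l.
Qed.

(** The first term is the clipping bias, the second the second moment. One number [b] serves both,
    since $e^{-l^2/(2a)}\le e^{-l^2/(4a)}$. *)
Lemma Ex_onebit_error_le (eta L b : R) (y : 'cV[R]_p) :
  l <= L -> expR (- (l ^+ 2 / (4 * a))) <= b ->
  Ex (fun w => let B := onebit_error M Sigma eta l (Y ix w) (Y iu w) (Y iv w) in
     dot y (B *m y) + dot (B *m y) (B *m y)) <=
  (`|eta| * ((s + 4 * a) * b * mu) +
   eta ^+ 2 * (2 * (L ^+ 2 * (L ^+ 2 * m + 2 * S * m + 8 * a * b * mu ^+ 2) + s * S * m)))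
  * dot y y.
Proof.
move=> lL qb.
have mU i k : measurable_fun setT (fun w => tnth (Y i w) k) by exact: measurable_coord.
have bs i j : bmeas (fun w => sign1 (X j w + l * tnth (Y i w) j)).
  by apply: bmeas_sign1_comp; apply: measurable_funD => //; apply: measurable_funM.
have bsum i : bmeas (fun w => \sum_k (\sum_j M k j * y j 0 *
     sign1 (X j w + l * tnth (Y i w) j)) ^+ 2).
  apply: bmeas_sum => k _; apply: bmeasX; apply: bmeas_sum => j _.
  by apply: bmeasM; first exact: bmeas_cst.
pose f1 w := \sum_i \sum_j eta * (M i j * (y i 0 * y j 0)) *
   (l ^+ 2 * (sign1 (X i w + l * tnth (Y iu w) i) * sign1 (X j w + l * tnth (Y iv w) j))
   - Sigma i j).
pose f2 i w := l ^+ 2 * (l ^+ 2 * \sum_k (\sum_j M k j * y j 0 *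
     sign1 (X j w + l * tnth (Y i w) j)) ^+ 2).
pose e := 2 * dot (hadamard M Sigma *m y) (hadamard M Sigma *m y).
have bf1' i j : bmeas (fun w => l ^+ 2 * (sign1 (X i w + l * tnth (Y iu w) i) *
    sign1 (X j w + l * tnth (Y iv w) j)) - Sigma i j).
  by apply: bmeasB; [apply: bmeasM; [exact: bmeas_cst|exact: bmeasM]|exact: bmeas_cst].
have bf1 : bmeas f1.
  apply: bmeas_sum => i _; apply: bmeas_sum => j _; apply: bmeasM; first exact: bmeas_cst.
  exact: bf1'.
have bf2 i : bmeas (f2 i).
  by do 2 (apply: bmeasM; first exact: bmeas_cst).
have ibm f : bmeas f -> intg f by exact: bmeas_integrable.
have if3 : bmeas (fun w => f2 iv w + f2 iu w + e).
  by apply: bmeasD; [exact: bmeasD|exact: bmeas_cst].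
apply: (@le_trans _ _ (Ex (fun w => f1 w + eta ^+ 2 * (f2 iv w + f2 iu w + e)))).
  apply: Ex_le; last by move=> w; apply: onebit_step_quad_le.
  - apply: ibm; rewrite /=.
    have bE i j : bmeas (fun w => onebit_error M Sigma eta l (Y ix w) (Y iu w) (Y iv w) i j).
      apply: (@eq_bmeas _ _ _ (fun w => eta * (M i j * (2^-1 *
        (l ^+ 2 * (sign1 (X i w + l * tnth (Y iu w) i) * sign1 (X j w + l * tnth (Y iv w) j))) +
        2^-1 * (l ^+ 2 * (sign1 (X j w + l * tnth (Y iu w) j) * sign1 (X i w + l * tnth (Y iv w) i)))) -
        M i j * Sigma i j))).
        by move=> w; rewrite !mxE !big_ord1 !mxE.
      apply: bmeasM; first exact: bmeas_cst.
      apply: bmeasB; last exact: bmeas_cst.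
      apply: bmeasM; first exact: bmeas_cst.
      by apply: bmeasD; do 2 (apply: bmeasM; first exact: bmeas_cst); apply: bmeasM.
    have bEy i : bmeas (fun w => (onebit_error M Sigma eta l (Y ix w) (Y iu w) (Y iv w) *m y) i 0).
      apply: (@eq_bmeas _ _ _ (fun w => \sum_j onebit_error M Sigma eta l (Y ix w) (Y iu w) (Y iv w) i j * y j 0)).
        by move=> w; rewrite [RHS]mxE.
      by apply: bmeas_sum => j _; apply: bmeasM; last exact: bmeas_cst.
    apply: bmeasD; apply: bmeas_sum => i _; apply: bmeasM => //; exact: bmeas_cst.
  - by apply: ibm; apply: bmeasD => //; apply: bmeasM; first exact: bmeas_cst.
rewrite (ExD (ibm _ bf1) (intgZl _ (ibm _ if3))) (ExZl _ (ibm _ if3)).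
rewrite (ExD (intgD (ibm _ (bf2 iv)) (ibm _ (bf2 iu))) (ibm _ (bmeas_cst T e))).
rewrite (ExD (ibm _ (bf2 iv)) (ibm _ (bf2 iu))) Ex_cst mulrDl.
have q0 := expR_ge0 (- (l ^+ 2 / (4 * a))).
have b0 : 0 <= b by apply: le_trans qb.
have mu0 : 0 <= mu by apply: opnorm_ge0.
have m0 : 0 <= m by apply: sqr_ge0.
have S0 : 0 <= S by apply: opnorm_ge0.
have y0 := dot_ge0 y.
have dS : 0 <= (s + 4 * a) * b by rewrite mulr_ge0// addr_ge0// mulr_ge0// ltW.
apply: lerD.
  rewrite Ex_sum; last first.
    by move=> i; apply: intg_sum => j; apply: intgZl; exact: ibm.
  apply: (@le_trans _ _ (\sum_i \sum_j `|eta| * (`|y i 0| * (M i j * `|y j 0|)) * ((s + 4 * a) * b))).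
    apply: ler_sum => i _; rewrite Ex_sum; last by move=> j; apply: intgZl; exact: ibm.
    apply: ler_sum => j _; rewrite (ExZl _ (ibm _ (bf1' i j))).
    rewrite (RintegralB _ (ibm _ (bmeasM (bmeas_cst T _) (bmeasM (bs iu i) (bs iv j)))) (ibm _ (bmeas_cst T _)))//.
    rewrite (ExZl _ (ibm _ (bmeasM (bs iu i) (bs iv j)))) Ex_cst.
    rewrite (Ex_sign1_cross indY iux ivx ivu l0 hU hV i j) -covX.
    apply: le_trans (ler_norm _) _; rewrite normrM distrC; apply: ler_pM => //.
      rewrite !normrM (ger0_norm (M0 i j)) le_eqVlt; apply/orP; left; apply/eqP; ring.
    have hd k : Ex (fun w => X k w ^+ 2) <= s.
      by apply: le_trans (diagS k); rewrite -covX le_eqVlt; apply/orP; left; apply/eqP; apply: eq_Ex => w; rewrite expr2.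
    apply: le_trans (Ex_clip_prod_le a0 l0 (expX i) (expX j) (hd i) (hd j)) _.
    by rewrite ler_wpM2l// addr_ge0// mulr_ge0// ltW.
  (* With absolute values the biases assemble into the quadratic form of [M] at $|y|$, so the bias
     costs [opnorm M]. *)
  have -> : \sum_i \sum_j `|eta| * (`|y i 0| * (M i j * `|y j 0|)) * ((s + 4 * a) * b) =
     `|eta| * ((s + 4 * a) * b) * dot (map_mx Num.norm y) (M *m map_mx Num.norm y).
    rewrite mulr_sumr; apply: eq_bigr => i _; rewrite !mxE !mulr_sumr.
    by apply: eq_bigr => j _; rewrite mxE; ring.
  have := quad_le_opnorm M (map_mx Num.norm y).
  rewrite -(norm2_sqr (map_mx _ y)) norm2_abs norm2_sqr -/mu => hq.
  have := ler_wpM2l (mulr_ge0 (normr_ge0 eta) dS) hq.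
  by move=> /le_trans; apply; rewrite le_eqVlt; apply/orP; left; apply/eqP; ring.
rewrite -[leRHS]mulrA ler_wpM2l ?sqr_ge0//.
have l2L : l ^+ 2 <= L ^+ 2 by rewrite lerXn2r// nnegrE// (le_trans l0).
have l2 : 0 <= l ^+ 2 by apply: sqr_ge0.
have qq : expR (- (l ^+ 2 / (2 * a))) <= b.
  apply: le_trans qb; rewrite ler_expR lerN2 ler_wpM2l//.
  by rewrite lef_pV2 ?posrE ?mulr_gt0// ler_wpM2r// ?(ltW a0)//; lra.
have h1 i : i != ix -> uniform_cube (Y i) -> Ex (f2 i) <=
   L ^+ 2 * (L ^+ 2 * m + 2 * S * m + 8 * a * b * mu ^+ 2) * dot y y.
  move=> ixi hi; rewrite /f2 (ExZl _ (intgZl _ (ibm _ (bsum i)))) (ExZl _ (ibm _ (bsum i))).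
  apply: le_trans (ler_wpM2l l2 (Ex_signs_sum_le y ixi hi)) _.
  rewrite -[leRHS]mulrA; apply: ler_pM => //.
    have := expR_ge0 (- (l ^+ 2 / (2 * a))); have := sqr_ge0 mu => e1 e2.
    apply: mulr_ge0 => //; apply: addr_ge0; last by rewrite !mulr_ge0// ltW.
    by apply: addr_ge0; [exact: mulr_ge0|apply: mulr_ge0 => //; apply: mulr_ge0].
  rewrite ler_wpM2r//; apply: lerD; first by apply: lerD => //; apply: ler_wpM2r.
  by rewrite ler_wpM2r ?sqr_ge0// ler_wpM2l// mulr_ge0// ltW.
have h2 := hadamard_psd_le M y cov_sym cov_psd diagS s0.
have h1u := h1 iu iux hU; have h1v := h1 iv ivx hV.
rewrite -/S -/m in h2; rewrite /e.
have -> : 2 * (L ^+ 2 * (L ^+ 2 * m + 2 * S * m + 8 * a * b * mu ^+ 2) + s * S * m) * dot y y =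
   L ^+ 2 * (L ^+ 2 * m + 2 * S * m + 8 * a * b * mu ^+ 2) * dot y y +
   L ^+ 2 * (L ^+ 2 * m + 2 * S * m + 8 * a * b * mu ^+ 2) * dot y y +
   2 * (s * (S * (m * dot y y))) by ring.
by apply: lerD; [exact: lerD|rewrite ler_wpM2l].
Qed.

End clipped.
End expected_step.

(** * Concentration of sums of adapted random matrices *)

Section adapted_matrix_sums.
Context {R : realType} d d' (T : measurableType d) (S : measurableType d')
  (P : probability T R) (I : finType) (Y : I -> {RV P >-> S}).
Hypothesis indY : mutually_independent Y.
Local Notation Ex f := (Rintegral P setT f).
Implicit Types J : {set I}.

Definition mxbmeas d0 (A : measurableType d0) m p (F : A -> 'M[R]_(m, p)) :=
  forall i j, bmeas (fun w => F w i j).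

Section closure.
Context d0 (A : measurableType d0) (m p q : nat).

Lemma mxbmeas_cst (Z : 'M[R]_(m, p)) : mxbmeas (fun=> Z : 'M[R]_(m, p)) (A := A).
Proof. by move=> i j; apply: bmeas_cst. Qed.

Lemma mxbmeasD (F G : A -> 'M[R]_(m, p)) :
  mxbmeas F -> mxbmeas G -> mxbmeas (fun w => F w + G w).
Proof.
by move=> bF bG i j; apply: eq_bmeas (bmeasD (bF i j) (bG i j)) => w; rewrite mxE.
Qed.

Lemma mxbmeasZ c (F : A -> 'M[R]_(m, p)) :
  mxbmeas F -> mxbmeas (fun w => c *: F w).
Proof.
by move=> bF i j; apply: eq_bmeas (bmeasM (bmeas_cst _ c) (bF i j)) => w; rewrite mxE.
Qed.

Lemma mxbmeasM (F : A -> 'M[R]_(m, p)) (G : A -> 'M[R]_(p, q)) :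
  mxbmeas F -> mxbmeas G -> mxbmeas (fun w => F w *m G w).
Proof.
move=> bF bG i j.
apply: (@eq_bmeas _ _ _ (fun w => \sum_k F w i k * G w k j)); first by move=> w; rewrite mxE.
by apply: bmeas_sum => k _; apply: bmeasM.
Qed.

End closure.

Lemma mxbmeasX d0 (A : measurableType d0) p (F : A -> 'M[R]_p) n :
  mxbmeas F -> mxbmeas (fun w => F w ^+ n).
Proof.
move=> bF; elim: n => [|n IH].
  by move=> i j; apply: eq_bmeas (bmeas_cst A ((1 : 'M[R]_p) i j)).
by move=> i j; apply: eq_bmeas (mxbmeasM bF IH i j) => w; rewrite exprS.
Qed.

Lemma mxbmeas_trace d0 (A : measurableType d0) p (F : A -> 'M[R]_p) :
  mxbmeas F -> bmeas (fun w => \tr (F w)).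
Proof. by move=> bF; apply: bmeas_sum => i _; apply: bF. Qed.

Lemma mxbmeas_dot d0 (A : measurableType d0) p (F G : A -> 'cV[R]_p) :
  mxbmeas F -> mxbmeas G -> bmeas (fun w => dot (F w) (G w)).
Proof. by move=> bF bG; apply: bmeas_sum => i _; apply: bmeasM. Qed.

Lemma bmeas_comp d1 d2 (A : measurableType d1) (B : measurableType d2)
    (g : A -> B) (f : B -> R) :
  measurable_fun setT g -> bmeas f -> bmeas (f \o g).
Proof.
move=> mg [mf [c fc]]; split; first exact: (measurableT_comp mf mg).
by exists c => x; apply: fc.
Qed.

Lemma measurable_sigma_of_sub J J0 : J0 \subset J ->
  measurable_fun setT (id : sigma_of Y J -> sigma_of Y J0).
Proof.
move=> J0J _ A sA; rewrite setTI preimage_id; move: A sA.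
apply: smallest_sub; first exact: smallest_sigma_algebra.
move=> _ [B mB ->]; apply: sub_sigma_algebra.
exists (fun i => if i \in J0 then B i else setT).
  by move=> i; case: ifP.
apply/seteqP; split=> w /= h i /= iJ.
  by case: ifP => // /h.
by have := h i (fintype.subsetP J0J i iJ); rewrite iJ.
Qed.

(* The families [Y i], [i \in J k] and [i \in J' k], are the past of step [k]
   and its fresh randomness: [w] and [w'] are the corresponding arguments of
   the increment [B k w w'], and freezing [w] in an expectation over [w'] is
   conditioning on the past. *)
Variables (p n : nat) (J J' : nat -> {set I}) (eps : nat -> R)
  (B : nat -> T -> T -> 'M[R]_p).
Hypothesis JJ' : forall k, (k < n)%N -> {in J k, forall i, i \notin J' k}.
Hypothesis Jsub : forall k, (k < n)%N -> (J k :|: J' k) \subset J k.+1.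
Hypothesis bB : forall k, (k < n)%N ->
  mxbmeas (fun z : sigma_of Y (J k) * sigma_of Y (J' k) => B k z.1 z.2).
Hypothesis symB : forall k w w', (k < n)%N -> (B k w w')^T = B k w w'.
Hypothesis B1 : forall k w w', (k < n)%N -> opbound (B k w w') 1.
Hypothesis eps0 : forall k, (k < n)%N -> 0 <= eps k.
Hypothesis Beps : forall k w y, (k < n)%N ->
  Ex (fun w' => dot y (B k w w' *m y) + dot (B k w w' *m y) (B k w w' *m y)) <=
  eps k * dot y y.

Let A k w := \sum_(j < k) B j w w.

Let symA k w : (k <= n)%N -> (A k w)^T = A k w.
Proof.
move=> kn; rewrite linear_sum /=; apply: eq_bigr => j _.
by rewrite symB// (leq_trans _ kn).
Qed.

Let A_le k w : (k <= n)%N -> opbound (A k w) n%:R.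
Proof.
move=> kn; apply: (@opbound_le _ _ _ _ k%:R); first by rewrite ler_nat.
have -> : k%:R = \sum_(j < k) 1 :> R by rewrite sumr_const card_ord.
have -> : A k w = \sum_(j < k) (if (j < n)%N then B j w w else 0).
  by apply: eq_bigr => j _; rewrite (leq_trans _ kn).
apply: opbound_sum => j; case: ifP => // jn.
  exact: B1.
by move=> x; rewrite mul0mx norm20 mul1r norm2_ge0.
Qed.

Let Jmono j k : (j < k)%N -> (k <= n)%N -> (J j :|: J' j) \subset J k.
Proof.
elim: k => // k IH; rewrite ltnS leq_eqVlt => /predU1P[->|jk] kn.
  exact: Jsub.
apply: (fintype.subset_trans (IH jk (ltnW kn))).
by apply: fintype.subset_trans (Jsub kn); apply: finset.subsetUl.
Qed.

Let bA k : (k <= n)%N -> mxbmeas (A k : sigma_of Y (J k) -> 'M[R]_p).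
Proof.
move=> kn i j.
apply: (@eq_bmeas _ _ (sigma_of Y (J k)) (fun w => \sum_(e < k) B e w w i j)).
  by move=> w; rewrite summxE.
apply: bmeas_sum => e _.
have en : (e < n)%N by apply: leq_trans kn.
have := bB en i j.
apply: (bmeas_comp (g := fun w : sigma_of Y (J k) => (w : sigma_of Y (J e), w : sigma_of Y (J' e)))).
have hs := Jmono (ltn_ord e) kn.
apply: measurable_fun_pair; apply: measurable_sigma_of_sub; apply: fintype.subset_trans hs.
  exact: finset.subsetUl.
exact: finset.subsetUr.
Qed.

Section fixed_exponent.
Variable K : nat.
Let N := (2 ^ K.+1)%N.
Let a : R := N%:R^-1.
Let Phi k w := \tr ((1 + a *: A k w) ^+ N).
Let G k w : 'M[R]_p := (1 + a *: A k w) ^+ (2 ^ K).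
(** The discretization error of [mxtrace_exprD_le], with the crude bound $n$ on all partial sums. It
    is of order $1/N$ for fixed [n] and [p], and $N$ is chosen last. *)
Let delta : R := p%:R * (N%:R * (((1 + a * n%:R) * (1 + a)) ^+ N * (a ^+ 2 * n%:R))).

Let PhiE k w : (k <= n)%N -> Phi k w = \sum_i dot (col i (G k w)) (col i (G k w)).
Proof.
move=> kn; rewrite sum_dot_col.
have -> : (G k w)^T = G k w by rewrite /G trmxX linearD /= trmx1 linearZ /= symA.
by rewrite mulmxE -exprD addnn -mul2n -expnS.
Qed.

Let Phi_ge0 k w : (k <= n)%N -> 0 <= Phi k w.
Proof. by move=> kn; rewrite PhiE//; apply: sumr_ge0 => i _; exact: dot_ge0. Qed.

Let bG k : (k <= n)%N -> mxbmeas (G k : sigma_of Y (J k) -> 'M[R]_p).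
Proof.
move=> kn; apply: mxbmeasX; apply: mxbmeasD; first exact: mxbmeas_cst.
exact: mxbmeasZ (bA kn).
Qed.

Let bPhi k : (k <= n)%N -> bmeas (Phi k : T -> R).
Proof.
move=> kn; apply: (@bmeas_sigma_of _ _ _ _ _ P _ Y (J k)); apply: mxbmeas_trace.
apply: mxbmeasX; apply: mxbmeasD; first exact: mxbmeas_cst.
exact: mxbmeasZ (bA kn).
Qed.

Let delta0 : 0 <= delta.
Proof.
have a0 : 0 <= a by rewrite invr_ge0.
by rewrite /delta !mulr_ge0 ?exprn_ge0 ?mulr_ge0 ?addr_ge0 ?mulr_ge0.
Qed.

(** The columns of [G k] depend only on the past. Freezing them, [Beps] applies column by column,
    and their squared norms add up to [Phi k]. *)
Let Ex_Phi_step k : (k < n)%N -> Ex (Phi k.+1) <= (1 + eps k) * Ex (Phi k) + delta.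
Proof.
move=> kn; have kn' := ltnW kn.
pose f (z : T * T) := \sum_i (dot (col i (G k z.1)) (col i (G k z.1)) +
   (dot (col i (G k z.1)) (B k z.1 z.2 *m col i (G k z.1)) +
    dot (B k z.1 z.2 *m col i (G k z.1)) (B k z.1 z.2 *m col i (G k z.1)))).
have bcol i : mxbmeas (fun z : sigma_of Y (J k) * sigma_of Y (J' k) => col i (G k z.1)).
  move=> i' j'; apply: eq_bmeas (bmeas_comp measurable_fst (bG kn' i' i)) => z.
  by rewrite /= mxE.
have bBc i : mxbmeas (fun z : sigma_of Y (J k) * sigma_of Y (J' k) =>
    B k z.1 z.2 *m col i (G k z.1)).
  exact: mxbmeasM (bB kn) (bcol i).
have bf : bmeas (f : sigma_of Y (J k) * sigma_of Y (J' k) -> R).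
  by apply: bmeas_sum => i _; apply: bmeasD; [|apply: bmeasD]; apply: mxbmeas_dot.
have bfd : bmeas (fun w : T => f (w, w)).
  have mid e : measurable_fun setT (id : T -> sigma_of Y e) by exact: measurable_sigma_of_id.
  exact: (bmeas_comp (measurable_fun_pair (mid (J k)) (mid (J' k))) bf).
apply: (@le_trans _ _ (Ex (fun w => f (w, w) + delta))).
  apply: Ex_le; [exact/bmeas_integrable/bPhi|
    by apply: bmeas_integrable; apply: bmeasD => //; exact: bmeas_cst|].
  move=> w; rewrite /Phi /A big_ord_recr /= -/(A k w).
  have := mxtrace_exprD_le K (symA w kn') (symB w w kn) (ler0n _ n) (A_le w kn') (B1 w w kn).
  cbv zeta; rewrite -/N -/a -/(G k w) -/delta => /le_trans; apply.
  rewrite lerD2r /f /= le_eqVlt; apply/orP; left; apply/eqP.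
  by apply: eq_bigr => i _; rewrite addrA.
rewrite ExD; last 2 first.
- exact: bmeas_integrable.
- by apply: bmeas_integrable; exact: bmeas_cst.
rewrite Ex_cst lerD2r -(ExZl _ (bmeas_integrable P (bPhi kn'))).
apply: (Ex_decouple_le indY (JJ' kn) bf).
  by apply: bmeasM; [exact: bmeas_cst|exact: bPhi].
move=> w; rewrite PhiE// mulr_sumr /f /=.
set g := fun i => fun w' : T => dot (col i (G k w)) (B k w w' *m col i (G k w)) +
    dot (B k w w' *m col i (G k w)) (B k w w' *m col i (G k w)).
have bg i : bmeas (g i).
  have bBw : mxbmeas (fun w' : T => B k w w').
    move=> i' j'.
    have mid e : measurable_fun setT (id : T -> sigma_of Y e) by exact: measurable_sigma_of_id.
    have mw : measurable_fun setT (fun w' : T => (w : sigma_of Y (J k), w' : sigma_of Y (J' k))).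
      by apply: measurable_fun_pair.
    exact: (bmeas_comp mw (bB kn i' j')).
  have bBcw : mxbmeas (fun w' : T => B k w w' *m col i (G k w)).
    by apply: mxbmeasM bBw _; exact: mxbmeas_cst.
  by apply: bmeasD; apply: mxbmeas_dot => //; exact: mxbmeas_cst.
have ig i := bmeas_integrable P (bg i).
have i1 i : P.-integrable setT (EFin \o (fun _ : T => dot (col i (G k w)) (col i (G k w)))).
  by apply: bmeas_integrable; exact: bmeas_cst.
rewrite Ex_sum; last by move=> i; exact: intgD (i1 i) (ig i).
apply: ler_sum => i _; rewrite (ExD (i1 i) (ig i)) Ex_cst mulrDl mul1r lerD2l.
exact: Beps.
Qed.

Let Ex_Phi_le k : (k <= n)%N ->
  Ex (Phi k) <= (p%:R + k%:R * delta) * \prod_(j < k) (1 + eps j).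
Proof.
elim: k => [_|k IH kn].
  rewrite mul0r addr0 big_ord0 mulr1 (@eq_Ex _ _ _ _ _ (fun=> p%:R)) ?Ex_cst// => w.
  by rewrite /Phi /A big_ord0 scaler0 addr0 expr1n mxtrace1.
apply: le_trans (Ex_Phi_step kn) _; rewrite big_ord_recr /=.
set Q := \prod_(i < k) _ in IH *.
have e0 := eps0 kn.
(* Because the product is at least 1, each new [delta] may also be multiplied by it, which keeps one
   common factor. *)
have Q1 : 1 <= Q.
  rewrite /Q; elim/big_ind: _ => // [x y x1 y1|i _].
    by rewrite (le_trans x1)// ler_peMr// (le_trans _ x1).
  by rewrite lerDl eps0// (ltn_trans (ltn_ord i)).
have := IH (ltnW kn) => h.
have h2 : (1 + eps k) * Ex (Phi k) <= (1 + eps k) * ((p%:R + k%:R * delta) * Q).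
  by rewrite ler_wpM2l// addr_ge0.
have -> : (p%:R + k.+1%:R * delta) * (Q * (1 + eps k)) =
    (p%:R + k%:R * delta) * (Q * (1 + eps k)) + delta * (Q * (1 + eps k)).
  by rewrite -natr1; ring.
have h3 : delta <= delta * (Q * (1 + eps k)).
  by rewrite ler_peMr// (le_trans Q1)// ler_peMr ?lerDl// (le_trans _ Q1).
apply: lerD => //; apply: le_trans h2 _.
by rewrite le_eqVlt; apply/orP; left; apply/eqP; ring.
Qed.

(** Markov's inequality for [Phi n] at level $e^{u/2}$: a unit vector with quadratic form above $u$
    forces $(1+u/N)^N\le\Phi_n$. The condition $u\le N$ permits [expR_half_le], and $n\delta\le p$
    makes the prefactor $2p$. *)
Lemma adapted_mx_tail_fixed (u : R) : 0 <= u -> u <= N%:R -> n%:R * delta <= p%:R ->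
  exists2 bad : set T, measurable bad &
    (P bad <= (2 * p%:R * expR (\sum_(j < n) eps j - u / 2))%:E)%E /\
    forall w, ~ bad w -> forall y, dot y (A n w *m y) <= u * dot y y.
Proof.
move=> u0 uN nd; have [mPhi _] := bPhi (leqnn n).
have N0 : 0 < N%:R :> R by rewrite ltr0n expn_gt0.
have au : 0 <= a * u <= 1.
  by rewrite mulr_ge0 ?invr_ge0 ?ler0n//= /a mulrC ler_pdivrMr// mul1r.
have expu : expR (u / 2) <= (1 + a * u) ^+ N.
  have := expR_half_le au => h.
  have -> : expR (u / 2) = expR (a * u / 2) ^+ N.
    rewrite -expRM_natl; congr expR; rewrite /a; field; exact: lt0r_neq0.
  by rewrite lerXn2r// ?nnegrE ?expR_ge0//; case/andP: au => h1 _; rewrite addr_ge0.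
exists [set w | expR (u / 2) <= Phi n w].
  have : measurable_fun setT (fun w => expR (u / 2) <= Phi n w).
    exact: measurable_fun_ler.
  by move=> /(_ measurableT [set true] Logic.I); rewrite setTI.
split.
  apply: le_trans (markov_le P (bPhi (leqnn n)) _ _ _ (expR_gt0 (u / 2))) _ => //.
  - by move=> w; exact: Phi_ge0.
  - have : measurable_fun setT (fun w => expR (u / 2) <= Phi n w).
      exact: measurable_fun_ler.
    by move=> /(_ measurableT [set true] Logic.I); rewrite setTI.
  rewrite lee_fin expRB mulrA ler_pM2r ?invr_gt0 ?expR_gt0//.
  apply: le_trans (Ex_Phi_le (leqnn n)) _; apply: ler_pM.
  - by rewrite addr_ge0// mulr_ge0.
  - by apply: prodr_ge0 => j _; rewrite addr_ge0// eps0.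
  - lra.
  - rewrite expR_sum; apply: ler_prod => j _.
    by rewrite expR_ge1Dx andbT addr_ge0// eps0.
move=> w /= /negP; rewrite -ltNge => h y.
have [y0|y0] := eqVneq (norm2 y) 0.
  by rewrite (norm2_eq0 y0) mulmx0 /dot !big1 ?mulr0// => i _; rewrite mxE mul0r.
rewrite leNgt; apply/negP => hy.
have ny : 0 < norm2 y by rewrite lt_def y0 norm2_ge0.
pose x := (norm2 y)^-1 *: y.
have x1 : norm2 x = 1 by rewrite norm2Z ger0_norm ?invr_ge0 ?norm2_ge0// mulVf.
have hx : u < dot x (A n w *m x).
  rewrite -scalemxAr dotZl dotZr mulrA -invfM -expr2 norm2_sqr mulrC.
  by rewrite ltr_pdivlMr// -norm2_sqr exprn_gt0.
have sG : (1 + a *: A n w)^T = 1 + a *: A n w.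
  by rewrite linearD /= trmx1 linearZ /= symA.
have := dot_X2_le_trace K sG x1.
rewrite mulmxDl mul1mx -scalemxAl dotDr dotZr -[dot x x]norm2_sqr x1 expr1n -/N.
move=> hp; have : (1 + a * u) ^+ N <= Phi n w.
  apply: le_trans hp; rewrite lerXn2r ?nnegrE//.
  - by case/andP: au => h1 _; rewrite addr_ge0.
  - by rewrite addr_ge0// mulr_ge0 ?invr_ge0// (le_trans u0)// ltW.
  - by rewrite lerD2l ler_wpM2l ?invr_ge0// ltW.
by rewrite leNgt (lt_le_trans h expu).
Qed.

End fixed_exponent.

Lemma adapted_mx_tail (u : R) : 0 <= u ->
  exists2 bad : set T, measurable bad &
    (P bad <= (2 * p%:R * expR (\sum_(j < n) eps j - u / 2))%:E)%E /\
    forall w, ~ bad w -> forall y, dot y ((\sum_(k < n) B k w w) *m y) <= u * dot y y.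
Proof.
move=> u0.
(* The base raised to the power $N$ in [delta] stays below $e^{n+1}$, so $n\delta\le
   p\,n^2e^{n+1}/N$. Hence $N\ge c$ ensures both conditions of [adapted_mx_tail_fixed]. *)
pose c : R := u + n%:R ^+ 2 * expR (n%:R + 1).
have c0 : 0 <= c by rewrite addr_ge0// mulr_ge0 ?sqr_ge0 ?expR_ge0.
pose K := Num.bound c.
have KN : c <= (2 ^ K.+1)%:R.
  apply: ltW; apply: lt_le_trans (archi_boundP c0) _.
  rewrite ler_nat; apply: ltnW; apply: ltn_trans (ltnSn _) _.
  exact: ltn_expl.
have cN : 0 < (2 ^ K.+1)%:R :> R by rewrite ltr0n expn_gt0.
apply: (adapted_mx_tail_fixed (K := K)) => //.
  by apply: le_trans KN; rewrite lerDl mulr_ge0 ?sqr_ge0 ?expR_ge0.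
set N := (2 ^ K.+1)%N in KN cN *; set a := N%:R^-1 : R.
have a0 : 0 <= a by rewrite invr_ge0 ltW.
have r_le : ((1 + a * n%:R) * (1 + a)) ^+ N <= expR (n%:R + 1).
  have -> : expR (n%:R + 1) = (expR (a * n%:R) * expR a) ^+ N.
    rewrite -expRD -expRM_natl; congr expR; rewrite /a; field; exact: lt0r_neq0.
  rewrite lerXn2r// ?nnegrE ?mulr_ge0 ?expR_ge0 ?addr_ge0 ?mulr_ge0//.
  by rewrite ler_pM ?addr_ge0 ?mulr_ge0// expR_ge1Dx.
rewrite mulrCA ler_piMr//.
have -> : n%:R * (N%:R * (((1 + a * n%:R) * (1 + a)) ^+ N * (a ^+ 2 * n%:R))) =
   (n%:R ^+ 2 * ((1 + a * n%:R) * (1 + a)) ^+ N) / N%:R.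
  rewrite -/a; have -> : a ^+ 2 = a * a by rewrite expr2.
  have aN : N%:R * a = 1 by rewrite /a mulfV// gt_eqF.
  rewrite (_ : n%:R * _ = (N%:R * a) * (n%:R ^+ 2 * ((1 + a * n%:R) * (1 + a)) ^+ N * a)).
    by rewrite aN mul1r.
  ring.
rewrite ler_pdivrMr// mul1r; apply: le_trans KN.
apply: (@le_trans _ _ (n%:R ^+ 2 * expR (n%:R + 1))); last by rewrite lerDr.
by rewrite ler_wpM2l ?sqr_ge0.
Qed.

End adapted_matrix_sums.

(** * Samples and running means *)

Section law_transfer.
Context {R : realType} d0 (T0 : measurableType d0) (P0 : probability T0 R)
  d (T : measurableType d) (P : probability T R)
  d' (S : measurableType d') (Y0 : {RV P0 >-> S}) (Y : {RV P >-> S}).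
Hypothesis law : same_law Y Y0.

Lemma same_law_integral (f : S -> R) : measurable_fun setT f ->
  P0.-integrable setT (EFin \o (f \o Y0)) ->
  P.-integrable setT (EFin \o (f \o Y)) /\
  Rintegral P setT (f \o Y) = Rintegral P0 setT (f \o Y0).
Proof.
move=> mf i0; have mY := measurable_funPT Y; have mY0 := measurable_funPT Y0.
have mEf : measurable_fun setT (EFin \o f) by exact/measurable_EFinP.
have iY : P.-integrable setT (EFin \o (f \o Y)).
  apply/integrableP; split.
    by apply/measurable_EFinP; apply: (measurableT_comp mf mY).
  have /integrableP[_ fin0] := i0.
  have mn : measurable_fun setT (fun y => `|(f y)%:E|%E).
    exact: (measurableT_comp (@abse_measurable R setT) mEf).
  have := ge0_integral_distribution Y mn (fun y => abse_ge0 _) => /= <-.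
  rewrite (eq_measure_integral (distribution P0 Y0)) => [|A mA _]; last exact: law.
  by rewrite (ge0_integral_distribution Y0 mn (fun y => abse_ge0 _)).
split=> //; rewrite /Rintegral; congr fine.
have := integral_distribution mEf iY => /= <-.
have := integral_distribution mEf i0 => /= <-.
by apply: eq_measure_integral => A mA _; exact: law.
Qed.

End law_transfer.

Section subgaussian_vector.
Context {R : realType} d (T : measurableType d) (P : probability T R) (p : nat)
  (X : {RV P >-> p.-tuple R}).
Local Notation Ex f := (Rintegral P setT f).
Local Notation intg f := (P.-integrable setT (EFin \o f)).

Let x i w := tnth (X w) i.

Lemma covmxE i j : covmx X i j = Ex (fun w => x i w * x j w).
Proof.
rewrite mxE unlock /Rintegral; congr fine; apply: eq_integral => w _.
by rewrite !mxE big_ord1 !mxE.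
Qed.

Hypothesis X2 : square_integrable_vec X.

Lemma square_integrable_intgM i j : intg (fun w => x i w * x j w).
Proof. by have /Lfun1_integrable := Lfun2_mul_Lfun1 (X2 i) (X2 j). Qed.

Lemma covmx_le i j : `|covmx X i j| <= 2^-1 * covmx X i i + 2^-1 * covmx X j j.
Proof.
rewrite !covmxE -(ExZl _ (square_integrable_intgM i i)) -(ExZl _ (square_integrable_intgM j j)).
rewrite -(ExD (intgZl _ (square_integrable_intgM i i)) (intgZl _ (square_integrable_intgM j j))).
apply: le_trans (le_normr_Rintegral _ _) _ => //; first exact: square_integrable_intgM.
apply: Ex_le => [||w].
- exact: integrable_norm (square_integrable_intgM i j).
- exact: intgD (intgZl _ (square_integrable_intgM i i)) (intgZl _ (square_integrable_intgM j j)).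
- by rewrite ler_norml; apply/andP; split;
    [have := sqr_ge0 (x i w + x j w)|have := sqr_ge0 (x i w - x j w)]; nra.
Qed.

(** A covariance is at most the average of two variances, so the largest entry is matched on the
    diagonal. This supplies the coordinate that keeps the running means away from 0. *)
Lemma mx_norm_covmx_diag : mx_norm (covmx X) != 0 ->
  exists i, covmx X i i = mx_norm (covmx X).
Proof.
move=> /mx_norm_neq0[[i j] /= e]; exists i.
have := covmx_le i j; rewrite -e => h.
have hi := le_trans (ler_norm _) (le_mx_norm (covmx X) i i).
have hj := le_trans (ler_norm _) (le_mx_norm (covmx X) j j).
by apply/eqP; rewrite eq_le hi /=; lra.
Qed.

Lemma covmx0_ae i : covmx X i i = 0 -> P [set w | x i w != 0] = 0%E.
Proof.
rewrite covmxE => e.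
have m : measurable_fun setT (x i) by exact: measurable_coord.
have /integrableP[mi _] := square_integrable_intgM i i.
have := ae_eq_integral_abs P measurableT mi.
rewrite (eq_integral (fun w => (x i w * x i w)%:E)); last first.
  by move=> w _ /=; rewrite ger0_norm// -expr2 sqr_ge0.
rewrite (Ex_EFin (square_integrable_intgM i i)) e => -[/(_ erefl) [N [mN N0 sN]] _].
apply/eqP; rewrite eq_le measure_ge0 andbT -N0 le_measure ?inE//.
  have : measurable_fun setT (fun w => x i w == 0) by apply: measurable_fun_eqr.
  move=> /(_ measurableT [set false] Logic.I); rewrite setTI.
  by congr measurable; apply/seteqP; split => w /=; case: (x i w == 0).
move=> w /= xw; apply: sN => /= /(_ Logic.I) [] /eqP.
by rewrite mulf_eq0 orbb (negbTE xw).
Qed.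

(** Using $2K$ in place of $K$ puts the infimum strictly below $\sqrt a$, so some admissible $t$
    lies below $\sqrt a$; hence the constant $4K^2$. *)
Lemma subgaussian_exp_moment (K : R) i : 0 < K -> subgaussian K X ->
  0 < mx_norm (covmx X) ->
  exp_moment_le P (4 * K ^+ 2 * mx_norm (covmx X)) (x i).
Proof.
move=> K0 sg s0; set s := mx_norm _ in s0 *.
have m : measurable_fun setT (x i) by exact: measurable_coord.
have := sg (delta_mx i 0).
have dE w : dot (colvec (X w)) (delta_mx i 0) = x i w by rewrite dot_delta mxE.
rewrite (_ : (fun w => dot _ _) = x i); last by apply/funext => w.
rewrite (_ : (fun w => dot _ _ ^+ 2) = (fun w => x i w * x i w)); last first.
  by apply/funext => w; rewrite dE expr2.
have -> : fine 'E_P[fun w => x i w * x i w] = covmx X i i.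
  by rewrite covmxE unlock.
move=> h.
have hs : covmx X i i <= s := le_trans (ler_norm _) (le_mx_norm (covmx X) i i).
have ss0 : 0 < Num.sqrt s by rewrite sqrtr_gt0.
have : (psi2_norm P (x i) < (2 * K * Num.sqrt s)%:E)%E.
  apply: le_lt_trans h _; rewrite lte_fin.
  apply: (@le_lt_trans _ _ (K * Num.sqrt s)).
    by rewrite ler_wpM2l ?(ltW K0)// ler_sqrt// ltW.
  by rewrite ltr_pM2r//; lra.
move=> /ereal_inf_lt[_ [t [t0 et] <-]]; rewrite lte_fin => tlt.
set a := 4 * K ^+ 2 * s.
have a0 : 0 < a by rewrite !mulr_gt0// exprn_gt0.
have ta : t ^+ 2 <= a.
  have -> : a = (2 * K * Num.sqrt s) ^+ 2 by rewrite !exprMn sqr_sqrtr ?(ltW s0)// /a; ring.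
  by rewrite lerXn2r ?nnegrE ?(ltW tlt)// ltW// (lt_trans t0).
have me b : measurable_fun setT (fun w => expR (x i w ^+ 2 / b)).
  apply: measurableT_comp => //; apply: measurable_funM => //.
  exact: measurable_funX.
have it : intg (fun w => expR (x i w ^+ 2 / t ^+ 2)).
  apply/integrableP; split; first exact/measurable_EFinP.
  rewrite (eq_integral (fun w => (expR (x i w ^+ 2 / t ^+ 2))%:E)); last first.
    by move=> w _; rewrite /= ger0_norm ?expR_ge0.
  by move: et; rewrite unlock => /le_lt_trans; apply; rewrite ltry.
have le w : expR (x i w ^+ 2 / a) <= expR (x i w ^+ 2 / t ^+ 2).
  by rewrite ler_expR ler_wpM2l ?sqr_ge0// lef_pV2 ?posrE ?exprn_gt0.
have ia : intg (fun w => expR (x i w ^+ 2 / a)).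
  by apply: le_intg it => // w; rewrite ger0_norm ?expR_ge0.
split=> //; apply: le_trans (Ex_le ia it le) _.
by rewrite -lee_fin -(Ex_EFin it); move: et; rewrite unlock.
Qed.

End subgaussian_vector.

Lemma finite_union_le {R : realType} d (T : measurableType d)
    (P : probability T R) (I : Type) (r : seq I) (F : I -> set T) (c : R) :
  (forall i, measurable (F i)) -> (forall i, (P (F i) <= c%:E)%E) ->
  measurable (\big[setU/set0]_(i <- r) F i) /\
  (P (\big[setU/set0]_(i <- r) F i) <= ((size r)%:R * c)%:E)%E.
Proof.
move=> mF Fc; elim: r => [|i r [mr IH]].
  by rewrite big_nil measure0 mul0r.
rewrite big_cons; split; first exact: measurableU.
apply: le_trans (measureU2 _ _ _) _ => //.
by rewrite /= -natr1 mulrDl mul1r addrC EFinD leeD.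
Qed.

(** * Chernoff bound for the lower tail of an independent sum *)

Section independent_products.
Context {R : realType} d d' (T : measurableType d) (S : measurableType d')
  (P : probability T R) (I : finType) (Y : I -> {RV P >-> S}).
Hypothesis indY : mutually_independent Y.
Local Notation Ex f := (Rintegral P setT f).

Lemma Ex_prod (f : S -> R) (r : seq I) : bmeas f -> uniq r ->
  Ex (fun w => \prod_(i <- r) f (Y i w)) = \prod_(i <- r) Ex (fun w => f (Y i w)).
Proof.
move=> bf; elim: r => [_|i r IH /= /andP[ir ur]].
  rewrite (@eq_Ex _ _ _ _ _ (fun=> 1)) ?Ex_cst ?big_nil// => w.
  by rewrite big_nil.
rewrite big_cons -IH// (@eq_Ex _ _ _ _ _ (fun w => f (Y i w) * \prod_(j <- r) f (Y j w)));
  last by move=> w; rewrite big_cons.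
apply: (@Ex_indepM _ _ _ _ _ _ _ _ indY [set i]%SET [set j in r]%SET).
- by move=> j; rewrite !inE => /eqP ->.
- apply: (bmeas_comp _ bf).
  by apply: (@measurable_sigma_of _ _ _ _ _ _ _ Y [set i]%SET i); rewrite inE.
- have -> : (fun w : sigma_of Y [set j in r]%SET => \prod_(j <- r) f (Y j w)) =
      (fun w => \prod_(j <- r | j \in [set j in r]%SET) f (Y j w)).
    apply/funext => w; rewrite big_seq; apply: eq_bigl => j; by rewrite inE.
  apply: bmeas_prod => j jr; apply: (bmeas_comp _ bf).
  exact: (@measurable_sigma_of _ _ _ _ _ _ _ Y _ j jr).
Qed.

Lemma Ex_laplace_lower_tail (g : S -> R) (r : seq I) (b q c : R) :
  measurable_fun setT g -> (forall x, 0 <= g x) -> uniq r -> 0 <= b ->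
  {in r, forall i, Ex (fun w => expR (- (b * g (Y i w)))) <= q} ->
  measurable [set w | \sum_(i <- r) g (Y i w) <= c] /\
  (P [set w | (\sum_(i <- r) g (Y i w) <= c)%R] <= (expR (b * c) * q ^+ size r)%:E)%E.
Proof.
move=> mg g0 ur b0 hq.
have msum : measurable_fun setT (fun w => \sum_(i <- r) g (Y i w)).
  apply: measurable_sum => i; exact: (measurableT_comp mg (measurable_funPT (Y i))).
have mA : measurable [set w | \sum_(i <- r) g (Y i w) <= c].
  have : measurable_fun setT (fun w => \sum_(i <- r) g (Y i w) <= c).
    exact: measurable_fun_ler.
  by move=> /(_ measurableT [set true] Logic.I); rewrite setTI.
split=> //.
have bf : bmeas (fun x => expR (- (b * g x))).
  apply: (@bmeas_le _ _ _ _ 1).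
    by apply: measurableT_comp => //; apply: measurableT_comp => //; apply: measurable_funM.
  by move=> x; rewrite expR_ge0/= -expR0 ler_expR oppr_le0 mulr_ge0.
have bp : bmeas (fun w => \prod_(i <- r) expR (- (b * g (Y i w)))).
  apply: bmeas_prod => i _; apply: (bmeas_comp _ bf); exact: measurable_funPT.
apply: le_trans (markov_le P bp _ mA _ (expR_gt0 (- (b * c)))) _.
- by move=> w; apply: prodr_ge0 => i _; exact: expR_ge0.
- by move=> w /= h; rewrite -expR_sum ler_expR sumrN -mulr_sumr lerN2 ler_wpM2l.
rewrite lee_fin (Ex_prod bf ur) expRN invrK mulrC ler_wpM2l ?expR_ge0//.
elim: r hq {ur msum mA bp} => [|i r IH] hq; first by rewrite big_nil expr0.
have hr : {in r, forall j, Ex (fun w => expR (- (b * g (Y j w)))) <= q}.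
  by move=> j jr; apply: hq; rewrite inE jr orbT.
rewrite big_cons exprS; apply: ler_pM.
- by apply: Rintegral_ge0 => w _; exact: expR_ge0.
- by apply: prodr_ge0 => j _; apply: Rintegral_ge0 => w _; exact: expR_ge0.
- by apply: hq; rewrite inE eqxx.
- exact: IH.
Qed.

End independent_products.

Section running_means.
Context {R : realType} (n p : nat).

Lemma running_mean_le (x : 'I_n.+1 -> 'cV[R]_p) (k : 'I_n) c : 0 <= c ->
  (forall j i, `|x j i 0| <= c) -> 0 <= running_mean x k <= c.
Proof.
move=> c0 xc; apply/andP; split.
  by rewrite mulr_ge0 ?invr_ge0// sumr_ge0// => j _; exact: mx_norm_ge0.
rewrite /running_mean mulrC ler_pdivrMr//.
apply: (@le_trans _ _ (\sum_(j < n.+1 | (j < k.+1)%N) c)).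
  by apply: ler_sum => j _; apply: mx_norm_le => // i e; rewrite (ord1 e).
rewrite sumr_const -[c *+ _]mulr_natr ler_wpM2l// ler_nat.
have kn : (k.+1 <= n.+1)%N by rewrite ltnS ltnW.
rewrite -[X in (_ <= X)%N](card_ord k.+1).
rewrite -(card_codom (f := widen_ord kn)); last first.
  by move=> i j /(congr1 val) /= /val_inj.
apply: subset_leq_card; apply/fintype.subsetP => j jk; apply/codomP.
by exists (Ordinal jk); apply: val_inj.
Qed.

Lemma running_mean_ge (x : 'I_n.+1 -> 'cV[R]_p) (k : 'I_n) i :
  \sum_(j <- enum [pred j : 'I_n.+1 | (j < k.+1)%N]) `|x j i 0| <=
  k.+1%:R * running_mean x k.
Proof.
rewrite /running_mean mulrA mulfV// mul1r big_enum_cond/=.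
rewrite [leRHS](eq_bigl (fun j : 'I_n.+1 => (j \in [pred j : 'I_n.+1 | (j < k.+1)%N]) && true)).
  by apply: ler_sum => j _; exact: le_mx_norm.
by move=> j; rewrite andbT inE.
Qed.

Lemma size_enum_lt (k : 'I_n) : size (enum [pred j : 'I_n.+1 | (j < k.+1)%N]) = k.+1.
Proof.
rewrite -cardE.
have kn : (k.+1 <= n.+1)%N by rewrite ltnS ltnW.
rewrite -[RHS](card_ord k.+1) -(card_codom (f := widen_ord kn)); last first.
  by move=> i j /(congr1 val) /= /val_inj.
apply: eq_card => j; rewrite inE; apply/idP/codomP => [jk|[i ->]].
  by exists (Ordinal jk); apply: val_inj.
by rewrite /= ltn_ord.
Qed.

End running_means.

Lemma sum_inv_sqr_le {R : realType} n :
  \sum_(k < n) (k.+1%:R ^+ 2)^-1 <= 2 :> R.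
Proof.
(* The induction carries the telescoping bound $2-1/n$, with one more term so that it starts at a
   single summand. *)
suff : \sum_(k < n.+1) (k.+1%:R ^+ 2)^-1 <= 2 - n.+1%:R^-1 :> R.
  rewrite big_ord_recr /= => h.
  have h2 : 2 - n.+1%:R^-1 <= 2 :> R by rewrite lerBlDr lerDl invr_ge0.
  by apply: le_trans (le_trans h h2); rewrite lerDl invr_ge0 sqr_ge0.
elim: n => [|n IH]; first by rewrite big_ord1 expr1n invr1; lra.
rewrite big_ord_recr /=; apply: le_trans (lerD IH (lexx _)) _.
have -> : n.+2%:R = n.+1%:R + 1 :> R by rewrite -natr1.
set z := n.+1%:R; have z0 : 0 < z :> R by rewrite ltr0n.
rewrite -subr_ge0.
have -> : 2 - (z + 1)^-1 - (2 - z^-1 + ((z + 1) ^+ 2)^-1) = (z * (z + 1) ^+ 2)^-1.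
  by field; rewrite !gt_eqF// addr_gt0.
by rewrite invr_ge0 mulr_ge0 ?sqr_ge0// ltW.
Qed.

Lemma sum_small_le {R : realType} n (x : R) : 0 <= x ->
  \sum_(k < n) (if k.+1%:R <= x then 1 else 0) <= x.
Proof.
move=> x0.
have h k : \sum_(e < k) (if e.+1%:R <= x then 1 else 0) <= k%:R :> R.
  rewrite -[k in k%:R]card_ord -sumr_const; apply: ler_sum => e _.
  by case: ifP.
elim: n => [|n IH]; first by rewrite big_ord0.
case: (boolP (n.+1%:R <= x)) => [nx|nx].
  exact: le_trans (h n.+1) nx.
by rewrite big_ord_recr /= (negbTE nx) addr0.
Qed.

(** * The adaptive estimator *)

Section estimator_tail.
Context {R : realType} d (T : measurableType d) (P : probability T R) (p n : nat).
Variables (X : 'I_n.+1 -> {RV P >-> p.-tuple R}) (U Ub : 'I_n -> {RV P >-> p.-tuple R}).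
Local Notation Y := (samples_and_dithers X U Ub).
Local Notation I := ('I_n.+1 + ('I_n + 'I_n))%type.
Local Notation Ex f := (Rintegral P setT f).
Hypothesis indY : mutually_independent Y.
Hypotheses (hU : forall k, uniform_cube (U k)) (hUb : forall k, uniform_cube (Ub k)).
Variables (a s : R) (M Sigma : 'M[R]_p).
Hypotheses (a0 : 0 < a) (s0 : 0 <= s).
Hypothesis expX : forall j k, exp_moment_le P a (fun w => tnth (X j w) k).
Hypothesis covX : forall j i i', Ex (fun w => tnth (X j w) i * tnth (X j w) i') = Sigma i i'.
Hypothesis Sigma_le : forall i j, `|Sigma i j| <= s.
Hypotheses (M0 : forall i j, 0 <= M i j) (sM : M^T = M).
Variables (c : 'I_n -> R) (lam : 'I_n -> T -> R).
Hypothesis lam0 : forall k w, 0 <= lam k w.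
Hypothesis lamE : forall k w,
  lam k w = c k * running_mean (fun j => colvec (X j w)) k.
Variables (eta L : R) (b : nat -> R).
Hypotheses (L0 : 0 <= L) (b0 : forall k, 0 <= b k).
Hypothesis eta_le : `|eta| * (L ^+ 2 + s) * opnorm M <= 1.

(** The first condition bounds the increment, the second its bias. Both are determined by the
    samples that precede step [k]. *)
Definition good_dither k w :=
  (lam k w <= L) && (expR (- (lam k w ^+ 2 / (4 * a))) <= b k).

Definition step_rate k : R :=
  `|eta| * ((s + 4 * a) * b k * opnorm M) +
  eta ^+ 2 * (2 * (L ^+ 2 * (L ^+ 2 * norm12 M ^+ 2 +
    2 * opnorm Sigma * norm12 M ^+ 2 + 8 * a * b k * opnorm M ^+ 2) +
    s * opnorm Sigma * norm12 M ^+ 2)).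

Lemma measurable_mx_norm d0 (A : measurableType d0) m q (F : A -> 'M[R]_(m, q)) :
  (forall i j, measurable_fun setT (fun w => F w i j)) ->
  measurable_fun setT (fun w => mx_norm (F w)).
Proof.
move=> mF; rewrite (_ : (fun w => _) =
    fun w => \big[Num.max/0]_ij `|F w ij.1 ij.2|); last first.
  by apply/funext => w; rewrite mx_normrE.
elim: (index_enum _) => [|ij r IH].
  rewrite (_ : (fun w => _) = fun=> 0) => //; by apply/funext => w; rewrite big_nil.
rewrite (_ : (fun w => _) = fun w => Num.max `|F w ij.1 ij.2|
  (\big[Num.max/0]_(ij <- r) `|F w ij.1 ij.2|)); last first.
  by apply/funext => w; rewrite big_cons.
by apply: measurable_maxr => //; apply: measurableT_comp => //; apply: mF.
Qed.

(** Step [k], counted from 0, uses sample $k+1$ and dithers $k$. Its level averages the samples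
    $0,\dots,k$, hence the weak inequality for samples and the strict one for dithers. *)
Let past (k : nat) : {set I} := [set i : I | match i with
  | inl j => (j <= k)%N | inr (inl j) => (j < k)%N | inr (inr j) => (j < k)%N end]%SET.

Let present (k : nat) : {set I} := [set i : I | match i with
  | inl j => j == k.+1 :> nat | inr (inl j) => j == k :> nat
  | inr (inr j) => j == k :> nat end]%SET.

Let past_present k : (k < n)%N -> {in past k, forall i, i \notin present k}.
Proof.
move=> _ [j|[j|j]]; rewrite !inE.
- by move=> jk; apply/negP => /eqP jk'; rewrite jk' ltnn in jk.
- by move=> jk; apply/negP => /eqP jk'; rewrite jk' ltnn in jk.
- by move=> jk; apply/negP => /eqP jk'; rewrite jk' ltnn in jk.
Qed.

Let past_sub k : (k < n)%N -> past k :|: present k \subset past k.+1.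
Proof.
move=> _; apply/fintype.subsetP => -[j|[j|j]]; rewrite !inE => /orP[h|/eqP ->] //.
- exact: ltnW.
- by apply: ltn_trans h _.
- by apply: ltn_trans h _.
Qed.

(** [adapted_mx_tail] indexes steps by natural numbers; [o] is the default ordinal outside the
    range. *)
Variable o : 'I_n.
Local Notation ord k := (insubd o k).

(* Steps with a bad dithering level are replaced by 0, which keeps the
   increments bounded and adapted. *)
Let good01 k w : R := if good_dither k w then 1 else 0.
Let lam' k w : R := if good_dither k w then lam k w else 0.

Let B (k : nat) (w w' : T) : 'M[R]_p :=
  good01 (ord k) w *: onebit_error M Sigma eta (lam' (ord k) w)
    (X (lift ord0 (ord k)) w') (U (ord k) w') (Ub (ord k) w').

Let ordE k : (k < n)%N -> ord k = k :> nat.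
Proof. by move=> kn; rewrite val_insubd kn. Qed.

Let mlam k : (k < n)%N -> measurable_fun setT (lam (ord k) : sigma_of Y (past k) -> R).
Proof.
move=> kn; rewrite (_ : lam (ord k) = fun w => c (ord k) *
    ((ord k).+1%:R^-1 * \sum_(j < n.+1) (if (j < (ord k).+1)%N then mx_norm (colvec (X j w)) else 0))).
  do 2 apply: measurable_funM => //.
  apply: measurable_sum => j; case: (boolP (j < (ord k).+1)%N) => jk /=; last exact: measurable_cst.
  apply: (@measurable_mx_norm _ (sigma_of Y (past k))) => i e.
  have jp : inl j \in past k by rewrite inE -(ordE kn).
  rewrite (_ : (fun w => _) = (fun w => tnth (Y (inl j) w) i)).
    exact: (@measurable_sigma_of_coord _ _ _ P _ _ Y (past k) (inl j) i jp).
  by apply/funext => w; rewrite mxE.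
by apply/funext => w; rewrite lamE /running_mean big_mkcond.
Qed.

Let mgood k : (k < n)%N ->
  measurable_fun setT (good_dither (ord k) : sigma_of Y (past k) -> bool).
Proof.
move=> kn; have ml := mlam kn; apply: measurable_and.
  exact: measurable_fun_ler.
apply: measurable_fun_ler => //; apply: measurableT_comp => //.
apply: measurableT_comp => //; apply: measurable_funM => //.
exact: measurable_funX.
Qed.

Let bB k : (k < n)%N ->
  mxbmeas (fun z : sigma_of Y (past k) * sigma_of Y (present k) => B k z.1 z.2).
Proof.
move=> kn i j; set o' := ord k.
have bg : bmeas (fun z : sigma_of Y (past k) * sigma_of Y (present k) => good01 o' z.1).
  split; last by exists 1 => z; rewrite /good01; case: ifP; rewrite ?normr1 ?normr0.
  apply: (measurableT_comp (_ : measurable_fun setT (good01 o' : sigma_of Y (past k) -> R)) measurable_fst).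
  exact: measurable_fun_ifT (mgood kn) _ _.
have bl : bmeas (fun z : sigma_of Y (past k) * sigma_of Y (present k) => lam' o' z.1).
  split.
    apply: (measurableT_comp (_ : measurable_fun setT (lam' o' : sigma_of Y (past k) -> R)) measurable_fst).
    exact: measurable_fun_ifT (mgood kn) (mlam kn) _.
  exists L => z; rewrite /lam'; case: ifP => [/andP[h _]|_]; last by rewrite normr0.
  by rewrite ger0_norm.
have mp q e : q \in present k ->
    measurable_fun setT (fun z : sigma_of Y (past k) * sigma_of Y (present k) => tnth (Y q z.2) e).
  exact: measurable_sigma_of_snd.
have pX : inl (lift ord0 o') \in present k by rewrite inE /= /bump /= add1n ordE.
have pU : inr (inl o') \in present k by rewrite inE ordE.
have pV : inr (inr o') \in present k by rewrite inE ordE.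
have bs q e : q \in present k -> bmeas (fun z : sigma_of Y (past k) * sigma_of Y (present k) =>
    sign1 (tnth (X (lift ord0 o') z.2) e + lam' o' z.1 * tnth (Y q z.2) e)).
  move=> hq; apply: bmeas_sign1_comp; apply: measurable_funD; first exact: mp pX.
  by apply: measurable_funM; [exact: bl.1|exact: mp].
pose F e e' (z : sigma_of Y (past k) * sigma_of Y (present k)) := lam' o' z.1 ^+ 2 *
  (sign1 (tnth (X (lift ord0 o') z.2) e + lam' o' z.1 * tnth (U o' z.2) e) *
   sign1 (tnth (X (lift ord0 o') z.2) e' + lam' o' z.1 * tnth (Ub o' z.2) e')).
have bF e e' : bmeas (F e e').
  apply: bmeasM; first exact: bmeasX.
  by apply: bmeasM; [exact: bs pU|exact: bs pV].
apply: (@eq_bmeas _ _ (sigma_of Y (past k) * sigma_of Y (present k))%type (fun z => good01 o' z.1 *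
   (eta * (M i j * (2^-1 * F i j z + 2^-1 * F j i z) - M i j * Sigma i j)))).
  by move=> z; rewrite /B -/o' !mxE !big_ord1 !mxE.
apply: bmeasM => //; apply: bmeasM; first exact: bmeas_cst.
apply: bmeasB; last exact: bmeas_cst.
apply: bmeasM; first exact: bmeas_cst.
by apply: bmeasD; apply: bmeasM => //; exact: bmeas_cst.
Qed.

Let hadamard_sym (A : 'M[R]_p) : A^T = A -> (hadamard M A)^T = hadamard M A.
Proof.
move=> sA; apply/matrixP => i j; rewrite !mxE.
by rewrite -{1}sM -{1}sA !mxE.
Qed.

Let Ssym : Sigma^T = Sigma.
Proof. exact: (cov_sym (Y := X) (ix := ord0) (covX ord0)). Qed.

Let symB k w w' : (k < n)%N -> (B k w w')^T = B k w w'.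
Proof.
move=> _; rewrite /B /onebit_error /onebit_step !linearZ /= linearB /=.
by rewrite (hadamard_sym (sym_part_sym _)) (hadamard_sym Ssym) !scalerA mulrC.
Qed.

(** Signs have modulus 1, so the entries are dominated by $|\eta|(L^2+s)M_{ij}$, and [eta_le] is the
    normalization that makes this enough. *)
Let B1 k w w' : (k < n)%N -> opbound (B k w w') 1.
Proof.
move=> kn; apply: opbound_le eta_le _; apply: opbound_dominated.
  by rewrite mulr_ge0// addr_ge0// sqr_ge0.
move=> i j; rewrite /B /onebit_error.
set l := lam' _ w; set g := good01 _ w.
have g1 : `|g| <= 1 by rewrite /g /good01; case: ifP; rewrite ?normr1 ?normr0.
have l2 : `|l ^+ 2| <= L ^+ 2.
  rewrite ger0_norm ?sqr_ge0// /l /lam'; case: ifP => [/andP[h _]|_].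
    by rewrite lerXn2r ?nnegrE.
  by rewrite expr0n/= sqr_ge0.
set W := onebit_step _ _ _ _.
have Wij : `|W i j| <= L ^+ 2.
  rewrite /W !mxE !big_ord1 !mxE.
  apply: le_trans (ler_normD _ _) _; rewrite !normrM !sign1_norm !mulr1.
  rewrite [`|2^-1|]ger0_norm ?invr_ge0//; rewrite expr2 normrM in l2; lra.
have -> : (g *: (eta *: (hadamard M W - hadamard M Sigma))) i j =
    g * (eta * (M i j * (W i j - Sigma i j))).
  by clear Wij; clearbody W; rewrite !mxE; ring.
rewrite !normrM (ger0_norm (M0 i j)).
apply: (@le_trans _ _ (1 * (`|eta| * (M i j * (L ^+ 2 + s))))).
  apply: ler_pM => //; first by rewrite mulr_ge0// mulr_ge0.
  apply: ler_wpM2l => //; apply: ler_wpM2l => //.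
  by apply: le_trans (ler_normB _ _) _; apply: lerD.
by rewrite le_eqVlt; apply/orP; left; apply/eqP; ring.
Qed.

Let rate0 k : 0 <= step_rate k.
Proof.
have h1 := opnorm_ge0 M; have h2 := opnorm_ge0 Sigma; have h3 := norm12_ge0 M.
have a0' := ltW a0; have bk := b0 k.
apply: addr_ge0.
  by rewrite mulr_ge0// mulr_ge0// mulr_ge0// addr_ge0// mulr_ge0.
apply: mulr_ge0; first exact: sqr_ge0.
apply: mulr_ge0 => //; apply: addr_ge0; last by rewrite mulr_ge0 ?sqr_ge0// mulr_ge0.
apply: mulr_ge0; first exact: sqr_ge0.
apply: addr_ge0; last by rewrite mulr_ge0 ?sqr_ge0// !mulr_ge0.
by apply: addr_ge0; rewrite mulr_ge0 ?sqr_ge0// mulr_ge0.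
Qed.

Let Brate k w y : (k < n)%N ->
  Ex (fun w' => dot y (B k w w' *m y) + dot (B k w w' *m y) (B k w w' *m y)) <=
  step_rate k * dot y y.
Proof.
move=> kn; rewrite /B /good01 /lam'.
case: ifP => [/andP[hL hb]|_]; last first.
  rewrite (@eq_Ex _ _ _ _ _ (fun=> 0)) ?Ex_cst; last first.
    move=> w'; rewrite scale0r mul0mx /dot !big1 ?addr0// => i _; rewrite !mxE ?mulr0 ?mul0r//.
  by rewrite mulr_ge0 ?dot_ge0.
set o' := ord k in hL hb *.
have ok : o' = k :> nat by exact: ordE.
rewrite ok in hb.
under eq_Ex do rewrite scale1r.
have := @Ex_onebit_error_le _ _ _ P p I Y indY (inl (lift ord0 o')) (inr (inl o')) (inr (inr o'))
  a s M Sigma isT isT _ (hU o') (hUb o') a0 s0 (fun i => expX (lift ord0 o') i)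
  (fun i j => covX (lift ord0 o') i j) _ M0 sM (lam o' w) (lam0 o' w) eta L (b k) y hL hb.
apply=> [|i]; first by [].
exact: le_trans (ler_norm _) (Sigma_le i i).
Qed.

Lemma sum_onebit_error w : (0 < n)%N ->
  \sum_(k < n) onebit_error M Sigma eta (lam k w)
    (X (lift ord0 k) w) (U k w) (Ub k w) =
  (eta * n%:R) *: (hadamard M (adaptive_estimator X U Ub lam w) - hadamard M Sigma).
Proof.
move=> n0; have nz : n%:R != 0 :> R by rewrite pnatr_eq0 -lt0n.
rewrite -scaler_sumr -scalerA; congr (_ *: _); rewrite sumrB scalerBr.
congr (_ - _); last by rewrite sumr_const card_ord scaler_nat.
apply/matrixP => i j; rewrite summxE [RHS]mxE hadamardE.
rewrite /adaptive_estimator /onebit_estimator mxE [X in _ + X]mxE.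
rewrite [X in X + _]mxE [X in _ * (_ * (_ + _ * X))]mxE /onebit_sum !summxE.
rewrite mulrCA mulrDr !mulr_sumr -big_split /= mulr_sumr.
apply: eq_bigr => k _; rewrite !mxE !big_ord1 !mxE; field; exact: nz.
Qed.

(** When all levels are good no step has been replaced by 0, and the tail bound for the modified sum
    concerns the estimator itself. *)
Lemma estimator_tail (u : R) : 0 <= u ->
  exists2 bad : set T, measurable bad &
    (P bad <= (2 * p%:R * expR (\sum_(k < n) step_rate k - u / 2))%:E)%E /\
    forall w, ~ bad w -> (forall k, good_dither k w) -> forall y,
      eta * n%:R * dot y ((hadamard M (adaptive_estimator X U Ub lam w) -
        hadamard M Sigma) *m y) <= u * dot y y.
Proof.
move=> u0; have n0 : (0 < n)%N by apply: leq_ltn_trans (ltn_ord o).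
have [bad mbad [Pbad hbad]] := adapted_mx_tail indY past_present past_sub bB symB B1
  (fun k _ => rate0 k) Brate u0.
exists bad => //; split=> // w /hbad hw gw y.
rewrite -dotZr scalemxAl -sum_onebit_error//.
apply: le_trans (hw y); rewrite le_eqVlt; apply/orP; left; apply/eqP.
congr (dot _ (_ *m _)); apply: eq_bigr => k _; rewrite /B.
have -> : ord k = k by apply: val_inj; rewrite /= val_insubd ltn_ord.
by rewrite /good01 /lam' gw scale1r.
Qed.

End estimator_tail.

(** * Numerical bounds and the scale [D] *)

Section constants.
Context {R : realType}.

Lemma ln2_ge : 2^-1 <= ln 2 :> R.
Proof.
rewrite -ler_expR lnK ?posrE//.
have := @expR_half_le R 1; rewrite ler01 lexx => /(_ isT).
by rewrite mul1r; lra.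
Qed.

Lemma ln_nat_ge (k : nat) : (1 < k)%N -> 2^-1 <= ln k%:R :> R.
Proof.
move=> k1; apply: le_trans ln2_ge _; rewrite ler_ln ?posrE ?ltr0n ?ler_nat//.
exact: ltnW.
Qed.

Lemma nat_le_expR (k : nat) (t : R) : (0 < k)%N -> ln k%:R <= t -> k%:R <= expR t.
Proof. by move=> k0 h; rewrite -[leLHS]lnK ?posrE ?ltr0n// ler_expR. Qed.

(** [D] dominates both of its summands. The first, $2L^2\mu$, controls the bias and every term with
    $\mu^2$. The second, [A2], controls the variance through $A_2^2\theta=Q^2nsS_0\nu^2$. *)
Lemma step_rate_sum_le (n : nat) (K s L mu nu S0 Q theta C4 k3 D : R) (b : nat -> R) :
  (0 < n)%N ->
  0 < s -> 0 <= mu -> 0 <= nu -> s <= S0 -> 1 <= Q -> 0 < theta -> 1 <= C4 ->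
  L ^+ 2 = C4 * Q * s ->
  (forall k, 0 <= b k) -> \sum_(k < n) b k <= k3 * theta ->
  D = 2 * L ^+ 2 * mu + Q * Num.sqrt n%:R * Num.sqrt s * Num.sqrt S0 * nu / Num.sqrt theta ->
  0 < D ->
  \sum_(k < n) (D^-1 * ((s + 4 * (4 * K ^+ 2 * s)) * b k * mu) +
    D^-1 ^+ 2 * (2 * (L ^+ 2 * (L ^+ 2 * nu ^+ 2 + 2 * S0 * nu ^+ 2 +
       8 * (4 * K ^+ 2 * s) * b k * mu ^+ 2) + s * S0 * nu ^+ 2))) <=
  ((1 + 16 * K ^+ 2) * k3 / 2 + 2 * (C4 + 1) ^+ 2 + 16 * K ^+ 2 * k3) * theta.
Proof.
move=> n0 s0 mu0 nu0 sS Q1 th0 C41 L2 b0 bsum DE D0.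
set e := D^-1; have e0 : 0 <= e by rewrite invr_ge0 ltW.
have n0' : 0 <= n%:R :> R by [].
have S00 : 0 <= S0 by apply: le_trans sS; exact: ltW.
set A1 := 2 * L ^+ 2 * mu in DE; set A2 := _ / _ in DE.
have A10 : 0 <= A1 by rewrite /A1 mulr_ge0// mulr_ge0// sqr_ge0.
have A20 : 0 <= A2 by rewrite divr_ge0 ?sqrtr_ge0// !mulr_ge0 ?sqrtr_ge0//; lra.
have eA1 : e * A1 <= 1 by rewrite mulrC ler_pdivrMr// mul1r DE lerDl.
have eA2 : e * A2 <= 1 by rewrite mulrC ler_pdivrMr// mul1r DE lerDr.
have eA22 : (e * A2) ^+ 2 <= 1 by rewrite expr_le1// mulr_ge0.
have A2E : A2 ^+ 2 * theta = Q ^+ 2 * n%:R * s * S0 * nu ^+ 2.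
  rewrite /A2 exprMn exprVn !exprMn !sqr_sqrtr ?(ltW s0) ?(ltW th0)//.
  by field; rewrite gt_eqF.
set Bs := \sum_(k < n) b k in bsum.
have Bs0 : 0 <= Bs by apply: sumr_ge0.
rewrite (_ : \sum_(k < n) _ = (1 + 16 * K ^+ 2) * (e * s * mu) * Bs +
   2 * n%:R * e ^+ 2 * (L ^+ 2 * (L ^+ 2 * nu ^+ 2 + 2 * S0 * nu ^+ 2) + s * S0 * nu ^+ 2) +
   64 * K ^+ 2 * (e ^+ 2 * L ^+ 2 * s * mu ^+ 2) * Bs); last first.
  rewrite (eq_bigr (fun k : 'I_n => ((1 + 16 * K ^+ 2) * (e * s * mu) +
     64 * K ^+ 2 * (e ^+ 2 * L ^+ 2 * s * mu ^+ 2)) * b k +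
     2 * e ^+ 2 * (L ^+ 2 * (L ^+ 2 * nu ^+ 2 + 2 * S0 * nu ^+ 2) + s * S0 * nu ^+ 2)));
    last by move=> k _; rewrite -/e; ring.
  by rewrite big_split /= -mulr_sumr sumr_const card_ord -mulr_natl -/Bs; ring.
have sL : s <= L ^+ 2.
  rewrite L2 -[leLHS]mul1r ler_wpM2r ?(ltW s0)//.
  by rewrite -[leLHS]mulr1 ler_pM.
have half : e * s * mu <= 2^-1.
  have : e * s * mu <= e * L ^+ 2 * mu by rewrite ler_wpM2r// ler_wpM2l.
  have -> : e * L ^+ 2 * mu = (e * A1) / 2 by rewrite /A1; field.
  by move=> h; apply: le_trans h _; lra.
have K20 := sqr_ge0 K.
have h1 : (1 + 16 * K ^+ 2) * (e * s * mu) * Bs <= (1 + 16 * K ^+ 2) * k3 / 2 * theta.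
  have -> : (1 + 16 * K ^+ 2) * k3 / 2 * theta = (1 + 16 * K ^+ 2) * 2^-1 * (k3 * theta) by ring.
  rewrite ler_pM//; first by rewrite !mulr_ge0// ?(ltW s0)//; lra.
  by rewrite ler_wpM2l//; lra.
have h3 : 64 * K ^+ 2 * (e ^+ 2 * L ^+ 2 * s * mu ^+ 2) * Bs <= 16 * K ^+ 2 * k3 * theta.
  have q : e ^+ 2 * L ^+ 2 * s * mu ^+ 2 <= 4^-1.
    have : e ^+ 2 * L ^+ 2 * s * mu ^+ 2 <= e ^+ 2 * L ^+ 2 * L ^+ 2 * mu ^+ 2.
      have eL : 0 <= e ^+ 2 * L ^+ 2 by rewrite mulr_ge0 ?sqr_ge0.
      by rewrite ler_wpM2r ?sqr_ge0// ler_wpM2l.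
    have -> : e ^+ 2 * L ^+ 2 * L ^+ 2 * mu ^+ 2 = (e * A1) ^+ 2 / 4 by rewrite /A1; field.
    have : (e * A1) ^+ 2 <= 1 by rewrite expr_le1// mulr_ge0.
    by lra.
  have -> : 16 * K ^+ 2 * k3 * theta = 64 * K ^+ 2 * 4^-1 * (k3 * theta) by field.
  have q0 : 0 <= e ^+ 2 * L ^+ 2 * s * mu ^+ 2.
    by rewrite mulr_ge0 ?sqr_ge0// mulr_ge0 ?(ltW s0)// mulr_ge0 ?sqr_ge0.
  rewrite ler_pM//; first by rewrite mulr_ge0// mulr_ge0.
  by rewrite ler_wpM2l// mulr_ge0.
have h2 : 2 * n%:R * e ^+ 2 * (L ^+ 2 * (L ^+ 2 * nu ^+ 2 + 2 * S0 * nu ^+ 2) + s * S0 * nu ^+ 2)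
    <= 2 * (C4 + 1) ^+ 2 * theta.
  have i1 : L ^+ 2 * (L ^+ 2 * nu ^+ 2 + 2 * S0 * nu ^+ 2) + s * S0 * nu ^+ 2 <=
      (C4 + 1) ^+ 2 * (Q ^+ 2 * s * S0 * nu ^+ 2).
    have -> : L ^+ 2 * (L ^+ 2 * nu ^+ 2 + 2 * S0 * nu ^+ 2) + s * S0 * nu ^+ 2 =
       (C4 ^+ 2 * Q ^+ 2 * s * s + 2 * C4 * Q * s * S0 + s * S0) * nu ^+ 2.
      by rewrite L2; ring.
    have -> : (C4 + 1) ^+ 2 * (Q ^+ 2 * s * S0 * nu ^+ 2) =
       (C4 ^+ 2 * Q ^+ 2 * s * S0 + 2 * C4 * Q ^+ 2 * s * S0 + Q ^+ 2 * s * S0) * nu ^+ 2 by ring.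
    have Q2 : Q <= Q ^+ 2 by rewrite expr2 ler_peMl//; lra.
    have C40 : 0 <= C4 by lra.
    have Q0 : 0 <= Q by lra.
    rewrite ler_wpM2r ?sqr_ge0//; apply: lerD; first apply: lerD.
    - by rewrite ler_wpM2l// mulr_ge0 ?(ltW s0)// mulr_ge0 ?sqr_ge0.
    - rewrite ler_wpM2r// ler_wpM2r ?(ltW s0)// ler_wpM2l//; lra.
    - rewrite ler_wpM2r// -[leLHS]mul1r ler_wpM2r ?(ltW s0)//; lra.
  apply: (@le_trans _ _ (2 * n%:R * e ^+ 2 * ((C4 + 1) ^+ 2 * (Q ^+ 2 * s * S0 * nu ^+ 2)))).
    by rewrite ler_wpM2l// mulr_ge0 ?sqr_ge0// mulr_ge0.
  have -> : 2 * n%:R * e ^+ 2 * ((C4 + 1) ^+ 2 * (Q ^+ 2 * s * S0 * nu ^+ 2)) =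
     2 * (C4 + 1) ^+ 2 * (e ^+ 2 * (A2 ^+ 2 * theta)) by rewrite A2E; ring.
  have c4 : 0 <= 2 * (C4 + 1) ^+ 2 by rewrite mulr_ge0 ?sqr_ge0.
  rewrite ler_wpM2l//.
  by rewrite mulrA -exprMn -[leRHS]mul1r ler_wpM2r// ltW.
lra.
Qed.

End constants.

Section estimator_measurable.
Context {R : realType} d (T : measurableType d).

Definition mxmeas m p (F : T -> 'M[R]_(m, p)) :=
  forall i j, measurable_fun setT (fun w => F w i j).

Lemma mxmeasM m p q (F : T -> 'M[R]_(m, p)) (G : T -> 'M[R]_(p, q)) :
  mxmeas F -> mxmeas G -> mxmeas (fun w => F w *m G w).
Proof.
move=> mF mG i j; rewrite (_ : (fun w => _) = fun w => \sum_k F w i k * G w k j).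
  by apply: measurable_sum => k; apply: measurable_funM.
by apply/funext => w; rewrite mxE.
Qed.

Lemma mxmeasX p (F : T -> 'M[R]_p) n : mxmeas F -> mxmeas (fun w => F w ^+ n).
Proof.
move=> mF; elim: n => [|n IH].
  by move=> i j; apply: measurable_cst.
have -> : (fun w => F w ^+ n.+1) = (fun w => F w *m F w ^+ n).
  by apply/funext => w; rewrite exprS.
exact: mxmeasM.
Qed.

Lemma measurable_opnorm_le p (F : T -> 'M[R]_p) c : 0 <= c ->
  (forall w, (F w)^T = F w) -> mxmeas F -> measurable [set w | opnorm (F w) <= c].
Proof.
move=> c0 sF mF.
rewrite (_ : [set w | _] = \bigcap_k [set w | \tr (F w ^+ (2 ^ k.+1)) <= p%:R * c ^+ (2 ^ k.+1)]).
  apply: bigcap_measurable; first by exists 0%N.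
  move=> k _.
  have : measurable_fun setT (fun w => \tr (F w ^+ (2 ^ k.+1)) <= p%:R * c ^+ (2 ^ k.+1)).
    apply: measurable_fun_ler => //; apply: measurable_sum => i; exact: mxmeasX.
  by move=> /(_ measurableT [set true] Logic.I); rewrite setTI.
apply/seteqP; split=> w /=.
  by move=> /(sym_opnorm_leP (sF w) c0) h k _; apply: h.
by move=> h; apply/(sym_opnorm_leP (sF w) c0) => k; apply: h.
Qed.

End estimator_measurable.

Section exponential_bounds.
Context {R : realType}.
Implicit Types (theta : R) (p n : nat).

(** The exponents $2\theta$ and $3\theta$ of the individual tails lose at most $3\theta/10$ and
    $\theta/10$ to union bounds and dimension; the remaining $7\theta/10$ absorbs the constants. *)
Lemma expRN_split_le theta : 5 <= theta ->
  expR (- (17 / 10 * theta)) <= expR (- theta) / 4.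
Proof.
move=> th5; have -> : - (17 / 10 * theta) = - theta + - (7 / 10 * theta) by lra.
rewrite expRD ler_wpM2l ?expR_ge0// expRN lef_pV2 ?posrE ?expR_gt0//.
have h : 4 <= 1 + 7 / 10 * theta by lra.
exact: le_trans h (expR_ge1Dx _).
Qed.

Lemma samples_tail_le theta p n : 5 <= theta -> (1 < n)%N ->
  p%:R <= expR (theta / 10) -> n%:R <= expR (theta / 10) ->
  (n.+1 * p)%:R * (2 * expR (- (2 * theta))) <= expR (- theta) / 2.
Proof.
move=> th5 n1 pe ne; have e4 := expRN_split_le th5.
(* For $n\ge2$ the number of samples is at most $n^2$, so all coordinates of all samples cost three
   factors $e^{\theta/10}$. *)
have nn : n.+1%:R <= n%:R ^+ 2 :> R.
  rewrite -natrX ler_nat; case: n n1 {ne} => [|[|m]]// _.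
  rewrite -mulnn; apply: leq_trans (leq_mul (leqnn _) (_ : 2 <= m.+2)%N) => //.
  by rewrite muln2 -addnn addSn ltnS leq_addl.
have h : (n.+1 * p)%:R <= expR (3 / 10 * theta).
  have -> : 3 / 10 * theta = (theta / 10 + theta / 10) + theta / 10 by lra.
  rewrite !expRD -expr2 natrM ler_pM//; apply: le_trans nn _.
  by rewrite lerXn2r ?nnegrE ?expR_ge0.
apply: (@le_trans _ _ (expR (3 / 10 * theta) * (2 * expR (- (2 * theta))))).
  by rewrite ler_wpM2r// mulr_ge0 ?expR_ge0.
rewrite mulrCA -expRD.
have -> : 3 / 10 * theta + - (2 * theta) = - (17 / 10 * theta) by clear; lra.
by clear -e4; lra.
Qed.

Lemma means_tail_le theta n : 5 <= theta -> n%:R <= expR (theta / 10) ->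
  n%:R * expR (- (2 * theta)) <= expR (- theta) / 2.
Proof.
move=> th5 ne; have e4 := expRN_split_le th5.
apply: (@le_trans _ _ (expR (theta / 10) * expR (- (2 * theta)))).
  by rewrite ler_wpM2r ?expR_ge0.
apply: (@le_trans _ _ (expR (- (17 / 10 * theta)))).
  by rewrite -expRD ler_expR; clear -th5; lra.
by have e0 := expR_gt0 (- theta); clear -e4 e0; lra.
Qed.

Lemma matrix_tail_le theta p : 5 <= theta -> p%:R <= expR (theta / 10) ->
  2 * p%:R * expR (- (3 * theta)) <= expR (- theta) / 2.
Proof.
move=> th5 pe; have e4 := expRN_split_le th5.
apply: (@le_trans _ _ (2 * expR (theta / 10) * expR (- (3 * theta)))).
  by rewrite ler_wpM2r ?expR_ge0// ler_wpM2l.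
apply: (@le_trans _ _ (2 * expR (- (17 / 10 * theta)))).
  by rewrite -mulrA ler_wpM2l// -expRD ler_expR; clear -th5; lra.
by clear -e4; lra.
Qed.

End exponential_bounds.

(** * The event on which all dithering levels are good *)

Section good_events.
Context {R : realType} d (T : measurableType d) (P : probability T R) (p n : nat).
Variables (X : 'I_n.+1 -> {RV P >-> p.-tuple R}) (U Ub : 'I_n -> {RV P >-> p.-tuple R}).
Local Notation Y := (samples_and_dithers X U Ub).
Local Notation Ex f := (Rintegral P setT f).
Hypothesis indY : mutually_independent Y.
Variables (K s theta : R) (i0 : 'I_p).
Hypotheses (K0 : 0 < K) (s0 : 0 < s) (th5 : 5 <= theta) (n1 : (1 < n)%N).
Hypotheses (pe : p%:R <= expR (theta / 10)) (ne : n%:R <= expR (theta / 10)).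
Let a := 4 * K ^+ 2 * s.
Let c0 := (32 * K ^+ 2)^-1.
Hypothesis expX : forall j k, exp_moment_le P a (fun w => tnth (X j w) k).
Hypothesis varX : forall j, Ex (fun w => tnth (X j w) i0 ^+ 2) = s.

Let a0 : 0 < a.
Proof. by rewrite /a mulr_gt0// mulr_gt0// exprn_gt0. Qed.

Let c00 : 0 < c0.
Proof. by rewrite invr_gt0 mulr_gt0// exprn_gt0. Qed.

Lemma samples_bounded : exists2 bad, measurable bad &
  (P bad <= (expR (- theta) / 2)%:E)%E /\
  forall w, ~ bad w -> forall j i, tnth (X j w) i ^+ 2 <= 2 * a * theta.
Proof.
have th5' := th5.
pose F (ji : 'I_n.+1 * 'I_p) := [set w | a * (2 * theta) <= tnth (X ji.1 w) ji.2 ^+ 2].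
have mF ji : measurable (F ji).
  have : measurable_fun setT (fun w => a * (2 * theta) <= tnth (X ji.1 w) ji.2 ^+ 2).
    by apply: measurable_fun_ler => //; apply: measurable_funX; exact: measurable_coord.
  by move=> /(_ measurableT [set true] Logic.I); rewrite setTI.
have PF ji : (P (F ji) <= (2 * expR (- (2 * theta)))%:E)%E.
  exact: (exp_moment_tail a0 (2 * theta) (expX ji.1 ji.2)).
have [mU PU] := finite_union_le (enum {: 'I_n.+1 * 'I_p}) mF PF.
exists (\big[setU/set0]_(ji <- enum {: 'I_n.+1 * 'I_p}) F ji) => //; split.
  apply: le_trans PU _; rewrite lee_fin -cardE card_prod !card_ord.
  exact: samples_tail_le.
move=> w nb j i; rewrite leNgt; apply/negP => h; apply: nb.
rewrite -bigcup_seq; exists (j, i); first by rewrite /= mem_enum.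
by rewrite /F /=; lra.
Qed.

(** [Ex_abs_ge] with $B=16K^2\sqrt s$ loses exactly $s/2$, so $E|X_{i_0}|\ge c_0\sqrt s$. The weight
    $c_0/(2\sqrt s)$ then gives the exponent $c_0^2/2-c_0^2/4$. *)
Lemma Ex_laplace_coord j :
  Ex (fun w => expR (- (c0 / (2 * Num.sqrt s) * `|tnth (X j w) i0|))) <=
  expR (- (c0 ^+ 2 / 4)).
Proof.
have th5' := th5.
have r0 : 0 < Num.sqrt s by rewrite sqrtr_gt0.
have rr : Num.sqrt s ^+ 2 = s by rewrite sqr_sqrtr// ltW.
set B := 16 * K ^+ 2 * Num.sqrt s.
have B0 : 0 < B by rewrite /B !mulr_gt0// exprn_gt0.
have := Ex_abs_ge a0 B0 (expX j i0); rewrite varX => hB.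
have e1 : 8 * a ^+ 2 / B ^+ 2 = s / 2.
  rewrite /B /a !exprMn rr; field.
  by rewrite !gt_eqF// K0.
rewrite e1 in hB.
have hm : c0 * Num.sqrt s <= Ex (fun w => `|tnth (X j w) i0|).
  rewrite -(ler_pM2l B0); apply: le_trans hB.
  have -> : B * (c0 * Num.sqrt s) = Num.sqrt s ^+ 2 / 2.
    by rewrite /B /c0; field; rewrite gt_eqF.
  by rewrite rr; lra.
have b0 : 0 <= c0 / (2 * Num.sqrt s) by rewrite divr_ge0// ?(ltW c00)// mulr_ge0// ltW.
apply: le_trans (Ex_laplace_le a0 b0 (expX j i0) hm _) _.
  by rewrite varX.
rewrite ler_expR lerN2 le_eqVlt; apply/orP; left; apply/eqP.
rewrite -[X in _ = _ - _ * X]rr; field; by rewrite gt_eqF.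
Qed.

(** Asking for only a quarter of the mean leaves the Chernoff exponent $(k+1)c_0^2/8$. The threshold
    on $k$ is where this exceeds $2\theta$, enough for a union bound over all $k$. *)
Lemma means_bounded_below : exists2 bad, measurable bad &
  (P bad <= (expR (- theta) / 2)%:E)%E /\
  forall w, ~ bad w -> forall k : 'I_n, 16 / c0 ^+ 2 * theta < k.+1%:R ->
    c0 / 4 * Num.sqrt s <= running_mean (fun j => colvec (X j w)) k.
Proof.
have th5' := th5.
have r0 : 0 < Num.sqrt s by rewrite sqrtr_gt0.
pose b := c0 / (2 * Num.sqrt s).
have b0 : 0 <= b by rewrite divr_ge0// ?(ltW c00)// mulr_ge0// ltW.
pose g (x : p.-tuple R) := `|tnth x i0|.
have mg : measurable_fun setT g by apply: measurableT_comp => //; exact: measurable_tnth.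
pose r (k : 'I_n) : seq ('I_n.+1 + ('I_n + 'I_n))%type :=
  [seq inl j | j <- enum [pred j : 'I_n.+1 | (j < k.+1)%N]].
pose c (k : 'I_n) := k.+1%:R * (c0 / 4 * Num.sqrt s).
have tail k : measurable [set w | \sum_(i <- r k) g (Y i w) <= c k] /\
    (P [set w | (\sum_(i <- r k) g (Y i w) <= c k)%R] <=
     (expR (b * c k) * expR (- (c0 ^+ 2 / 4)) ^+ size (r k))%:E)%E.
  apply: (@Ex_laplace_lower_tail _ _ _ _ _ _ _ Y indY g (r k) b _ (c k) mg _ _ b0).
  - by move=> x; exact: normr_ge0.
  - by rewrite /r map_inj_uniq ?enum_uniq// => x y [].
  - by move=> _ /mapP[j _ ->]; exact: Ex_laplace_coord.
(* Early means carry no guarantee, so their bad event is empty; the corresponding [b k] is 1. *)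
pose F (k : 'I_n) := if 16 / c0 ^+ 2 * theta < k.+1%:R
   then [set w | \sum_(i <- r k) g (Y i w) <= c k] else set0.
have mF k : measurable (F k).
  by rewrite /F; case: ifP => // _; exact: (tail k).1.
have PF k : (P (F k) <= (expR (- (2 * theta)))%:E)%E.
  rewrite /F; case: ifP => hk; last by rewrite measure0 lee_fin expR_ge0.
  apply: le_trans (tail k).2 _; rewrite lee_fin -expRM_natl -expRD ler_expR.
  rewrite size_map size_enum_lt.
  have -> : b * c k + k.+1%:R * - (c0 ^+ 2 / 4) = - (k.+1%:R * c0 ^+ 2 / 8).
    by rewrite /b /c; field; rewrite gt_eqF.
  rewrite lerN2.
  move: hk; rewrite mulrAC ltr_pdivrMr ?exprn_gt0// => hk; lra.
have [mU PU] := finite_union_le (enum 'I_n) mF PF.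
exists (\big[setU/set0]_(k <- enum 'I_n) F k) => //; split.
  apply: le_trans PU _; rewrite lee_fin -cardE card_ord; exact: means_tail_le.
move=> w nb k hk; rewrite leNgt; apply/negP => h; apply: nb.
rewrite -bigcup_seq; exists k; first by rewrite /= mem_enum.
rewrite /F hk /= big_map.
apply: (@le_trans _ _ (k.+1%:R * running_mean (fun j => colvec (X j w)) k)).
  apply: le_trans (running_mean_ge _ _ i0); apply: ler_sum => j _.
  by rewrite /g mxE.
by rewrite ler_wpM2l// ltW.
Qed.

Variables (lam : 'I_n -> T -> R) (C1 : R).
Hypothesis C1E : C1 = 32 * K ^+ 2 / (c0 / 4) ^+ 2.
Hypothesis lam_sqr : forall k w, lam k w ^+ 2 =
  C1 * ln k.+1%:R * running_mean (fun j => colvec (X j w)) k ^+ 2.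
Hypothesis lam0 : forall k w, 0 <= lam k w.
Let b (k : nat) : R := if k.+1%:R <= 16 / c0 ^+ 2 * theta then 1 else (k.+1%:R ^+ 2)^-1.

(** [C1] solves $C_1(c_0/4)^2s/(4a)=2$, so a running mean of at least $(c_0/4)\sqrt s$ makes the
    bias factor at most $(k+1)^{-2}$. The upper bound [L] comes from $\|X_j\|_\infty^2\le2a\theta$
    and $\log(k+1)\le\log n$. *)
Lemma dithers_good (L : R) : 0 <= L ->
  L ^+ 2 = (8 * K ^+ 2 * C1 + 1) * (theta * ln n%:R) * s ->
  exists2 bad, measurable bad &
  (P bad <= (expR (- theta))%:E)%E /\
  forall w, ~ bad w -> forall k, good_dither a lam L b k w.
Proof.
have th5' := th5.
move=> L0 L2.
have [b1 mb1 [Pb1 h1]] := samples_bounded.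
have [b2 mb2 [Pb2 h2]] := means_bounded_below.
exists (b1 `|` b2); first exact: measurableU.
split.
  apply: le_trans (measureU2 _ mb1 mb2) _.
  apply: le_trans (leeD Pb1 Pb2) _; rewrite -EFinD lee_fin; lra.
move=> w /not_orP[/h1 {}h1 /h2 {}h2] k.
have C10 : 0 <= C1.
  rewrite C1E; apply: divr_ge0; last exact: sqr_ge0.
  by apply: mulr_ge0; [exact: ler0n|exact: sqr_ge0].
have lnk : 0 <= ln k.+1%:R :> R by rewrite ln_ge0// ler1n.
have th0 : 0 <= theta by lra.
have lnkn : ln k.+1%:R <= ln n%:R :> R.
  by rewrite ler_ln ?posrE ?ltr0n ?ler_nat ?(ltn_ord k)// (ltn_trans _ n1).
have lnn := le_trans lnk lnkn.
apply/andP; split.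
  rewrite -(ler_sqr (lam0 k w)) ?nnegrE// lam_sqr L2.
  set rm := running_mean _ _.
  have /andP[rm0 rmle] : 0 <= rm <= Num.sqrt (2 * a * theta).
    apply: running_mean_le => [|j i]; first exact: sqrtr_ge0.
    rewrite mxE -sqrtr_sqr ler_sqrt; last first.
      by rewrite mulr_ge0// mulr_ge0// ltW.
    exact: h1.
  have rm2 : rm ^+ 2 <= 2 * a * theta.
    have at0 : 0 <= 2 * a * theta by rewrite mulr_ge0// mulr_ge0// ltW.
    by rewrite -[leRHS](sqr_sqrtr at0) lerXn2r ?nnegrE ?sqrtr_ge0.
  apply: (@le_trans _ _ (C1 * ln n%:R * (2 * a * theta))).
    apply: ler_pM => //; first by rewrite mulr_ge0.
      exact: sqr_ge0.
    by rewrite ler_wpM2l.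
  have -> : C1 * ln n%:R * (2 * a * theta) = 8 * K ^+ 2 * C1 * (theta * ln n%:R) * s.
    by rewrite /a; ring.
  by rewrite ler_wpM2r ?(ltW s0)// ler_wpM2r ?mulr_ge0// lerDl.
rewrite /b; case: ifP => [_|/negbT].
  by rewrite -expR0 ler_expR oppr_le0 divr_ge0 ?sqr_ge0// mulr_ge0// ltW.
rewrite -ltNge => hk; have {}h2 := h2 k hk.
have kp : 0 < k.+1%:R :> R by rewrite ltr0n.
have -> : (k.+1%:R ^+ 2)^-1 = expR (- (2 * ln k.+1%:R)) :> R.
  by rewrite expRN expRM_natl lnK ?posrE.
rewrite ler_expR lerN2 ler_pdivlMr ?mulr_gt0// lam_sqr.
set rm := running_mean _ _ in h2 *.
have h3 : (c0 / 4) ^+ 2 * s <= rm ^+ 2.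
  have -> : (c0 / 4) ^+ 2 * s = (c0 / 4 * Num.sqrt s) ^+ 2.
    by rewrite [RHS]exprMn sqr_sqrtr// ltW.
  have q0 : 0 <= c0 / 4 * Num.sqrt s by rewrite mulr_ge0 ?sqrtr_ge0// divr_ge0// ltW.
  by rewrite lerXn2r ?nnegrE// (le_trans q0).
apply: (@le_trans _ _ (C1 * ln k.+1%:R * ((c0 / 4) ^+ 2 * s))); last first.
  by rewrite ler_wpM2l// mulr_ge0.
rewrite C1E /a le_eqVlt; apply/orP; left; apply/eqP.
by field; rewrite gt_eqF.
Qed.

End good_events.

Section final_rate.
Context {R : realType}.

Lemma powR52 (x : R) : 0 <= x -> x `^ (5 / 2) = x ^+ 2 * Num.sqrt x.
Proof.
move=> x0; have -> : 5 / 2 = 2%:R + 2^-1 :> R by lra.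
rewrite powRD ?powR_mulrn ?powR12_sqrt//.
by apply/implyP => /eqP; lra.
Qed.

(** Substituting [D] gives the powers $\theta^{3/2}$ and $\theta^2$ with one factor $\log n$; the
    remaining factor $\theta\log p\ge1$ yields the form of the rate. *)
Lemma final_rate_le (n : nat) (s L mu nu S0 theta lp lnn C3 C4 D : R) :
  (0 < n)%N -> 0 <= s -> 0 <= mu -> 0 <= nu -> 1 <= theta * lp -> 1 <= theta ->
  0 <= lnn -> 0 <= C3 -> 0 <= C4 ->
  L ^+ 2 = C4 * (theta * lnn) * s ->
  D = 2 * L ^+ 2 * mu +
    (theta * lnn) * Num.sqrt n%:R * Num.sqrt s * Num.sqrt S0 * nu / Num.sqrt theta ->
  2 * (C3 + 3) * theta * D / n%:R <=
  4 * (C3 + 3) * (C4 + 1) * (lp * lnn *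
    (theta `^ (5 / 2) * (nu / Num.sqrt n%:R) * Num.sqrt s * Num.sqrt S0
     + theta ^+ 3 * (mu / n%:R) * s)).
Proof.
move=> n0 s0 mu0 nu0 tl t1 l0 C30 C40 L2 DE.
have nR : 0 < n%:R :> R by rewrite ltr0n.
have t0 : 0 < theta by lra.
set r := Num.sqrt n%:R; have r0 : 0 < r by rewrite sqrtr_gt0.
have rr : n%:R = r * r by rewrite -expr2 sqr_sqrtr// ltW.
set t := Num.sqrt theta; have tp : 0 < t by rewrite sqrtr_gt0.
have tt : theta = t * t by rewrite -expr2 sqr_sqrtr// ltW.
have q1 := sqrtr_ge0 s; have q2 := sqrtr_ge0 S0.
rewrite powR52 ?(ltW t0)// -/t.
set G1 := lnn * (theta ^+ 2 * (mu / n%:R) * s).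
set G2 := lnn * (theta * t * (nu / r) * Num.sqrt s * Num.sqrt S0).
have G10 : 0 <= G1.
  by rewrite /G1 mulr_ge0// mulr_ge0// mulr_ge0 ?sqr_ge0// divr_ge0// ltW.
have G20 : 0 <= G2.
  by rewrite /G2 mulr_ge0// mulr_ge0// mulr_ge0// mulr_ge0 ?divr_ge0 ?(ltW r0)// mulr_ge0// ltW.
have -> : 2 * (C3 + 3) * theta * D / n%:R = 4 * (C3 + 3) * C4 * G1 + 2 * (C3 + 3) * G2.
  rewrite DE L2 /G1 /G2 -/r -/t rr tt.
  by field; rewrite !gt_eqF.
have -> : 4 * (C3 + 3) * (C4 + 1) * (lp * lnn *
    (theta ^+ 2 * t * (nu / r) * Num.sqrt s * Num.sqrt S0 + theta ^+ 3 * (mu / n%:R) * s)) =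
   (theta * lp) * (4 * (C3 + 3) * (C4 + 1) * (G1 + G2)).
  by rewrite /G1 /G2; ring.
have h : 4 * (C3 + 3) * C4 * G1 + 2 * (C3 + 3) * G2 <= 4 * (C3 + 3) * (C4 + 1) * (G1 + G2).
  rewrite -subr_ge0.
  have -> : 4 * (C3 + 3) * (C4 + 1) * (G1 + G2) - (4 * (C3 + 3) * C4 * G1 + 2 * (C3 + 3) * G2) =
     (C3 + 3) * (4 * G1 + (4 * C4 + 2) * G2) by ring.
  by rewrite mulr_ge0 ?addr_ge0// mulr_ge0// addr_ge0// mulr_ge0.
apply: le_trans h _; rewrite ler_peMl// mulr_ge0 ?addr_ge0// mulr_ge0 ?addr_ge0//.
by rewrite mulr_ge0// addr_ge0.
Qed.

End final_rate.

Section high_probability.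
Context {R : realType} d (T : measurableType d) (P : probability T R).

Lemma prob_ge_compl (A bad : set T) (e : R) : measurable A -> measurable bad ->
  (P bad <= e%:E)%E -> (forall w, ~ bad w -> A w) -> ((1 - e)%:E <= P A)%E.
Proof.
move=> mA mb Pb h; apply: (@le_trans _ _ (P (~` bad))).
  rewrite probability_setC// EFinB; apply: leeB => //.
by apply: le_measure; rewrite ?inE//; exact: measurableC.
Qed.

Lemma measurable_adaptive_error p n (X : 'I_n.+1 -> {RV P >-> p.-tuple R})
    (U Ub : 'I_n -> {RV P >-> p.-tuple R}) (lam : 'I_n -> T -> R) (M Sigma : 'M[R]_p) :
  (forall k, measurable_fun setT (lam k)) ->
  mxmeas (fun w => hadamard M (adaptive_estimator X U Ub lam w) - hadamard M Sigma).
Proof.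
move=> ml i j.
have ms k (V : {RV P >-> p.-tuple R}) e : measurable_fun setT (fun w =>
    sign1 (tnth (X (lift ord0 k) w) e + lam k w * tnth (V w) e)).
  apply: (measurableT_comp measurable_sign1); apply: measurable_funD.
    exact: measurable_coord.
  by apply: measurable_funM => //; exact: measurable_coord.
pose F (i j : 'I_p) w := \sum_(k < n) lam k w ^+ 2 / n%:R *
   (sign1 (tnth (X (lift ord0 k) w) i + lam k w * tnth (U k w) i) *
    sign1 (tnth (X (lift ord0 k) w) j + lam k w * tnth (Ub k w) j)).
have mF i' j' : measurable_fun setT (F i' j').
  apply: measurable_sum => k; apply: measurable_funM.
    by apply: measurable_funM => //; exact: measurable_funX.
  by apply: measurable_funM; exact: ms.
rewrite (_ : (fun w => _) = fun w => M i j * (2^-1 * F i j w + 2^-1 * F j i w) - M i j * Sigma i j).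
  apply: measurable_funB => //; apply: measurable_funM => //.
  by apply: measurable_funD; apply: measurable_funM.
apply/funext => w; rewrite /adaptive_estimator /onebit_estimator !mxE /onebit_sum !summxE.
congr (_ * (_ * _ + _ * _) - _); apply: eq_bigr => k _; by rewrite !mxE !big_ord1 !mxE.
Qed.

End high_probability.

Lemma hadamard0l {R : realType} p (M : 'M[R]_p) : hadamard 0 M = 0.
Proof. by apply/matrixP => i j; rewrite !mxE mul0r. Qed.

Lemma opnorm0 {R : realType} p : opnorm (0 : 'M[R]_p) = 0.
Proof.
apply/eqP; rewrite eq_le opnorm_ge0 andbT; apply: opnorm_le => // x.
by rewrite mul0mx norm20 mul0r.
Qed.

Lemma adaptive_error_sym {R : realType} d (T : measurableType d) (P : probability T R)
    p n (X : 'I_n.+1 -> {RV P >-> p.-tuple R}) (U Ub : 'I_n -> {RV P >-> p.-tuple R})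
    (lam : 'I_n -> T -> R) (M Sigma : 'M[R]_p) w : M^T = M -> Sigma^T = Sigma ->
  (hadamard M (adaptive_estimator X U Ub lam w) - hadamard M Sigma)^T =
  hadamard M (adaptive_estimator X U Ub lam w) - hadamard M Sigma.
Proof.
move=> sM sS.
have hs (A : 'M[R]_p) : A^T = A -> (hadamard M A)^T = hadamard M A.
  move=> sA; apply/matrixP => i j.
  by rewrite [LHS]mxE !hadamardE -[in LHS]sM -[in LHS]sA !mxE.
by rewrite linearB /= (hs _ sS) hs//; exact: sym_part_sym.
Qed.

(** * The bound for a nonzero covariance matrix and a nonzero mask *)

Section adaptive_bound.
Context {R : realType}.
Variable K : R.
Hypothesis K0 : 0 < K.

(** $c_0\sqrt s$ bounds a mean absolute value from below, [k3] bounds the sum of the bias factors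
    over $\theta$, [C4] gives the size of $L^2$, and [C3] is the total conditional rate over
    $\theta$. The summand 1 in [C4] ensures $s\le L^2$. *)
Let c0 := (32 * K ^+ 2)^-1.
Let C1 := 32 * K ^+ 2 / (c0 / 4) ^+ 2.
Let k3 := 16 / c0 ^+ 2 + 2.
Let C4 := 8 * K ^+ 2 * C1 + 1.
Let C3 := (1 + 16 * K ^+ 2) * k3 / 2 + 2 * (C4 + 1) ^+ 2 + 16 * K ^+ 2 * k3.

Let K2 : 0 < K ^+ 2. Proof. exact: exprn_gt0. Qed.

Let c00 : 0 < c0.
Proof. by rewrite invr_gt0; apply: mulr_gt0. Qed.

Let c02 : 0 < c0 ^+ 2. Proof. exact: exprn_gt0. Qed.

Let C10 : 0 < C1.
Proof.
apply: divr_gt0; first by apply: mulr_gt0; [rewrite ltr0n|exact: K2].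
by apply: exprn_gt0; apply: divr_gt0; [exact: c00|rewrite ltr0n].
Qed.

Let k30 : 0 < k3.
Proof. by apply: addr_gt0 => //; apply: divr_gt0. Qed.

Let C41 : 1 <= C4.
Proof. by rewrite lerDr; apply: mulr_ge0; [apply: mulr_ge0 => //; exact: ltW|exact: ltW]. Qed.

Let C30 : 0 <= C3.
Proof.
have h : 0 <= 16 * K ^+ 2 by apply: mulr_ge0 => //; exact: ltW.
apply: addr_ge0; last by apply: mulr_ge0 => //; exact: ltW.
apply: addr_ge0; last by apply: mulr_ge0 => //; exact: sqr_ge0.
apply: divr_ge0 => //; apply: mulr_ge0; last exact: ltW.
by apply: addr_ge0.
Qed.

Variables (p n : nat).
Hypotheses (p1 : (1 < p)%N) (n1 : (1 < n)%N).
Context d (T : measurableType d) (P : probability T R).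
Variables (X : 'I_n.+1 -> {RV P >-> p.-tuple R}) (U Ub : 'I_n -> {RV P >-> p.-tuple R}).
Hypothesis indY : mutually_independent (samples_and_dithers X U Ub).
Hypotheses (hU : forall k, uniform_cube (U k)) (hUb : forall k, uniform_cube (Ub k)).
Variables (M Sigma : 'M[R]_p).
Hypotheses (M0 : forall i j, 0 <= M i j) (sM : M^T = M).
Variable lam : 'I_n -> T -> R.
Hypothesis lam0 : forall k w, 0 <= lam k w.
Hypothesis lam_sqr : forall k w, lam k w ^+ 2 =
  C1 * ln (k.+1%:R) * running_mean (fun j => colvec (X j w)) k ^+ 2.
Variable theta : R.
Hypothesis htheta : 10 * Num.max (ln p%:R) (ln n%:R) <= theta.

Let error w := hadamard M (adaptive_estimator X U Ub lam w) - hadamard M Sigma.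
Let rate := 4 * (C3 + 3) * (C4 + 1) * (ln p%:R * ln n%:R *
    (theta `^ (5 / 2) * (norm12 M / Num.sqrt n%:R)
       * Num.sqrt (mx_norm Sigma) * Num.sqrt (opnorm Sigma)
     + theta ^+ 3 * (opnorm M / n%:R) * mx_norm Sigma)).

Lemma theta_ge_ln : [/\ 5 <= theta, p%:R <= expR (theta / 10),
  n%:R <= expR (theta / 10), 2^-1 <= ln p%:R :> R & 2^-1 <= ln n%:R :> R].
Proof.
have lp : 2^-1 <= ln p%:R :> R := ln_nat_ge p1.
have ln_ : 2^-1 <= ln n%:R :> R := ln_nat_ge n1.
have h := htheta.
have h1 : ln p%:R <= theta / 10.
  rewrite ler_pdivlMr// mulrC; apply: le_trans h.
  by rewrite ler_pM2l// le_max lexx.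
have h2 : ln n%:R <= theta / 10.
  rewrite ler_pdivlMr// mulrC; apply: le_trans h.
  by rewrite ler_pM2l// le_max lexx orbT.
split=> //; first by lra.
- by apply: nat_le_expR => //; exact: ltnW.
- by apply: nat_le_expR => //; exact: ltnW.
Qed.

Lemma lamE k w : lam k w =
  Num.sqrt (C1 * ln (k.+1%:R)) * running_mean (fun j => colvec (X j w)) k.
Proof.
have c0' : 0 <= C1 * ln (k.+1%:R).
  by apply: mulr_ge0; [exact: ltW | rewrite ln_ge0// ler1n].
have rm0 : 0 <= running_mean (fun j => colvec (X j w)) k.
  by rewrite mulr_ge0 ?invr_ge0// sumr_ge0// => j _; exact: mx_norm_ge0.
rewrite -[LHS]ger0_norm// -sqrtr_sqr lam_sqr sqrtrM// sqrtr_sqr.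
by rewrite ger0_norm.
Qed.

Lemma measurable_lam k : measurable_fun setT (lam k).
Proof.
rewrite (_ : lam k = fun w => Num.sqrt (C1 * ln (k.+1%:R)) *
  (k.+1%:R^-1 * \sum_(j <- enum [pred j : 'I_n.+1 | (j < k.+1)%N]) mx_norm (colvec (X j w)))).
  do 2 apply: measurable_funM => //; apply: measurable_sum => j.
  apply: measurable_mx_norm => i e.
  rewrite (_ : (fun w => _) = fun w => tnth (X j w) i); first exact: measurable_coord.
  by apply/funext => w; rewrite mxE.
apply/funext => w; rewrite lamE /running_mean; congr (_ * (_ * _)).
by rewrite big_enum_cond /=; apply: eq_bigl => j; rewrite andbT inE.
Qed.

Lemma rate_ge0 : 0 <= rate.
Proof.
have [th5 _ _ lp ln_] := theta_ge_ln.
have [C3' C4'] : 0 <= C3 /\ 1 <= C4 by split; [exact: C30|exact: C41].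
have th0 : 0 <= theta by lra.
have lp0 : 0 <= ln p%:R :> R by lra.
have ln0 : 0 <= ln n%:R :> R by lra.
apply: mulr_ge0.
  apply: mulr_ge0; last by lra.
  by apply: mulr_ge0 => //; lra.
apply: mulr_ge0; first exact: mulr_ge0.
apply: addr_ge0.
  do 2 (apply: mulr_ge0; last exact: sqrtr_ge0).
  apply: mulr_ge0; first exact: powR_ge0.
  by apply: divr_ge0; [exact: norm12_ge0|exact: sqrtr_ge0].
apply: mulr_ge0; last exact: mx_norm_ge0.
apply: mulr_ge0; first exact: exprn_ge0.
by apply: divr_ge0; [exact: opnorm_ge0|exact: ler0n].
Qed.

Lemma measurable_event : Sigma^T = Sigma -> measurable [set w | opnorm (error w) <= rate].
Proof.
move=> sS; apply: measurable_opnorm_le; first exact: rate_ge0.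
  by move=> w; exact: adaptive_error_sym.
by apply: measurable_adaptive_error; exact: measurable_lam.
Qed.

Let s := mx_norm Sigma.
Let a := 4 * K ^+ 2 * s.

Hypothesis expX : forall j k, exp_moment_le P a (fun w => tnth (X j w) k).
Hypothesis covX : forall j i i',
  Rintegral P setT (fun w => tnth (X j w) i * tnth (X j w) i') = Sigma i i'.
Variable i0 : 'I_p.
Hypothesis Si0 : Sigma i0 i0 = s.
Hypothesis s0 : 0 < s.

Let Ssym : Sigma^T = Sigma.
Proof. exact: (cov_sym (Y := X) (ix := ord0) (covX ord0)). Qed.

Let S0 := opnorm Sigma.
Let Q := theta * ln n%:R.
Let L := Num.sqrt (C4 * Q * s).
Let D := 2 * L ^+ 2 * opnorm M +
  Q * Num.sqrt n%:R * Num.sqrt s * Num.sqrt S0 * norm12 M / Num.sqrt theta.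
Let b (k : nat) : R := if k.+1%:R <= 16 / c0 ^+ 2 * theta then 1 else (k.+1%:R ^+ 2)^-1.

Let b0 k : 0 <= b k.
Proof. by rewrite /b; case: ifP => // _; rewrite invr_ge0 sqr_ge0. Qed.

Let b_sum : \sum_(k < n) b k <= k3 * theta.
Proof.
have [th5 _ _ _ _] := theta_ge_ln.
have x0 : 0 <= 16 / c0 ^+ 2 * theta.
  apply: mulr_ge0; last by lra.
  by apply: divr_ge0 => //; exact: ltW.
apply: (@le_trans _ _ (\sum_(k < n) (if k.+1%:R <= 16 / c0 ^+ 2 * theta then 1 else 0) +
   \sum_(k < n) (k.+1%:R ^+ 2)^-1)).
  rewrite -big_split; apply: ler_sum => k _; rewrite /b /=; case: ifP => _.
    by rewrite lerDl invr_ge0 sqr_ge0.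
  by rewrite add0r.
rewrite /k3 [leRHS]mulrDl; apply: lerD; first exact: sum_small_le.
by apply: le_trans (sum_inv_sqr_le n) _; lra.
Qed.

Let Q1 : 1 <= Q.
Proof.
have [th5 _ _ _ ln_] := theta_ge_ln.
have : 5 * 2^-1 <= Q by apply: ler_pM.
move=> h; apply: le_trans h; lra.
Qed.

Let Q0 : 0 <= Q. Proof. by apply: le_trans Q1. Qed.

Let L2 : L ^+ 2 = C4 * Q * s.
Proof.
rewrite sqr_sqrtr//; apply: mulr_ge0; last exact: ltW.
by apply: mulr_ge0 => //; apply: le_trans C41.
Qed.

Let sS0 : s <= S0. Proof. by rewrite -Si0; exact: diag_le_opnorm. Qed.

Let sL : s <= L ^+ 2.
Proof.
rewrite L2 -[leLHS]mul1r; apply: ler_wpM2r; first exact: ltW.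
by rewrite -[leLHS]mulr1; apply: ler_pM.
Qed.

(** The level $u=2(C_3+3)\theta$ is chosen so that the rates, at most $C_3\theta$, leave the
    exponent $-3\theta$, which also pays for the factor $2p$. *)
Lemma error_tail (eta : R) : 0 < D -> `|eta| = D^-1 ->
  exists2 bad : set T, measurable bad &
    (P bad <= (expR (- theta) / 2)%:E)%E /\
    forall w, ~ bad w -> (forall k, good_dither a lam L b k w) -> forall y,
      eta * n%:R * dot y (error w *m y) <= 2 * (C3 + 3) * theta * dot y y.
Proof.
move=> D0 etaE; have [th5 pe ne lp ln_] := theta_ge_ln.
have th0 : 0 < theta by lra.
have mu0 := opnorm_ge0 M.
have n0 : (0 < n)%N by exact: ltnW.
have eta2 : eta ^+ 2 = D^-1 ^+ 2 by rewrite -etaE -normrX ger0_norm ?sqr_ge0.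
have eta_le : `|eta| * (L ^+ 2 + s) * opnorm M <= 1.
  rewrite etaE -mulrA mulrC ler_pdivrMr// mul1r.
  apply: (@le_trans _ _ (2 * L ^+ 2 * opnorm M)).
    by rewrite ler_wpM2r//; have h := sL; lra.
  rewrite /D lerDl divr_ge0 ?sqrtr_ge0// mulr_ge0 ?norm12_ge0//.
  by do 3 (apply: mulr_ge0; last exact: sqrtr_ge0).
have u0 : 0 <= 2 * (C3 + 3) * theta.
  apply: mulr_ge0; last exact: ltW.
  by apply: mulr_ge0 => //; apply: addr_ge0 => //; exact: C30.
have a0 : 0 < a by apply: mulr_gt0 => //; apply: mulr_gt0.
have [bad mbad [Pbad hbad]] := estimator_tail indY hU hUb a0 (ltW s0) expX covX
  (le_mx_norm Sigma) M0 sM lam0 lamE (sqrtr_ge0 _) b0 eta_le (Ordinal n0) u0.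
exists bad => //; split; last exact: hbad.
apply: le_trans Pbad _; rewrite lee_fin.
apply: le_trans (matrix_tail_le th5 pe); rewrite ler_wpM2l ?mulr_ge0// ler_expR.
have hs : \sum_(k < n) step_rate a s M Sigma eta L b k <= C3 * theta.
  rewrite /step_rate etaE eta2.
  exact: (@step_rate_sum_le R n K s L (opnorm M) (norm12 M) S0 Q theta C4 k3 D b
    n0 s0 mu0 (norm12_ge0 M) sS0 Q1 th0 C41 L2 b0 b_sum erefl D0).
by lra.
Qed.

Lemma D_gt0 : M <> 0 -> 0 < D.
Proof.
move=> Mn0; have [th5 _ _ _ _] := theta_ge_ln.
have mup : 0 < opnorm M.
  by rewrite lt_def opnorm_ge0 andbT; apply/eqP => /opnorm0_eq0.
have Lp : 0 < L ^+ 2 by apply: lt_le_trans sL.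
rewrite /D; apply: ltr_pwDl.
  by apply: mulr_gt0 => //; apply: mulr_gt0.
apply: divr_ge0; last exact: sqrtr_ge0.
apply: mulr_ge0; last exact: norm12_ge0.
by do 3 (apply: mulr_ge0; last exact: sqrtr_ge0).
Qed.

(** [error_tail] is one-sided and is used for both signs of [eta]; with [dithers_good], the
    discarded events add up to $2e^{-\theta}$. *)
Lemma error_bound : M <> 0 ->
  ((1 - 2 * expR (- theta))%:E <= P [set w | (opnorm (error w) <= rate)%R])%E.
Proof.
move=> Mn0; have [th5 pe ne lp ln_] := theta_ge_ln.
have th0 : 0 < theta by lra.
have Dp := D_gt0 Mn0.
have n0 : (0 < n)%N by exact: ltnW.
have nR : 0 < n%:R :> R by rewrite ltr0n.
have varX j : Rintegral P setT (fun w => tnth (X j w) i0 ^+ 2) = s.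
  by rewrite -Si0 -(covX j); apply: eq_Ex => w; rewrite expr2.
have [bg mbg [Pbg hbg]] := dithers_good indY K0 s0 th5 n1 pe ne expX varX
  (erefl C1) lam_sqr lam0 (sqrtr_ge0 _) L2.
have eD : `|D^-1| = D^-1 by rewrite ger0_norm// invr_ge0 ltW.
have [b1 mb1 [Pb1 hb1]] := error_tail Dp eD.
have eD' : `|- D^-1| = D^-1 by rewrite normrN.
have [b2 mb2 [Pb2 hb2]] := error_tail Dp eD'.
have mb12 : measurable (b1 `|` b2) by exact: measurableU.
apply: (@prob_ge_compl _ _ _ P _ (bg `|` (b1 `|` b2))).
- exact: measurable_event.
- exact: measurableU.
- apply: le_trans (measureU2 _ mbg mb12) _.
  have h12 := le_trans (measureU2 P mb1 mb2) (leeD Pb1 Pb2).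
  apply: le_trans (leeD Pbg h12) _; rewrite -!EFinD lee_fin; lra.
move=> w /not_orP[/hbg gw /not_orP[/hb1 h1 /hb2 h2]].
have {}h1 := h1 gw; have {}h2 := h2 gw.
have ubound : 2 * (C3 + 3) * theta * D / n%:R <= rate.
  have tl : 1 <= theta * ln p%:R.
    by apply: le_trans (_ : 5 * 2^-1 <= _); [lra|apply: ler_pM].
  have t1 : 1 <= theta by lra.
  have l0 : 0 <= ln n%:R :> R by lra.
  exact: (@final_rate_le R n s L (opnorm M) (norm12 M) S0 theta (ln p%:R) (ln n%:R)
    C3 C4 D n0 (mx_norm_ge0 _) (opnorm_ge0 _) (norm12_ge0 _) tl t1 l0 C30
    (le_trans ler01 C41) L2 erefl).
apply: le_trans ubound.
have C33 : 0 <= C3 + 3 by apply: addr_ge0 => //; exact: C30.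
have c0' : 0 <= 2 * (C3 + 3) * theta * D / n%:R.
  apply: divr_ge0; last exact: ltW.
  apply: mulr_ge0; last exact: ltW.
  by apply: mulr_ge0; [apply: mulr_ge0|exact: ltW].
(* The error is symmetric, so two-sided bounds on its quadratic form bound its operator norm.
   Multiplying by $D/n$ undoes the scaling. *)
apply: opnorm_le => //; apply: sym_opbound => //; first exact: adaptive_error_sym.
move=> y; have {}h1 := h1 y; have {}h2 := h2 y.
rewrite ler_norml; set q := dot y _ in h1 h2 *.
have key : 2 * (C3 + 3) * theta * D / n%:R * dot y y =
    2 * (C3 + 3) * theta * dot y y * (D / n%:R) by rewrite -!mulrA (mulrC (dot y y)) !mulrA.
have Dn : 0 < D / n%:R by exact: divr_gt0.
have e1 : D^-1 * n%:R * q * (D / n%:R) = q by field; rewrite !gt_eqF.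
apply/andP; split.
  rewrite key lerNl; have := ler_wpM2r (ltW Dn) h2.
  by rewrite !mulNr e1.
by rewrite key -[leLHS]e1 ler_wpM2r// ltW.
Qed.

End adaptive_bound.

Lemma same_law_tuple {R : realType} d0 (T0 : measurableType d0) (P0 : probability T0 R)
    d (T : measurableType d) (P : probability T R) p
    (X0 : {RV P0 >-> p.-tuple R}) (X : {RV P >-> p.-tuple R}) :
  same_law X X0 -> square_integrable_vec X0 ->
  [/\ (forall a i, exp_moment_le P0 a (fun w => tnth (X0 w) i) ->
        exp_moment_le P a (fun w => tnth (X w) i)),
      (forall i j, Rintegral P setT (fun w => tnth (X w) i * tnth (X w) j) = covmx X0 i j) &
      (forall i, covmx X0 i i = 0 -> P [set w | tnth (X w) i != 0] = 0%E)].
Proof.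
move=> law sq; split.
- move=> a i [m0 i0 e0].
  have mf : measurable_fun setT (fun x : p.-tuple R => expR (tnth x i ^+ 2 / a)).
    apply: measurableT_comp => //; apply: measurable_funM => //.
    by apply: measurable_funX; exact: measurable_tnth.
  have [iX eX] := same_law_integral law mf i0.
  by split; [exact: measurable_coord|exact: iX|rewrite [leLHS]eX].
- move=> i j; rewrite covmxE.
  have mf : measurable_fun setT (fun x : p.-tuple R => tnth x i * tnth x j).
    by apply: measurable_funM; exact: measurable_tnth.
  exact: (same_law_integral law mf (square_integrable_intgM sq i j)).2.
- move=> i /(covmx0_ae sq) <-.
  have mA : measurable [set x : p.-tuple R | tnth x i != 0].
    have : measurable_fun setT (fun x : p.-tuple R => tnth x i == 0).
      by apply: measurable_fun_eqr => //; exact: measurable_tnth.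
    move=> /(_ measurableT [set false] Logic.I); rewrite setTI.
    by congr measurable; apply/seteqP; split => x /=; case: (tnth x i == 0).
  exact: law mA.
Qed.

Lemma covmx_sym {R : realType} d (T : measurableType d) (P : probability T R) p
  (X : {RV P >-> p.-tuple R}) : (covmx X)^T = covmx X.
Proof.
apply/matrixP => i j; rewrite mxE !covmxE.
by apply: eq_Ex => w; rewrite mulrC.
Qed.

Lemma adaptive_estimator0 {R : realType} d (T : measurableType d) (P : probability T R)
    p n (X : 'I_n.+1 -> {RV P >-> p.-tuple R}) (U Ub : 'I_n -> {RV P >-> p.-tuple R})
    (lam : 'I_n -> T -> R) w :
  (forall k, lam k w = 0) -> adaptive_estimator X U Ub lam w = 0.
Proof.
move=> l0; rewrite /adaptive_estimator /onebit_estimator.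
rewrite (_ : onebit_sum _ _ _ _ = 0) ?trmx0 ?scaler0 ?addr0//.
by rewrite /onebit_sum big1// => k _; rewrite l0 expr0n mul0r scale0r.
Qed.

(** With steps counted from 0, [ln k.+1%:R] is the logarithm of the mathematical index, so the first
    level is 0. At $p=1$ or $n=1$ a logarithm makes the right-hand side 0, and for $n=1$ the
    estimator is 0 whatever the covariance; hence both exceed 1. *)
Theorem theorem4 (R : realType) (K : R) (hK : 0 < K) :
  exists C1 C2 C : R, [/\ 0 < C1, 0 < C2, 0 < C &
  forall (p n : nat), (1 < p)%N -> (1 < n)%N ->
  forall (d0 : measure_display) (T0 : measurableType d0)
    (P0 : probability T0 R) (X0 : {RV P0 >-> p.-tuple R}),
  square_integrable_vec X0 -> mean_zero X0 -> subgaussian K X0 ->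
  forall (d : measure_display) (T : measurableType d) (P : probability T R)
    (X : 'I_n.+1 -> {RV P >-> p.-tuple R})
    (U Ub : 'I_n -> {RV P >-> p.-tuple R}),
  (forall j, same_law (X j) X0) ->
  (forall k, uniform_cube (U k)) ->
  (forall k, uniform_cube (Ub k)) ->
  mutually_independent (samples_and_dithers X U Ub) ->
  forall M : 'M[R]_p, (forall i j, 0 <= M i j <= 1) -> M^T = M ->
  forall lam : 'I_n -> T -> R,
  (forall k w, 0 <= lam k w) ->
  (forall k w, lam k w ^+ 2 =
     C1 * ln (k.+1%:R) * running_mean (fun j => colvec (X j w)) k ^+ 2) ->
  forall theta : R, C2 * Num.max (ln p%:R) (ln n%:R) <= theta ->
  let Sigma := covmx X0 in
  ((1 - 2 * expR (- theta))%:E <=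
   P [set w : T |
     (opnorm (hadamard M (adaptive_estimator X U Ub lam w) - hadamard M Sigma)
      <= C * (ln p%:R * ln n%:R *
         (theta `^ (5 / 2) * (norm12 M / Num.sqrt n%:R)
            * Num.sqrt (mx_norm Sigma) * Num.sqrt (opnorm Sigma)
          + theta ^+ 3 * (opnorm M / n%:R) * mx_norm Sigma)))%R])%E].
Proof.
have K2 : 0 < K ^+ 2 by exact: exprn_gt0.
have c00 : 0 < (32 * K ^+ 2)^-1 by rewrite invr_gt0; apply: mulr_gt0.
have C10 : 0 < 32 * K ^+ 2 / ((32 * K ^+ 2)^-1 / 4) ^+ 2.
  apply: divr_gt0; first by apply: mulr_gt0 => //; rewrite ltr0n.
  by apply: exprn_gt0; apply: divr_gt0 => //; rewrite ltr0n.
set C1 := 32 * K ^+ 2 / _ in C10.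
pose k3 := 16 / (32 * K ^+ 2)^-1 ^+ 2 + 2.
pose C4 := 8 * K ^+ 2 * C1 + 1.
pose C3 := (1 + 16 * K ^+ 2) * k3 / 2 + 2 * (C4 + 1) ^+ 2 + 16 * K ^+ 2 * k3.
have k30 : 0 < k3.
  by apply: addr_gt0 => //; apply: divr_gt0; [rewrite ltr0n|exact: exprn_gt0].
have C40 : 0 < C4.
  by apply: addr_gt0 => //; do 2 (apply: mulr_gt0 => //).
have C30 : 0 < C3.
  have h : 0 < 16 * K ^+ 2 by apply: mulr_gt0.
  apply: addr_gt0; last exact: mulr_gt0.
  apply: addr_gt0; last by apply: mulr_gt0 => //; apply: exprn_gt0; exact: addr_gt0.
  by apply: divr_gt0 => //; apply: mulr_gt0 => //; exact: addr_gt0.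
(* The value 10 gives $p,n\le e^{\theta/10}$ and, with $\log2\ge1/2$, also $\theta\ge5$. *)
exists C1, 10, (4 * (C3 + 3) * (C4 + 1)); split=> //.
  by apply: mulr_gt0; [apply: mulr_gt0 => //|]; exact: addr_gt0.
move=> p n p1 n1 d0 T0 P0 X0 sq _ sub d T P X U Ub law hU hUb indY M M01 sM
  lam lam0 lam_sqr theta htheta; cbv zeta.
have M0 i j : 0 <= M i j by case/andP: (M01 i j).
have law' j := same_law_tuple (law j) sq.
have e_ge0 : 0 <= 2 * expR (- theta) by apply: mulr_ge0 => //; exact: expR_ge0.
have rate0 := rate_ge0 hK p1 n1 M (covmx X0) htheta.
have mev := measurable_event hK p1 n1 U Ub sM lam0 lam_sqr htheta (covmx_sym X0).
(* If the covariance vanishes, all samples are almost surely 0; then so are the levels and the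
   estimator, and the error is 0. *)
have [s0|sn0] := eqVneq (mx_norm (covmx X0)) 0.
  pose F (ji : 'I_n.+1 * 'I_p) := [set w | tnth (X ji.1 w) ji.2 != 0].
  have mF ji : measurable (F ji).
    have : measurable_fun setT (fun w => tnth (X ji.1 w) ji.2 == 0).
      by apply: measurable_fun_eqr => //; exact: measurable_coord.
    move=> /(_ measurableT [set false] Logic.I); rewrite setTI.
    by congr measurable; apply/seteqP; split => x /=; rewrite /F /=; case: (_ == 0).
  have PF ji : (P (F ji) <= 0%:E)%E.
    have [_ _ h] := law' ji.1; rewrite h// (mx_norm_eq0 s0) mxE//.
  have [mb Pb] := finite_union_le (enum {: 'I_n.+1 * 'I_p}) mF PF.
  apply: prob_ge_compl mev mb _ _.
    by apply: le_trans Pb _; rewrite mulr0 lee_fin.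
  move=> w nb /=.
  have X0w j : colvec (X j w) = 0.
    apply/matrixP => i e; rewrite !mxE; apply/eqP/negPn/negP => h; apply: nb.
    by rewrite -bigcup_seq; exists (j, i); [rewrite /= mem_enum|].
  have l0 k : lam k w = 0.
    apply/eqP; rewrite -sqrf_eq0 lam_sqr /running_mean big1 ?mulr0 ?expr0n ?mulr0//.
    by move=> j _; rewrite X0w mx_norm0.
  have -> : hadamard M (adaptive_estimator X U Ub lam w)
      - hadamard M (covmx X0) = 0.
    by rewrite adaptive_estimator0// (mx_norm_eq0 s0) subrr.
  by rewrite opnorm0; exact: rate0.
have sp : 0 < mx_norm (covmx X0) by rewrite lt_def sn0 mx_norm_ge0.
(* A zero mask would make the scale [D] vanish; in that case the error is 0 everywhere. *)
have [MZ|MZ] := pselect (M = 0).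
  rewrite (_ : [set w | _] = setT); first by rewrite probability_setT lee_fin gerBl.
  apply/seteqP; split=> w //= _; move: rate0.
  by rewrite MZ !hadamard0l subrr opnorm0.
have [i0 Si0] := mx_norm_covmx_diag sq sn0.
apply: (error_bound hK p1 n1 indY hU hUb M0 sM lam0 lam_sqr htheta _ _ Si0 sp MZ).
- move=> j i; have [h _ _] := law' j; apply: h.
  exact: subgaussian_exp_moment hK sub sp.
- by move=> j i i'; have [_ h _] := law' j.
Qed.
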